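(* The self-adjoint extensions $\mathcal H$ of $\mathcal H_0$ whose domain satisfies the looping condition $\phi(L)=\phi(-L)$, this being the only constraint imposed on the vector of boundary values $\Gamma_0\mathbf U$ (that is, $\{\Gamma_0\mathbf U:\mathbf U\in D(\mathcal H)\}=\{x\in\mathbb C^{N+2}:x_1=x_2\}$), form an $(N+1)^2$-real-parameter family $\{\mathcal H_{a,\mathbf b,M'}\}$, parametrised by $a\in\mathbb R$, $\mathbf b\in\mathbb C^N$ and a Hermitian matrix $M'\in M_N(\mathbb C)$, where $\mathcal H_{a,\mathbf b,M'}$ acts as $-\frac{d^2}{dx^2}$ on each edge with domain $$D(\mathcal H_{a,\mathbf b,M'})=\Bigl\{\mathbf U\in H^2(\mathcal G)\ \Big|\ \phi(-L)=\phi(L),\ \ \phi'(-L)-\phi'(L)=2a\,\phi(-L)+\sqrt2\,\mathbf b^*\vec\psi(L),\ \ \vec\psi\,'(L)=\sqrt2\,\mathbf b\,\phi(-L)+M'\vec\psi(L)\Bigr\}.$$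
   Context: Let $L>0$, $N\ge1$. The looping-edge graph $\mathcal G$ has edges $e_0=[-L,L]$ and $e_j=[L,\infty)$, $j=1,\dots,N$. Functions on $\mathcal G$ are tuples $\mathbf U=(\phi,\psi_1,\dots,\psi_N)$ with $\phi$ on $[-L,L]$, $\psi_j$ on $[L,\infty)$ (complex valued). $L^2(\mathcal G)=L^2(-L,L)\oplus\bigoplus_{j=1}^NL^2(L,\infty)$ and $H^2(\mathcal G)=H^2(-L,L)\oplus\bigoplus_{j=1}^NH^2(L,\infty)$. $\mathcal H_0$ is the symmetric operator in $L^2(\mathcal G)$ acting as $-\frac{d^2}{dx^2}$ on each edge, with domain $C_0^\infty(-L,L)\oplus\bigoplus_{j=1}^NC_0^\infty(L,\infty)$. For $\mathbf U\in H^2(\mathcal G)$, $\Gamma_0\mathbf U=(\phi(-L),\phi(L),\psi_1(L),\dots,\psi_N(L))^T\in\mathbb C^{N+2}$, $\vec\psi(L)=(\psi_1(L),\dots,\psi_N(L))^T$, $\vec\psi\,'(L)=(\psi_1'(L),\dots,\psi_N'(L))^T$, and $\mathbf b^*$ is the conjugate transpose of $\mathbf b$. *)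

(* Defs.v *)
From HB Require Import structures.
From mathcomp Require Import all_boot all_order all_algebra.
From mathcomp Require Import complex.
From mathcomp Require Import all_classical all_reals all_analysis.

Set Implicit Arguments.
Unset Strict Implicit.
Unset Printing Implicit Defensive.

Import Order.TTheory GRing.Theory Num.Theory.
Import numFieldNormedType.Exports.

Local Open Scope classical_set_scope.
Local Open Scope ring_scope.
Local Open Scope complex_scope.
Local Open Scope sesquilinear_scope.

(* Complex-valued functions on an edge.  An edge is given by its interior, an
   open set I of R; a function on it is a total function R -> R[i] of which only
   the values on I matter, and elements of L^2(I) are functions up to
   almost-everywhere equality on I.  Measurability, integrals, derivatives and
   continuity are taken on real and imaginary parts. *)
Section Edge.
Variables (R : realType) (I : set R).
Local Notation C := R[i].
Local Notation mu := (@lebesgue_measure R).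

Definition rePart (f : R -> C) (x : R) : R := complex.Re (f x).
Definition imPart (f : R -> C) (x : R) : R := complex.Im (f x).

Definition cintegral (f : R -> C) : C :=
  (\int[mu]_(x in I) rePart f x) +i* (\int[mu]_(x in I) imPart f x).

Definition L2 (f : R -> C) : Prop :=
  [/\ measurable_fun I (rePart f), measurable_fun I (imPart f) &
      mu.-integrable I (EFin \o (fun x => rePart f x ^+ 2 + imPart f x ^+ 2))].

Definition cderiv (n : nat) (f : R -> C) (x : R) : C :=
  (derive1n n (rePart f) x) +i* (derive1n n (imPart f) x).

Definition smooth (f : R -> R) : Prop := forall n x, derivable (derive1n n f) x 1.

(* C_0^oo(I), extended by zero to the whole line. *)
Definition test_fun (eta : R -> C) : Prop :=
  [/\ smooth (rePart eta), smooth (imPart eta) &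
      exists K : set R, [/\ compact K, K `<=` I & forall x, ~ K x -> eta x = 0]].

Definition is_weak_deriv (n : nat) (f g : R -> C) : Prop :=
  forall eta, test_fun eta ->
    cintegral (fun x => f x * cderiv n eta x) =
    (-1) ^+ n * cintegral (fun x => g x * eta x).

Definition H2 (f : R -> C) : Prop :=
  L2 f /\ forall n, (n <= 2)%N -> exists g, L2 g /\ is_weak_deriv n f g.

(* A representative of the n-th weak derivative (zero if there is none in L^2). *)
Definition wderiv (n : nat) (f : R -> C) : R -> C :=
  xget (fun=> 0) [set g | L2 g /\ is_weak_deriv n f g].

(* The value at c, a point of the closed edge, of the representative of f that
   is continuous up to the boundary (zero if there is none). *)
Definition is_trace (f : R -> C) (c : R) (z : C) : Prop :=
  exists f0 : R -> C,
    [/\ {within closure I, continuous (rePart f0)},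
        {within closure I, continuous (imPart f0)},
        ae_eq mu I f f0 & f0 c = z].

Definition trace (f : R -> C) (c : R) : C := xget 0 [set z | is_trace f c z].

End Edge.

Section LoopingEdgeGraph.
Variables (R : realType) (L : R) (N : nat).
Local Notation C := R[i].
Local Notation mu := (@lebesgue_measure R).

Definition loopE : set R := `]- L, L[%classic.
Definition legE : set R := `]L, +oo[%classic.

Record gfun := GFun { phi : R -> C; psi : 'I_N -> R -> C }.

Definition gmap2 (op : (R -> C) -> (R -> C) -> (R -> C)) (U V : gfun) : gfun :=
  GFun (op (phi U) (phi V)) (fun j => op (psi U j) (psi V j)).
Definition gzero : gfun := GFun (fun=> 0) (fun _ _ => 0).
(* c U + V *)
Definition gaxpy (c : C) : gfun -> gfun -> gfun :=
  gmap2 (fun f g x => c * f x + g x).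
Definition gsub : gfun -> gfun -> gfun := gmap2 (fun f g x => f x - g x).

Definition gL2 (U : gfun) : Prop :=
  L2 loopE (phi U) /\ forall j, L2 legE (psi U j).
Definition gH2 (U : gfun) : Prop :=
  H2 loopE (phi U) /\ forall j, H2 legE (psi U j).

(* Equality in L^2(G). *)
Definition eqG (U V : gfun) : Prop :=
  ae_eq mu loopE (phi U) (phi V) /\ forall j, ae_eq mu legE (psi U j) (psi V j).

Definition ginner (U V : gfun) : C :=
  cintegral loopE (fun x => phi U x * (phi V x)^*) +
  \sum_(j < N) cintegral legE (fun x => psi U j x * (psi V j x)^*).
Definition gL2norm (U : gfun) : R := Num.sqrt (complex.Re (ginner U U)).

(* Unbounded operators in L^2(G) are represented by their graphs, which are
   saturated for eqG, so that equality of operators is equality of graphs. *)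
Definition opgraph := set (gfun * gfun).

Definition gdom (A : opgraph) : set gfun := [set U | exists V, A (U, V)].

Definition is_operator (A : opgraph) : Prop :=
  [/\ forall U V, A (U, V) -> gL2 U /\ gL2 V,
      forall U V U' V', A (U, V) -> gL2 U' -> gL2 V' -> eqG U U' -> eqG V V' ->
        A (U', V'),
      A (gzero, gzero),
      forall c U V U' V', A (U, V) -> A (U', V') ->
        A (gaxpy c U U', gaxpy c V V') &
      forall U V V', A (U, V) -> A (U, V') -> eqG V V'].

Definition densely_defined (A : opgraph) : Prop :=
  forall U (e : R), gL2 U -> 0 < e -> exists2 V, gdom A V & gL2norm (gsub U V) < e.

Definition adjoint (A : opgraph) : opgraph :=
  [set VW | [/\ gL2 VW.1, gL2 VW.2 &
     forall U Z, A (U, Z) -> ginner Z VW.1 = ginner U VW.2]].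

Definition self_adjoint (A : opgraph) : Prop :=
  [/\ is_operator A, densely_defined A & A = adjoint A].

Definition H0 : opgraph :=
  [set UV | [/\ gL2 UV.1, gL2 UV.2 &
     exists T : gfun,
       [/\ test_fun loopE (phi T), forall j, test_fun legE (psi T j),
           eqG UV.1 T &
           eqG UV.2 (GFun (fun x => - cderiv 2 (phi T) x)
                          (fun j x => - cderiv 2 (psi T j) x))]]].

Definition phi_at (U : gfun) (c : R) : C := trace loopE (phi U) c.
Definition phi'_at (U : gfun) (c : R) : C :=
  trace loopE (wderiv loopE 1 (phi U)) c.
Definition psi_L (U : gfun) : 'cV[C]_N := \col_j trace legE (psi U j) L.
Definition psi'_L (U : gfun) : 'cV[C]_N :=
  \col_j trace legE (wderiv legE 1 (psi U j)) L.

Definition Gamma0 (U : gfun) : 'cV[C]_N.+2 :=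
  col_mx (const_mx (phi_at U (- L)) : 'cV_1)
    (col_mx (const_mx (phi_at U L) : 'cV_1) (psi_L U)).

Definition weak_laplacian (U : gfun) : gfun :=
  GFun (fun x => - wderiv loopE 2 (phi U) x)
       (fun j x => - wderiv legE 2 (psi U j) x).

Definition looping_extension (A : opgraph) : Prop :=
  [/\ self_adjoint A, H0 `<=` A &
      Gamma0 @` gdom A = [set x : 'cV[C]_N.+2 | x 0 0 = x 1 0]].

Definition param := (R * 'cV[C]_N * 'M[C]_N)%type.

Definition param_set : set param := [set p | p.2 \is hermsymmx].

Definition Dpar (a : R) (b : 'cV[C]_N) (M : 'M[C]_N) : set gfun :=
  [set U | [/\ gH2 U,
     phi_at U (- L) = phi_at U L,
     phi'_at U (- L) - phi'_at U L =
       (2 * a)%:C * phi_at U (- L) +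
       (Num.sqrt 2)%:C * (b ^t* *m psi_L U) 0 0 &
     psi'_L U = ((Num.sqrt 2)%:C * phi_at U (- L)) *: b + M *m psi_L U]].

Definition Hpar (p : param) : opgraph :=
  [set UV | [/\ Dpar p.1.1 p.1.2 p.2 UV.1, gL2 UV.2 &
                eqG UV.2 (weak_laplacian UV.1)]].

Definition real_linear (n : nat) (theta : 'rV[R]_n -> param) : Prop :=
  forall (s : R) (u v : 'rV[R]_n),
    theta (s *: u + v) =
    (s * (theta u).1.1 + (theta v).1.1,
     s%:C *: (theta u).1.2 + (theta v).1.2,
     s%:C *: (theta u).2 + (theta v).2).

End LoopingEdgeGraph.

(* Main.v *)
Require Import Defs.
From mathcomp Require Import all_boot all_order all_algebra.
From mathcomp Require Import complex.
From mathcomp Require Import all_classical all_reals all_analysis.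
From mathcomp Require Import ring lra measurable_realfun.

(* On each edge a weak second derivative in L^2 makes f and f' absolutely
   continuous up to the endpoints, so Green's formula holds with the traces of f
   and f' as boundary terms: <-U'', V> - <U, -V''> = sform (U's data) (V's data),
   a sesquilinear form in the boundary data (phi(-L), phi'(-L), phi(L), phi'(L),
   psi(L), psi'(L)), and every such tuple is the data of some U in H^2(G).
   Testing the adjoint relation against C_0^oo shows that D(A) is contained in
   H^2(G) for every self-adjoint A extending H0, that A acts as -d^2/dx^2, and
   that sform vanishes on the boundary data of D(A).  The boundary conditions of
   Hpar are exactly the maximal isotropic subspaces of sform whose Gamma0-part is
   {x_1 = x_2}: pairing with the vector of data (1, 0) gives the condition on
   phi'(-L) - phi'(L), whose coefficients define a and b; pairing with (0, e_j)
   gives the condition on psi_j', and isotropy makes a real and M Hermitian. *)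

Import Order.TTheory GRing.Theory Num.Theory.
Local Open Scope classical_set_scope.
Local Open Scope ring_scope.

Set Implicit Arguments.
Unset Strict Implicit.
Unset Printing Implicit Defensive.

Import numFieldNormedType.Exports.

(** Everything on an edge is defined through weak derivatives of almost-everywhere classes, so no
    trace is known until a continuous representative is produced. Representatives are built on the
    whole line as iterated integrals from the left endpoint of the edge, with the second derivative
    extended by zero off the edge. They are then continuous everywhere, a trace becomes a plain
    value, and the bounded loop and the unbounded legs share one theory. The legs need extra work in
    two places: square integrability of f' is not automatic there, and Green's formula must receive
    nothing from infinity. Test functions serve twice, to identify weak derivatives and to show that
    domains are dense; both uses rest on explicit plateaus made from exp(-1/x). The factors 2 and
    square root of 2 in the boundary conditions are normalisations: they are invertible, so the
    parameters stay unique. The count $(N+1)^2 = 1 + 2N + N^2$ adds up a real number, a complex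
    vector and a Hermitian matrix. *)

(** * Smooth functions on the line and their closure properties *)

Section Smooth.
Variable R : realType.
Implicit Types f g : R -> R.

Lemma derive1nSr n f : derive1n n.+1 f = derive1n n (derive1 f).
Proof. by rewrite /derive1n iterSr. Qed.

Lemma is_derive_derive1 f (x d : R) : is_derive x 1 f d -> derive1 f x = d.
Proof. by move=> h; rewrite derive1E derive_val. Qed.

Lemma derivable_derive1 f (x : R) : derivable f x 1 -> is_derive x 1 f (derive1 f x).
Proof. by move=> h; rewrite derive1E; exact: derivableP. Qed.

(** Spares all formulas for n-th derivatives: it is enough to exhibit a class of derivable functions
    stable under a single [derive1]. *)
Lemma smooth_coind (S : (R -> R) -> Prop) f :
  (forall g, S g -> (forall x : R, derivable g x 1) /\ S (derive1 g)) ->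
  S f -> smooth f.
Proof.
move=> HS Sf n; elim: n f Sf => [|n IH] f Sf x; first exact: (HS _ Sf).1.
by rewrite derive1nSr; apply: IH; exact: (HS _ Sf).2.
Qed.

Lemma smooth_derivable f (x : R) : smooth f -> derivable f x 1.
Proof. by move=> /(_ 0%N x). Qed.

Lemma smooth_derive1 f : smooth f -> smooth (derive1 f).
Proof. by move=> sf n x; rewrite -derive1nSr; exact: sf. Qed.

Lemma smooth_is_derive f (x : R) : smooth f -> is_derive x 1 f (derive1 f x).
Proof. by move=> sf; exact/derivable_derive1/smooth_derivable. Qed.

Lemma derivable_smooth f :
  (forall x : R, derivable f x 1) -> smooth (derive1 f) -> smooth f.
Proof. by move=> df sf [|n] x //; rewrite derive1nSr; exact: sf. Qed.

Lemma smooth_continuous f : smooth f -> continuous f.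
Proof.
move=> sf x; apply: differentiable_continuous.
by apply/derivable1_diffP; exact: smooth_derivable.
Qed.

Lemma smooth_cst c : smooth (fun _ : R => c).
Proof.
apply: (@smooth_coind (fun f => exists c, f = fun=> c)); last by exists c.
move=> _ [d ->]; split=> [x|]; first exact: derivable_cst.
by exists 0; apply/funext => x; exact: derive1_cst.
Qed.

Lemma smooth_id : smooth (fun x : R => x).
Proof.
apply: derivable_smooth => [x|]; first exact: derivable_id.
have -> : derive1 (fun x : R => x) = fun=> 1.
  by apply/funext => x; rewrite derive1E derive_id.
exact: smooth_cst.
Qed.

(** A class suited to [smooth_coind]: differentiating a product or an inverse leaves that form, but
    stays within expressions built from smooth functions by these three operations. *)
Inductive smooth_alg : (R -> R) -> Prop :=
| SABase f : smooth f -> smooth_alg f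
| SAD f g : smooth_alg f -> smooth_alg g -> smooth_alg (fun x => f x + g x)
| SAM f g : smooth_alg f -> smooth_alg g -> smooth_alg (fun x => f x * g x)
| SAV f : (forall x, f x != 0) -> smooth_alg f -> smooth_alg (fun x => (f x)^-1).

Lemma smooth_algP f : smooth_alg f -> smooth f.
Proof.
apply: smooth_coind => {}f.
elim=> {f} [f sf|f g _ [df sf] _ [dg sg]|f g Sf [df sf] Sg [dg sg]|f f0 Sf [df sf]].
- by split=> [x|]; [exact: smooth_derivable|exact/SABase/smooth_derive1].
- have h (x : R) : is_derive x 1 (fun x => f x + g x) (derive1 f x + derive1 g x).
    by apply: is_deriveD; exact: derivable_derive1.
  split=> [x|]; first by case: (h x).
  rewrite (_ : derive1 _ = fun x => derive1 f x + derive1 g x); first exact: SAD.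
  by apply/funext => x; exact: is_derive_derive1.
- have h (x : R) : is_derive x 1 (fun x => f x * g x) (f x * derive1 g x + g x * derive1 f x).
    by apply: is_deriveM; exact: derivable_derive1.
  split=> [x|]; first by case: (h x).
  rewrite (_ : derive1 _ = fun x => f x * derive1 g x + g x * derive1 f x).
    by apply: SAD; apply: SAM.
  by apply/funext => x; exact: is_derive_derive1.
(* The derivative is spelled with a constant factor [-1] and repeated inverses because the closure
   constructors of [smooth_alg] are only sums, products and inverses. *)
- have h (x : R) : is_derive x 1 (fun x => (f x)^-1) ((-1) * ((f x)^-1 * (f x)^-1 * derive1 f x)).
    rewrite (_ : -1 * _ = - (f x) ^- 2 *: derive1 f x).
      by apply: is_deriveV => //; exact: derivable_derive1.
    by rewrite /GRing.scale/= expr2 invfM; ring.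
  split=> [x|]; first by case: (h x).
  rewrite (_ : derive1 _ = fun x => (-1) * ((f x)^-1 * (f x)^-1 * derive1 f x)).
    apply: SAM; first exact/SABase/smooth_cst.
    by apply: SAM => //; apply: SAM; exact: SAV.
  by apply/funext => x; exact: is_derive_derive1.
Qed.

Lemma smoothD f g : smooth f -> smooth g -> smooth (fun x => f x + g x).
Proof. by move=> sf sg; apply: smooth_algP; apply: SAD; exact: SABase. Qed.

Lemma smoothM f g : smooth f -> smooth g -> smooth (fun x => f x * g x).
Proof. by move=> sf sg; apply: smooth_algP; apply: SAM; exact: SABase. Qed.

Lemma smoothV f : (forall x, f x != 0) -> smooth f -> smooth (fun x => (f x)^-1).
Proof. by move=> f0 sf; apply: smooth_algP; apply: SAV => //; exact: SABase. Qed.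

Lemma smoothZ c f : smooth f -> smooth (fun x => c * f x).
Proof. by move=> sf; apply: smoothM; [exact: smooth_cst|exact: sf]. Qed.

Lemma smoothN f : smooth f -> smooth (fun x => - f x).
Proof.
move=> sf; rewrite (_ : (fun _ => _) = fun x => -1 * f x); first exact: smoothZ.
by apply/funext => x; rewrite mulN1r.
Qed.

Lemma smoothB f g : smooth f -> smooth g -> smooth (fun x => f x - g x).
Proof. by move=> sf sg; apply: smoothD; [exact: sf|exact: smoothN]. Qed.

Lemma is_derive_affine a b (x : R) : is_derive x 1 (fun x => a * x + b) a.
Proof.
have h : is_derive x 1 ((a \*: (@id R)) + cst b) (a *: 1 + 0).
  by apply: is_deriveD; apply: is_deriveZ.
by apply: is_derive_eq; rewrite addr0 /GRing.scale/= mulr1.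
Qed.

Lemma smooth_affine f a b : smooth f -> smooth (fun x => f (a * x + b)).
Proof.
(* The scalar [c] belongs to the class because the chain rule produces a further factor [a] at each
   differentiation. *)
move=> sf; apply: (@smooth_coind
  (fun g => exists f c, smooth f /\ g = fun x => c * f (a * x + b))); last first.
  by exists f, 1; split=> //; apply/funext => x; rewrite mul1r.
move=> _ [{sf}f [c [sf ->]]].
have h (x : R) : is_derive x 1 (fun x => c * f (a * x + b)) (c * a * derive1 f (a * x + b)).
  rewrite (_ : _ * _ * _ = c *: (derive1 f (a * x + b) * a)); last first.
    by rewrite /GRing.scale/=; ring.
  apply: (@is_deriveZ _ _ _ (f \o (fun x => a * x + b))).
  by apply: is_derive1_comp; [exact: smooth_is_derive|exact: is_derive_affine].
split=> [x|]; first by case: (h x).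
exists (derive1 f), (c * a); split; first exact: smooth_derive1.
by apply/funext => x; exact: is_derive_derive1.
Qed.

End Smooth.

(** * A smooth step built from exp(-1/x) *)

Section SmoothStep.
Variable R : realType.
Implicit Types (p : {poly R}) (x y : R).

(** Polynomials in 1/x are carried along because the derivatives of exp(-1/x) produce them; the
    family is closed under differentiation, at the origin included. *)
Definition flat p x : R := if 0 < x then p.[x^-1] * expR (- x^-1) else 0.

(** The extra power [y ^+ n] makes the induction on [p] work: peeling off a coefficient in Horner
    form leaves one more factor [y], absorbed by the induction hypothesis at [n.+1]. The remaining
    monomial is bounded through the exponential series, with constant n!. *)
Lemma horner_expRN_bounded p n : exists2 C : R, 0 <= C &
  forall y, 0 < y -> `|p.[y]| * y ^+ n * expR (- y) <= C.
Proof.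
elim/poly_ind: p n => [|p c IH] n.
  by exists 0 => // y _; rewrite horner0 normr0 !mul0r.
have [C C0 HC] := IH n.+1.
exists (C + `|c| * n`!%:R) => [|y y0]; first by rewrite addr_ge0 ?mulr_ge0.
rewrite hornerMXaddC.
have yn : y ^+ n * expR (- y) <= n`!%:R.
  rewrite expRN ler_pdivrMr ?expR_gt0//.
  case: n {HC} => [|n]; first by rewrite expr0 fact0 mul1r; apply: le_trans (expR_ge1Dx y); lra.
  have := expR_ge1Dxn n (ltW y0).
  have f0 : (0 : R) < n.+1`!%:R by rewrite ltr0n fact_gt0.
  move=> h; rewrite mulrC -ler_pdivrMr//; apply: le_trans h; lra.
have := HC y y0.
rewrite exprS.
have -> : `|p.[y]| * (y * y ^+ n) * expR (- y) = `|p.[y] * y| * y ^+ n * expR (- y).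
  by rewrite normrM (gtr0_norm y0); ring.
move=> h; apply: le_trans (lerD h (ler_wpM2l (normr_ge0 c) yn)).
rewrite [`|c| * _]mulrA -mulrDl -mulrDl !ler_wpM2r ?expR_ge0 ?exprn_ge0 ?(ltW y0)//.
exact: ler_normD.
Qed.

Lemma flat_le p : exists2 C : R, 0 <= C & forall x, `|flat p x| <= C * `|x|.
Proof.
have [C C0 HC] := horner_expRN_bounded p 1; exists C => // x.
rewrite /flat; case: ifPn => [x0|_]; last by rewrite normr0 mulr_ge0.
have xV : 0 < x^-1 by rewrite invr_gt0.
rewrite (gtr0_norm x0) -ler_pdivrMr// normrM (ger0_norm (expR_ge0 _)).
apply: le_trans (HC _ xV); rewrite expr1; lra.
Qed.

Lemma flat_continuous0 p : {for 0, continuous (flat p)}.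
Proof.
have [C C0 HC] := flat_le p.
have f0 : flat p 0 = 0 by rewrite /flat ltxx.
apply/cvgrPdist_le => e e0; rewrite f0.
have C1 : 0 < C + 1 by lra.
near=> x; rewrite sub0r normrN.
apply: le_trans (HC x) _.
have : `|x| <= e / (C + 1).
  near: x; have := @nbhs0_le R R^o (e / (C + 1)); apply; exact: divr_gt0.
rewrite ler_pdivlMr// => h.
have := normr_ge0 x; nra.
Unshelve. all: by end_near. Qed.

(** With $y = 1/x$, the derivative of $p(1/x) e^{-1/x}$ is $y^2 (p(y) - p'(y)) e^{-y}$. *)
Definition flat_der p : {poly R} := 'X ^+ 2 * (p - p^`()).

Lemma is_derive_flat p x : is_derive x (1 : R) (flat p) (flat (flat_der p) x).
Proof.
have [x0|x0|<-] := ltgtP 0 x.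
- apply: (@near_eq_is_derive _ _ _ (fun y => p.[y^-1] * expR (- y^-1))).
    near=> y; rewrite /flat ifT//; near: y; exact: lt_nbhsr.
  have dV : is_derive x 1 (fun y : R => y^-1) (- x ^- 2 *: 1).
    by apply: is_deriveV; rewrite ?gt_eqF//; exact: is_derive_id.
  have d1 : is_derive x 1 (horner p \o (fun y : R => y^-1)) (p^`().[x^-1] * (- x ^- 2 *: 1)).
    exact: is_derive1_comp.
  have d2 : is_derive x 1 (expR \o (fun y : R => - y^-1)) (expR (- x^-1) * - (- x ^- 2 *: 1)).
    by apply: is_derive1_comp; exact: is_deriveN.
  apply: (is_derive_eq (is_deriveM d1 d2)).
  rewrite /flat x0 /flat_der !hornerE /GRing.scale/= exprVn; ring.
- apply: (@near_eq_is_derive _ _ _ (fun=> 0)).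
    near=> y; rewrite /flat ifF//; apply/negbTE; rewrite -leNgt ltW//.
    by near: y; exact: lt_nbhsl.
  rewrite (_ : flat (flat_der p) x = 0); last by rewrite /flat ltNge (ltW x0).
  exact: is_derive_cst.
(* At the origin the difference quotient belongs to the same family: dividing [flat p] by x amounts
   to multiplying [p] by the variable, and the result is continuous with value 0 there. *)
- apply/is_derive1_caratheodory; exists (flat (p * 'X)); split.
  + move=> z; rewrite {2}/flat ltxx !subr0 /flat; case: ifPn => z0; last by rewrite mul0r.
    by rewrite !hornerE -!mulrA; congr (_ * _); rewrite mulrCA mulVf ?mulr1// gt_eqF.
  + exact: flat_continuous0.
  + by rewrite /flat ltxx.
Unshelve. all: by end_near. Qed.

Lemma smooth_flat p : smooth (flat p).
Proof.
apply: (@smooth_coind _ (fun f => exists p, f = flat p)); last by exists p.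
move=> _ [q ->]; split=> [x|]; first by case: (is_derive_flat q x).
exists (flat_der q); apply/funext => x; apply: is_derive_derive1.
exact: is_derive_flat.
Qed.

Let f1 := flat 1.

Let f1_gt0 x : 0 < x -> 0 < f1 x.
Proof. by move=> x0; rewrite /f1 /flat x0 hornerC mul1r expR_gt0. Qed.

Let f1_eq0 x : x <= 0 -> f1 x = 0.
Proof. by move=> x0; rewrite /f1 /flat ltNge x0. Qed.

Let f1_ge0 x : 0 <= f1 x.
Proof. by have [/f1_eq0->|/f1_gt0/ltW] := leP x 0. Qed.

Let den_gt0 x : 0 < f1 x + f1 (1 - x).
Proof.
have [x0|x0] := leP x 0; first by rewrite ltr_wpDl// f1_gt0//; lra.
by rewrite ltr_pwDl// f1_gt0.
Qed.

(** The denominator is positive because [x] and [1 - x] cannot both be nonpositive; the value is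
    exactly 1 from 1 on, where [flat 1 (1 - x)] vanishes. *)
Definition step x : R := flat 1 x * (flat 1 x + flat 1 (1 - x))^-1.

Lemma smooth_step : smooth step.
Proof.
have s1 : smooth (flat (1 : {poly R})) by exact: smooth_flat.
have s2 : smooth (fun x => flat 1 (1 - x)).
  rewrite (_ : (fun _ => _) = fun x => flat 1 (-1 * x + 1)); first exact: smooth_affine.
  by apply/funext => x; congr flat; ring.
apply: smoothM; first exact: s1.
apply: smoothV; last exact: smoothD.
by move=> x; rewrite gt_eqF// den_gt0.
Qed.

Lemma step_le0 x : x <= 0 -> step x = 0.
Proof. by move=> x0; rewrite /step -/f1 f1_eq0// mul0r. Qed.

Lemma step_ge1 x : 1 <= x -> step x = 1.
Proof.
move=> x1; rewrite /step -/f1 (@f1_eq0 (1 - x)); last by lra.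
by rewrite addr0 divff// gt_eqF// f1_gt0//; lra.
Qed.

Lemma step_ge0 x : 0 <= step x.
Proof. by rewrite mulr_ge0 ?invr_ge0 ?(ltW (den_gt0 x))//; exact: f1_ge0. Qed.

Lemma step_le1 x : step x <= 1.
Proof.
rewrite ler_pdivrMr ?mul1r; last exact: den_gt0.
by rewrite lerDl; exact: f1_ge0.
Qed.

Lemma step_gt0 x : 0 < x -> 0 < step x.
Proof. by move=> x0; rewrite mulr_gt0 ?invr_gt0 ?den_gt0//; exact: f1_gt0. Qed.

End SmoothStep.

(** * Primitives of locally integrable functions and integration by parts *)

Section Primitive.
Variable R : realType.
Implicit Types (f g F G : R -> R) (a b x y : R).
Notation mu := (@lebesgue_measure R).

(** Asked on every segment of the line, not only of an edge: functions on an edge enter after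
    extension by zero. *)
Definition loci f := forall x y, mu.-integrable `[x, y] (EFin \o f).

(** Not an oriented integral: it is 0 to the left of [a], so it is meaningful as an antiderivative
    only to the right of [a]. *)
Definition prim a f x : R := \int[mu]_(t in `[a, x]) f t.

Lemma loci_continuous f : continuous f -> loci f.
Proof.
move=> cf x y; apply: continuous_compact_integrable; first exact: segment_compact.
exact: continuous_subspaceT.
Qed.

Lemma loci_measurable f : loci f -> measurable_fun setT f.
Proof.
move=> lf; rewrite (_ : setT = \bigcup_n `[- n%:R, n%:R]%classic :> set R).
  apply/measurable_fun_bigcup => // n.
  by have /integrableP[/measurable_EFinP] := lf (- n%:R) n%:R.
apply/seteqP; split=> // x _; exists (Num.truncn `|x|).+1 => //=.
by rewrite in_itv/= -ler_norml ltW// truncnS_gt.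
Qed.

Lemma loci_cst c : loci (cst c).
Proof. by apply: loci_continuous => x; exact: cvg_cst. Qed.

Lemma RintegrableZ (D : set R) k f : measurable D -> mu.-integrable D (EFin \o f) ->
  mu.-integrable D (EFin \o (fun x => k * f x)).
Proof. by move=> mD fi; exact: (@integrableZl _ _ _ mu D mD k _ fi). Qed.

Lemma RintegrableD (D : set R) f g : measurable D -> mu.-integrable D (EFin \o f) ->
  mu.-integrable D (EFin \o g) -> mu.-integrable D (EFin \o (fun x => f x + g x)).
Proof. by move=> mD fi gi; exact: (@integrableD _ _ _ mu D mD _ _ fi gi). Qed.

Lemma RintegrableB (D : set R) f g : measurable D -> mu.-integrable D (EFin \o f) ->
  mu.-integrable D (EFin \o g) -> mu.-integrable D (EFin \o (fun x => f x - g x)).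
Proof. by move=> mD fi gi; exact: (@integrableB _ _ _ mu D mD _ _ fi gi). Qed.

Lemma lociD f g : loci f -> loci g -> loci (fun x => f x + g x).
Proof. by move=> lf lg x y; exact: RintegrableD. Qed.

Lemma lociB f g : loci f -> loci g -> loci (fun x => f x - g x).
Proof. by move=> lf lg x y; exact: RintegrableB. Qed.

Lemma lociMc f g : loci f -> continuous g -> loci (fun x => f x * g x).
Proof.
move=> lf cg x y.
have := @integrableMl _ _ _ mu `[x, y]%classic (measurable_itv _) (EFin \o f) g (lf x y).
apply; first by apply: measurable_funTS; exact: continuous_measurable_fun.
have cpt : compact (g @` (`[x, y]%classic : set R)).
  apply: continuous_compact; first exact: continuous_subspaceT.
  exact: segment_compact.
have [M [Mr HM]] := compact_bounded cpt.
by exists M; split=> // N MN z xyz /=; apply: HM MN _ _; exists z.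
Qed.

Lemma loci_locally f : loci f -> locally_integrable setT f.
Proof.
move=> lf; split; [exact: loci_measurable|exact: openT|].
move=> K _ cK; have [M [_ MK]] := compact_bounded cK.
have KS : K `<=` `[- (M + 1), M + 1]%classic.
  by move=> z /MK Hz; rewrite /= in_itv/= -ler_norml; apply: Hz; rewrite ltrDl.
have /integrableP[mf] := lf (- (M + 1)) (M + 1).
apply: le_lt_trans; apply: ge0_subset_integral => //=; first exact: compact_measurable.
by apply/measurable_EFinP; apply: measurableT_comp => //; exact/measurable_EFinP.
Qed.

Lemma prim_lt a f x : x < a -> prim a f x = 0.
Proof. by move=> xa; rewrite /prim set_itv_ge ?Rintegral_set0// bnd_simp -ltNge. Qed.

Lemma primaa a f : prim a f a = 0.
Proof. by rewrite /prim set_itv1 Rintegral_set1. Qed.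

Lemma primB a f x y : loci f -> a <= x -> x <= y ->
  prim a f y - prim a f x = \int[mu]_(t in `[x, y]) f t.
Proof.
move=> lf ax xy; rewrite /prim Rintegral_itvB//.
rewrite Rintegral_itv_obnd_cbnd//.
by apply: integrableS (lf x y) => //; exact: subset_itv_oc_cc.
Qed.

Lemma prim_continuous a f : loci f -> continuous (prim a f).
Proof.
move=> lf x; have [xa|ax] := ltP x a.
  apply: (@near_cst_continuous _ _ 0); near=> y; rewrite prim_lt//.
  by near: y; exact: lt_nbhsl.
(* Cutting [f] off at [a] and integrating from [a - 1] makes [x] interior to the interval of
   integration even when [x = a], without changing the values. *)
pose g := f \_ `[a, x + 1].
have ig : mu.-integrable `[a - 1, x + 1] (EFin \o g).
  rewrite -restrict_EFin; apply/integrable_restrict => //=.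
  apply: (integrableS _ _ _ (lf a (x+1))); [exact: measurable_itv|exact: measurableI|exact: subIsetr].
have xi : x \in `]a - 1, x + 1[ by rewrite in_itv/=; apply/andP; split; lra.
have ax1 : a - 1 < x + 1 by lra.
have [cc _ _] := (continuous_within_itvP _ ax1).1
  (parameterized_integral_continuous (ltW ax1) ig).
have primE : \near x, parameterized_integral mu (a - 1) x g = prim a f x.
  near=> y; rewrite /parameterized_integral /prim /g -Rintegral_mkcondr.
  congr Rintegral.
  apply/seteqP; split => z /=; rewrite !in_itv/=.
    by move=> [/andP[_ ->] /andP[->]].
  move=> /andP[az zy]; rewrite az zy; split; first by lra.
  rewrite (le_trans zy)//; rewrite ltW//; near: y; apply: lt_nbhsl; lra.
by apply: cvg_trans (near_eq_cvg primE) _; rewrite -(nbhs_singleton primE); exact: cc.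
Unshelve. all: by end_near. Qed.

Lemma EFin_Rintegral (D : set R) f : measurable D -> mu.-integrable D (EFin \o f) ->
  (\int[mu]_(x in D) (f x)%:E)%E = (\int[mu]_(x in D) f x)%:E.
Proof. by move=> mD fi; rewrite /Rintegral fineK//; exact: integrable_fin_num. Qed.

Lemma integrable_patch f a b : loci f ->
  mu.-integrable setT (EFin \o (f \_ `[a, b])).
Proof.
move=> lf; rewrite -restrict_EFin.
by apply/integrable_restrict => //=; rewrite setTI; exact: lf.
Qed.

Lemma mem_itvcc a b x : (x \in `[a, b]%classic) = (a <= x <= b).
Proof. by apply/idP/idP; rewrite inE/= in_itv/=. Qed.

(** Fubini on the triangle $y \le x$ of the square over [[a, b]]: the primitives are differentiable
    only almost everywhere, so the usual argument by the product rule is not at hand. *)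
Lemma prim_ibp f g a b : loci f -> loci g -> a <= b ->
  \int[mu]_(x in `[a, b]) (f x * prim a g x) +
  \int[mu]_(x in `[a, b]) (g x * prim a f x) = prim a f b * prim a g b.
Proof.
move=> lf lg ab.
(* Primes mark the cut-offs to [[a, b]], not derivatives. *)
pose f' := f \_ `[a, b]; pose g' := g \_ `[a, b].
have if' : mu.-integrable setT (EFin \o f') := integrable_patch a b lf.
have ig' : mu.-integrable setT (EFin \o g') := integrable_patch a b lg.
have mf' : measurable_fun setT f' by apply/measurable_EFinP; case/integrableP : if'.
have mg' : measurable_fun setT g' by apply/measurable_EFinP; case/integrableP : ig'.
pose D := [set z : R * R | z.2 <= z.1].
have mD : measurable D.
  have := measurable_fun_ler (@measurable_snd _ _ R R) (@measurable_fst _ _ R R).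
  move=> /(_ measurableT [set true] I); rewrite setTI.
  by congr (_ _); apply/seteqP; split => z.
pose P (z : R * R) : \bar R := (f' z.1 * g' z.2)%:E.
pose H (z : R * R) : \bar R := (f' z.1 * g' z.2 * \1_D z)%:E.
have mP : measurable_fun setT P.
  apply/measurable_EFinP; apply: measurable_funM.
    by apply: (measurableT_comp mf'); exact: measurable_fst.
  by apply: (measurableT_comp mg'); exact: measurable_snd.
have mH : measurable_fun setT H.
  apply/measurable_EFinP; apply: measurable_funM; first exact/measurable_EFinP.
  exact: measurable_indic.
(* The integral of $|g'|$ is a finite constant [c], which factors out of the iterated integral of
   $|f'(x) g'(y)|$. *)
have iP : (mu \x mu)%E.-integrable setT P.
  apply/integrable12ltyP => //.
  have /integrableP[_ cg] := ig'; have /integrableP[_ cf] := if'.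
  set c := (X in (X < _)%E) in cg.
  have c0 : (0 <= c)%E by exact: integral_ge0.
  have cfin : c \is a fin_num by rewrite ge0_fin_numE.
  rewrite (_ : (fun x => _) = (fun x => c * `|(EFin \o f') x|)%E); last first.
    apply/funext => x; rewrite /P /=.
    under eq_integral do rewrite normrM EFinM.
    rewrite ge0_integralZl//.
    - by rewrite muleC.
    - by apply/measurable_EFinP; exact: measurableT_comp.
  rewrite ge0_integralZl//.
  - by apply: lte_mul_pinfty.
  - by apply: measurableT_comp => //; exact/measurable_EFinP.
have iH : (mu \x mu)%E.-integrable setT H.
  apply: (le_integrable _ _ _ iP) => //= z _.
  rewrite lee_fin normrM ler_piMr// indicE; case: (_ \in _); first by rewrite normr1.
  by rewrite normr0 ler01.
have := Fubini iH.
have -> : (fun x => \int[mu]_y H (x, y))%E = EFin \o ((fun x => f x * prim a g x) \_ `[a, b]).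
  apply/funext => x /=.
  transitivity (\int[mu]_y (f' x * (g \_ `[a, x]) y)%:E)%E.
    apply: eq_integral => y _; rewrite /H /f' /g' /= !patchE indicE.
    case: ifPn => [|_]; last by rewrite !mul0r.
    rewrite inE/= in_itv/= => /andP[ax xb].
    have [yx|xy] := leP y x.
      rewrite [(x, y) \in D]mem_set// mulr1 !mem_itvcc yx.
      by rewrite (le_trans yx xb).
    rewrite [(x, y) \in D]memNset ?mulr0; last by rewrite /D/= leNgt xy.
    by rewrite mem_itvcc [y <= x]leNgt xy andbF mulr0.
  rewrite EFin_Rintegral//.
    rewrite RintegralZl//; last exact: integrable_patch.
    rewrite -Rintegral_mkcond /f' !patchE; case: ifPn => //; by rewrite mul0r.
  exact: (@integrableZl _ _ _ mu setT measurableT (f' x) _ (integrable_patch a x lg)).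
have -> : (fun y => \int[mu]_x H (x, y))%E =
    EFin \o ((fun y => g y * (prim a f b - prim a f y)) \_ `[a, b]).
  apply/funext => y /=.
  transitivity (\int[mu]_x (g' y * (f \_ `[y, b]) x)%:E)%E.
    apply: eq_integral => x _; rewrite /H /f' /g' /= !patchE indicE.
    case: (ifPn (y \in _)) => [|_]; last by rewrite mulr0 !mul0r.
    rewrite inE/= in_itv/= => /andP[ay yb].
    have [yx|xy] := leP y x.
      rewrite [(x, y) \in D]mem_set// mulr1 !mem_itvcc yx.
      by rewrite (le_trans ay yx)/= mulrC.
    rewrite [(x, y) \in D]memNset ?mulr0; last by rewrite /D/= leNgt xy.
    by rewrite mem_itvcc [y <= x]leNgt xy mulr0.
  rewrite EFin_Rintegral//.
    rewrite RintegralZl//; last exact: integrable_patch.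
    rewrite -Rintegral_mkcond /g' !patchE; case: ifPn => //; last by rewrite mul0r.
    by rewrite inE/= in_itv/= => /andP[ay yb]; rewrite primB.
  exact: (@integrableZl _ _ _ mu setT measurableT (g' y) _ (integrable_patch y b lf)).
have lfg : loci (fun x => f x * prim a g x) by apply: lociMc => //; exact: prim_continuous.
have lgf : loci (fun x => g x * prim a f x) by apply: lociMc => //; exact: prim_continuous.
have lgf' : loci (fun x => g x * (prim a f b - prim a f x)).
  apply: lociMc => // x; apply: cvgB; [exact: cvg_cst|exact: prim_continuous].
rewrite EFin_Rintegral//; last exact: integrable_patch.
rewrite EFin_Rintegral//; last exact: integrable_patch.
rewrite -!Rintegral_mkcond => -[->].
rewrite -RintegralD//.
(* The other iterated integral carries the factor [prim a f b - prim a f y]; adding the second term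
   of the claim leaves the constant [prim a f b]. *)
under eq_Rintegral do rewrite -mulrDr subrK.
by rewrite RintegralZr// mulrC.
Qed.

Lemma is_derive_prim a f x : loci f -> {for x, continuous f} -> a < x ->
  is_derive x (1 : R) (prim a f) (f x).
Proof.
move=> lf cf ax; have xx1 : x < x + 1 by rewrite ltrDl.
have [d <-] := continuous_FTC1_closed xx1 (lf a (x + 1)) ax cf.
exact: derivable_derive1.
Qed.

Lemma ae_derive_prim a f : loci f ->
  {ae mu, forall x, a < x -> is_derive x (1 : R) (prim a f) (f x)}.
Proof.
move=> lf; have := @FTC1 _ f (BLeft a) (lf a) (loci_locally lf).
apply: filterS; first exact: (ae_filter_ringOfSetsType mu).
move=> x /= h ax.
have [d <-] := h ltac:(by rewrite lte_fin).
exact: derivable_derive1.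
Qed.

(** Absolute continuity to the right of [a] with density [f], as an integral identity; [f] need not
    be the derivative of [F] at every point. *)
Definition ac a F f := forall x, a <= x -> F x = F a + prim a f x.

Lemma ac_prim a f c : ac a (fun x => c + prim a f x) f.
Proof. by move=> x ax; rewrite primaa addr0. Qed.

Lemma ac_C1 a F f : (forall x, is_derive x (1 : R) F (f x)) -> continuous f -> ac a F f.
Proof.
move=> dF cf x; rewrite le_eqVlt => /predU1P[<-|ax]; first by rewrite primaa addr0.
have cF : continuous F.
  by move=> y; apply/differentiable_continuous/derivable1_diffP; case: (dF y).
rewrite /prim /Rintegral (@continuous_FTC2 _ f F a x)//=.
- ring.
- exact: continuous_subspaceT.
- split=> [y _||]; first by case: (dF y).
  + exact/cvg_at_right_filter/cF.
  + exact/cvg_at_left_filter/cF.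
- by move=> y _; exact: is_derive_derive1.
Qed.

Lemma ac_smooth a F : smooth F -> ac a F (derive1 F).
Proof.
move=> sF; apply: ac_C1 => [x|]; first exact: smooth_is_derive.
exact/smooth_continuous/smooth_derive1.
Qed.

Lemma ac_ibp a b F G f g : loci f -> loci g -> ac a F f -> ac a G g -> a <= b ->
  \int[mu]_(x in `[a, b]) (f x * G x) + \int[mu]_(x in `[a, b]) (g x * F x) =
  F b * G b - F a * G a.
Proof.
move=> lf lg aF aG ab.
(* Splits off the constant [V a], so that only primitives are left for [prim_ibp]. *)
have E (u v V : R -> R) : loci u -> loci v -> ac a V v ->
    \int[mu]_(x in `[a, b]) (u x * V x) =
    \int[mu]_(x in `[a, b]) (u x * prim a v x) + prim a u b * V a.
  move=> lu lv aV; rewrite /(prim a u b) -RintegralZr//.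
  rewrite -RintegralD//.
  - apply: eq_Rintegral => x; rewrite inE/= in_itv/= => /andP[ax _].
    by rewrite (aV x ax); ring.
  - by apply: (lociMc lu); exact: prim_continuous.
  - by apply: (lociMc lu) => x; exact: cvg_cst.
rewrite (E f g)// (E g f)// addrACA prim_ibp// (aF b ab) (aG b ab); ring.
Qed.

End Primitive.

(** * Dominated convergence for real-valued integrals *)

Section DominatedConvergence.
Context d (T : measurableType d) (R : realType) (mu : {measure set T -> \bar R}).

Lemma Rdominated (D : set T) (u : nat -> T -> R) (f g : T -> R) :
  measurable D -> (forall n, measurable_fun D (u n)) -> measurable_fun D f ->
  (forall x, D x -> u n x @[n --> \oo] --> f x) ->
  mu.-integrable D (EFin \o g) -> (forall n x, D x -> `|u n x| <= g x) ->
  \int[mu]_(x in D) u n x @[n --> \oo] --> \int[mu]_(x in D) f x.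
Proof.
move=> mD mu_ mf uf ig ug.
have mu_' n : measurable_fun D (EFin \o u n) by exact/measurable_EFinP.
have mf' : measurable_fun D (EFin \o f) by exact/measurable_EFinP.
have uf' : {ae mu, forall x, D x -> (EFin \o u n) x @[n --> \oo] --> (EFin \o f) x}.
  by apply: aeW => x Dx; apply: cvg_EFin; [exact: nearW|exact: uf].
have ug' : {ae mu, forall x n, D x -> (`|(EFin \o u n) x| <= (EFin \o g) x)%E}.
  by apply: aeW => x n Dx; rewrite lee_fin ug.
have [fi _ h] := dominated_convergence mD mu_' mf' uf' ig ug'.
by apply: fine_cvg; rewrite fineK; [exact: h|exact: integrable_fin_num].
Qed.

End DominatedConvergence.

(** * Test functions on an edge and regularity of weak derivatives *)

Section TestFunctions.
Variable R : realType.
Implicit Types (f g F G eta : R -> R) (a b c d x y : R) (I : set R).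
Notation mu := (@lebesgue_measure R).

(** The left endpoint is finite and the right one may be infinite: this covers both the loop and the
    legs. *)
Definition isedge a I := exists2 b : itv_bound R, I = [set` Interval (BRight a) b] &
  b = +oo%O \/ exists2 b', a < b' & b = BLeft b'.

Lemma edge_gt a I x : isedge a I -> I x -> a < x.
Proof. by move=> [b -> _]; rewrite /= in_itv/= => /andP[]. Qed.

Lemma edge_conn a I x y : isedge a I -> I y -> a < x -> x <= y -> I x.
Proof.
move=> [b -> bE]; rewrite /= !in_itv/= => /andP[_ yb] -> xy /=.
by case: bE yb => [->//|[b' _ ->]] /=; apply: le_lt_trans.
Qed.

Lemma edge_open a I : isedge a I -> open I.
Proof. by move=> [b -> [->|[b' _ ->]]]. Qed.

Lemma edge_measurable a I : isedge a I -> measurable I.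
Proof. by move=> [b -> _]. Qed.

Lemma edge_near_left a I : isedge a I -> exists2 e, a < e & forall x, a < x -> x < e -> I x.
Proof.
move=> [b -> [->|[b' ab ->]]].
  by exists (a + 1) => [|x ax _]; [rewrite ltrDl|rewrite /= in_itv/= ax].
by exists b' => // x ax xb; rewrite /= in_itv/= ax xb.
Qed.

Lemma edge_near_right a I x : isedge a I -> I x -> exists2 y, x < y & I y.
Proof.
move=> [b -> [->|[b' ab ->]]]; rewrite /= in_itv/= => /andP[ax xb].
  by exists (x + 1) => [|]; [rewrite ltrDl|rewrite /= in_itv/= andbT; lra].
by exists ((x + b') / 2); [lra|rewrite /= in_itv/=; apply/andP; split; lra].
Qed.

(** The support lies in a segment with both ends in [I], which keeps it away from the endpoints of
    the edge; on an interval this amounts to compact support in [I]. *)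
Definition rtest I eta := smooth eta /\
  exists cd : R * R, [/\ I cd.1, I cd.2 & forall x, ~ (cd.1 <= x <= cd.2) -> eta x = 0].

Lemma rtest_derive1 I eta : rtest I eta -> rtest I (derive1 eta).
Proof.
move=> [se [[c d] /= [Ic Id e0]]]; split; first exact: smooth_derive1.
exists (c, d); split=> //= x /negP.
rewrite negb_and -!ltNge => h; apply: is_derive_derive1.
apply: (@near_eq_is_derive _ _ _ (fun=> 0)).
case/orP: h => h; near=> y; apply/esym/e0/negP; rewrite negb_and -!ltNge; apply/orP.
  by left; near: y; exact: lt_nbhsl.
by right; near: y; exact: lt_nbhsr.
Unshelve. all: by end_near. Qed.

Lemma rtest_continuous I eta : rtest I eta -> continuous eta.
Proof. by case=> se _; exact: smooth_continuous. Qed.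

Lemma rtest0 a I eta x : isedge a I -> rtest I eta -> ~ I x -> eta x = 0.
Proof.
move=> aI [se [[c d] /= [Ic Id e0]]] Ix; apply: e0 => /andP[cx xd]; apply: Ix.
by apply: (edge_conn aI Id) => //; apply: lt_le_trans cx; exact: (edge_gt aI Ic).
Qed.

Section Edge.
Variables (a : R) (I : set R) (aI : isedge a I).

Let mI : measurable I := edge_measurable aI.

Lemma rtest_hull eta1 eta2 : rtest I eta1 -> rtest I eta2 ->
  exists c d, [/\ I c, I d, (forall x, ~ (c <= x <= d) -> eta1 x = 0) &
    forall x, ~ (c <= x <= d) -> eta2 x = 0].
Proof.
move=> [s1 [[c1 d1] /= [Ic1 Id1 e1]]] [s2 [[c2 d2] /= [Ic2 Id2 e2]]].
exists (Num.min c1 c2), (Num.max d1 d2); split.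
- by rewrite /Num.min; case: ifP.
- by rewrite /Num.max; case: ifP.
- move=> x h; apply: e1 => /andP[cx xd]; apply: h.
  by rewrite ge_min cx le_max xd.
- move=> x h; apply: e2 => /andP[cx xd]; apply: h.
  by rewrite ge_min cx le_max xd !orbT.
Qed.

Lemma rtestB eta1 eta2 : rtest I eta1 -> rtest I eta2 ->
  rtest I (fun x => eta1 x - eta2 x).
Proof.
move=> t1 t2; have [c [d [Ic Id h1 h2]]] := rtest_hull t1 t2.
split; first exact: smoothB t1.1 t2.1.
by exists (c, d); split=> //= x h; rewrite h1// h2// subr0.
Qed.

Lemma rtestZ k eta : rtest I eta -> rtest I (fun x => k * eta x).
Proof.
move=> [s1 [cd [h1 h2 h3]]]; split; first exact: smoothZ.
by exists cd; split=> // x h; rewrite h3// mulr0.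
Qed.

(** Trades the edge for a segment starting at [a], where the lemmas on primitives apply; [T] is a
    point of the edge beyond the support. *)
Lemma rtest_integral eta : rtest I eta -> exists2 T, a <= T &
  [/\ eta a = 0, eta T = 0, derive1 eta T = 0, forall x, T <= x -> eta x = 0 &
  forall f, \int[mu]_(x in I) (f x * eta x) = \int[mu]_(x in `[a, T]) (f x * eta x) /\
  (loci f -> mu.-integrable I (EFin \o (fun x => f x * eta x)))].
Proof.
move=> te; have [se [[c d] /= [Ic Id e0]]] := te.
have [T dT IT] := edge_near_right aI Id.
have aT := edge_gt aI IT; have ac := edge_gt aI Ic.
exists T; first exact: ltW.
have E x : d < x -> eta x = 0 by move=> dx; apply: e0; rewrite leNgt (leNgt _ d) dx andbF.
have E' : eta a = 0 by apply: e0; rewrite leNgt ac.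
have P f : ((fun x => f x * eta x) \_ I) = ((fun x => f x * eta x) \_ `[a, T]).
  apply/funext => x; rewrite !patchE mem_itvcc.
  case: ifPn => [|/negP Ix].
    rewrite inE => Ix; rewrite (ltW (edge_gt aI Ix))/=; case: ifPn => //; rewrite -ltNge => Tx.
    by rewrite E ?mulr0//; apply: lt_trans Tx.
  case: ifPn => // _; rewrite (rtest0 aI te) ?mulr0//.
  by move=> h; apply: Ix; rewrite inE.
split=> //.
- exact: E.
- have td := rtest_derive1 te.
  apply: is_derive_derive1.
  apply: (@near_eq_is_derive _ _ _ (fun=> 0)).
  by near=> y; apply/esym/E; near: y; exact: lt_nbhsr.
- by move=> x Tx; apply: E; apply: lt_le_trans Tx.
- move=> f; split; first by rewrite Rintegral_mkcond P -Rintegral_mkcond.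
  move=> lf; rewrite -[I]setTI; apply/integrable_restrict => //.
  rewrite restrict_EFin P; apply: integrable_patch; apply: lociMc => //.
  exact: rtest_continuous te.
Unshelve. all: by end_near. Qed.

Lemma rtest_integrable f eta : loci f -> rtest I eta ->
  mu.-integrable I (EFin \o (fun x => f x * eta x)).
Proof. by move=> lf /rtest_integral[T _ [_ _ _ _ h]]; apply: (h f).2. Qed.

Lemma ac_rtest_ibp F f eta : loci f -> ac a F f -> rtest I eta ->
  \int[mu]_(x in I) (F x * derive1 eta x) = - \int[mu]_(x in I) (f x * eta x).
Proof.
move=> lf aF te; have td := rtest_derive1 te.
have [T aT [e1 e2 _ e4 h]] := rtest_integral te.
have [T' aT' [_ _ _ e4' h']] := rtest_integral td.
(* The test function and its derivative come with separate bounds [T] and [T']; both integrals are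
   moved to the common segment up to [M]. *)
set M := Num.max T T'.
have TM : T <= M by rewrite le_max lexx.
have TM' : T' <= M by rewrite le_max lexx orbT.
have wid u S (g : R -> R) : a <= S -> S <= M -> (forall x, S <= x -> u x = 0) ->
    \int[mu]_(x in `[a, S]) (g x * u x) = \int[mu]_(x in `[a, M]) (g x * u x).
  move=> aS SM u0; rewrite [LHS]Rintegral_mkcond [RHS]Rintegral_mkcond.
  apply: eq_Rintegral => x _; rewrite !patchE !mem_itvcc.
  case: (a <= x) => //=; have [xS|Sx] := leP x S; first by rewrite (le_trans xS SM).
  by rewrite u0 ?mulr0 ?(ltW Sx)//; case: ifP.
rewrite (h _).1 (h' _).1 (wid eta)// (wid (derive1 eta))//.
have lde : loci (derive1 eta) by apply: loci_continuous; exact: rtest_continuous td.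
have := ac_ibp lf lde aF (ac_smooth te.1 (a := a)) (le_trans aT TM).
rewrite e1 (e4 M TM) !mulr0 subrr => /eqP; rewrite addrC addr_eq0 => /eqP <-.
by apply: eq_Rintegral => x _; rewrite mulrC.
Qed.

(** As [n] grows these tend pointwise to the indicator of []c, d[] while staying between 0 and 1:
    each flank has width 1/n. *)
Definition plateau c d (n : nat) x := step (n%:R * (x - c)) * step (n%:R * (d - x)).

Lemma plateau_ge0 c d n x : 0 <= plateau c d n x.
Proof. by rewrite mulr_ge0// step_ge0. Qed.

Lemma plateau_le1 c d n x : plateau c d n x <= 1.
Proof. by rewrite mulr_ile1// ?step_ge0 ?step_le1. Qed.

Lemma plateau_out c d n x : ~ (c < x < d) -> plateau c d n x = 0.
Proof.
move=> /negP; rewrite negb_and -!leNgt => /orP[xc|dx]; rewrite /plateau.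
  by rewrite step_le0 ?mul0r// mulr_ge0_le0// subr_le0.
by rewrite mulrC step_le0 ?mul0r// mulr_ge0_le0// subr_le0.
Qed.

Lemma smooth_plateau c d n : smooth (plateau c d n).
Proof.
apply: smoothM.
  rewrite (_ : (fun _ => _) = fun x => step (n%:R * x + (- (n%:R * c)))).
    exact/smooth_affine/smooth_step.
  by apply/funext => x; congr step; ring.
rewrite (_ : (fun _ => _) = fun x => step (- n%:R * x + n%:R * d)).
  exact/smooth_affine/smooth_step.
by apply/funext => x; congr step; ring.
Qed.

Lemma plateau_cvg c d x : plateau c d n x @[n --> \oo] --> ((c < x < d)%R%:R : R).
Proof.
have [/andP[cx xd]|/negP h] := boolP (c < x < d); last first.
  rewrite (_ : (fun n => _) = fun=> 0); first exact: cvg_cst.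
  by apply/funext => n; rewrite plateau_out.
have big (e : R) : 0 < e -> \forall n \near \oo, 1 <= n%:R * e.
  move=> e0; near=> n; rewrite -ler_pdivrMr// mul1r.
  by near: n; exact: nbhs_infty_ger.
apply: cvg_near_cst.
have xc0 : 0 < x - c by rewrite subr_gt0.
have dx0 : 0 < d - x by rewrite subr_gt0.
near=> n; rewrite /plateau !step_ge1 ?mulr1//; near: n; exact: big.
Unshelve. all: by end_near. Qed.

Lemma rtest_plateau c d n : I c -> I d -> rtest I (plateau c d n).
Proof.
move=> Ic Id; split; first exact: smooth_plateau.
exists (c, d); split=> //= x h; apply: plateau_out => /andP[cx xd]; apply: h.
by rewrite !ltW.
Qed.

(** The primitive of [f] is then constant on the edge, and by Lebesgue differentiation its
    derivative is [f] almost everywhere. *)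
Lemma loci_ae0 f : loci f ->
  (forall c d, I c -> I d -> c <= d -> \int[mu]_(x in `[c, d]) f x = 0) ->
  {ae mu, forall x, I x -> f x = 0}.
Proof.
move=> lf H; have := ae_derive_prim a lf.
apply: filterS; first exact: (ae_filter_ringOfSetsType mu).
move=> x /= h Ix; have ax := edge_gt aI Ix; have df := h ax.
have [y xy Iy] := edge_near_right aI Ix.
rewrite -(is_derive_derive1 df); apply: is_derive_derive1.
apply: (@near_eq_is_derive _ _ _ (fun=> prim a f x)).
near=> z.
have az : a < z by near: z; exact: lt_nbhsr.
have zy : z < y by near: z; exact: lt_nbhsl.
have Iz : I z := edge_conn aI Iy az (ltW zy).
have [zx|xz] := leP z x; apply/eqP.
  by rewrite -subr_eq0 primB ?(ltW az)// H.
by rewrite eq_sym -subr_eq0 primB ?(ltW ax) ?(ltW xz)// H// ltW.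
Unshelve. all: by end_near. Qed.

(** Integrals of [f] against plateaus converge, by dominated convergence, to its integral over a
    segment; these all vanish and [loci_ae0] applies. *)
Lemma fundamental_lemma f : loci f ->
  (forall eta, rtest I eta -> \int[mu]_(x in I) (f x * eta x) = 0) ->
  {ae mu, forall x, I x -> f x = 0}.
Proof.
move=> lf H; apply: loci_ae0 => // c d Ic Id cd.
have mf := loci_measurable lf.
have mind : measurable_fun `[c, d] (fun x => f x * (c < x < d)%R%:R).
  apply: measurable_funM; first exact: measurable_funTS.
  rewrite (_ : (fun _ => _) = \1_(`]c, d[%classic : set R)); first exact: measurable_indic.
  apply/funext => x; rewrite indicE; congr ((nat_of_bool _)%:R).
  by apply/idP/idP; rewrite inE/= in_itv/=.
have lim : \int[mu]_(x in `[c, d]) (f x * plateau c d n x) @[n --> \oo] -->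
    \int[mu]_(x in `[c, d]) (f x * (c < x < d)%R%:R).
  apply: (@Rdominated _ _ _ mu _ _ _ (fun x => `|f x|)) => //.
  - move=> n; apply: measurable_funTS; apply: measurable_funM => //.
    by apply: continuous_measurable_fun; apply: smooth_continuous; exact: smooth_plateau.
  - move=> x _; apply: cvgM; [exact: cvg_cst|exact: plateau_cvg].
  - exact: (integrable_norm (lf c d)).
  - move=> n x _; rewrite normrM ler_piMr// ger0_norm ?plateau_ge0//.
    exact: plateau_le1.
have E : \int[mu]_(x in `[c, d]) (f x * (c < x < d)%R%:R) = 0.
  apply: (cvg_unique _ lim) => //=.
  rewrite (_ : (fun n => _) = fun=> 0); first exact: cvg_cst.
  apply/funext => n; rewrite -(H _ (rtest_plateau n Ic Id)).
  rewrite [LHS]Rintegral_mkcond [RHS]Rintegral_mkcond.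
  apply: eq_Rintegral => x _; rewrite !patchE mem_itvcc.
  case: ifPn => [/andP[cx xd]|ncd].
    by rewrite mem_set//; apply: (edge_conn aI Id) => //; apply: lt_le_trans cx; exact: edge_gt aI Ic.
  case: ifPn => // _; rewrite plateau_out ?mulr0//.
  by apply/negP; apply: contra ncd => /andP[/ltW-> /ltW->].
rewrite -E; move: cd; rewrite le_eqVlt => /predU1P[<-|cd].
  by rewrite set_itv1 !Rintegral_set1.
have i1 (g : R -> R) : mu.-integrable `[c, d] (EFin \o g) ->
    \int[mu]_(x in `[c, d]) g x = \int[mu]_(x in `]c, d[) g x.
  move=> ig.
  rewrite -Rintegral_itv_bndo_bndc; last by apply: integrableS ig => //; exact: subset_itv_co_cc.
  rewrite -Rintegral_itv_obnd_cbnd//.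
  by apply: integrableS ig => //; exact: subset_itv_oo_cc.
have icd : mu.-integrable `[c, d] (EFin \o (fun x => f x * (c < x < d)%R%:R)).
  apply: (le_integrable _ _ _ (integrable_norm (lf c d))) => //.
  - exact/measurable_EFinP.
  - by move=> x _ /=; rewrite lee_fin normr_id normrM ler_piMr// ger0_norm//; case: (_ && _).
rewrite i1; last exact: lf.
rewrite i1//; apply: eq_Rintegral => x; rewrite inE/= in_itv/= => ->; by rewrite mulr1.
Qed.

Lemma edge_nonempty : exists2 c, I c & exists2 d, c < d & I d.
Proof.
have [e ae h] := edge_near_left aI.
exists (a + (e - a) / 3); first by apply: h; lra.
by exists (a + (e - a) / 2); [lra|apply: h; lra].
Qed.

Lemma exists_rtest1 : exists2 rho, rtest I rho & \int[mu]_(x in I) rho x = 1.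
Proof.
have [c Ic [d cd Id]] := edge_nonempty.
have tp := rtest_plateau 1 Ic Id.
have ip : mu.-integrable I (EFin \o plateau c d 1).
  have := rtest_integrable (loci_cst 1) tp.
  by apply: eq_integrable => // x _ /=; rewrite mul1r.
suff J0 : \int[mu]_(x in I) plateau c d 1 x != 0.
  exists (fun x => (\int[mu]_(x in I) plateau c d 1 x)^-1 * plateau c d 1 x); first exact: rtestZ.
  by rewrite RintegralZl// mulVf.
(* A plateau of zero integral would vanish almost everywhere, but it is positive on []c, d[], which
   has positive measure. *)
apply/eqP => J.
have iz : mu.-integrable I (EFin \o plateau c d 1) := ip.
have : ae_eq mu I (EFin \o plateau c d 1) (cst 0%E).
  apply/ae_eq_integral_abs => //; first exact: (measurable_int _ ip).
  under eq_integral do rewrite /= ger0_norm ?plateau_ge0//.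
  by rewrite EFin_Rintegral// J.
move=> [N [mN N0 subN]].
have : (mu `]c, d[ <= mu N)%E.
  apply: le_measure; rewrite ?inE//; apply: subset_trans subN => x /= + /= h.
  rewrite in_itv/= => /andP[cx xd].
  have Ix : I x.
    by apply: (edge_conn aI Id); [apply: lt_trans cx; exact: edge_gt aI Ic|exact: ltW].
  have := h Ix; rewrite /plateau => -[] /eqP; rewrite mulf_eq0 => /orP[]/eqP h'.
    by have := @step_gt0 R (1 * (x - c)); rewrite h' ltxx; apply/implyP; lra.
  by have := @step_gt0 R (1 * (d - x)); rewrite h' ltxx; apply/implyP; lra.
by rewrite N0 lebesgue_measure_itv/= lte_fin cd -EFinB lee_fin; lra.
Qed.

(** Zero mean is what makes the primitive vanish beyond the support, hence a test function again. *)
Lemma rtest_primitive eta : rtest I eta -> \int[mu]_(x in I) eta x = 0 ->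
  exists2 theta, rtest I theta & derive1 theta = eta.
Proof.
move=> te J0; have [se [[c d] /= [Ic Id e0]]] := te.
have ce := rtest_continuous te.
have le := loci_continuous ce.
have ac := edge_gt aI Ic.
have Pc x : x < c -> prim a eta x = 0.
  move=> xc; rewrite -[RHS](Rintegral_set0 mu eta) [LHS]Rintegral_mkcond [RHS]Rintegral_mkcond.
  apply: eq_Rintegral => y _; rewrite patch_set0 patchE mem_itvcc; case: ifPn => // /andP[ay yx].
  by apply: e0 => /andP[cy _]; move: (le_lt_trans (le_trans cy yx) xc); rewrite ltxx.
have Pd x : d <= x -> prim a eta x = 0.
  move=> dx; rewrite -J0 [LHS]Rintegral_mkcond [RHS]Rintegral_mkcond.
  apply: eq_Rintegral => y _; rewrite !patchE mem_itvcc.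
  have [Iy|Iy] := boolP (y \in I).
    rewrite inE in Iy; rewrite (ltW (edge_gt aI Iy))/=; case: ifPn => // yx.
    by rewrite e0// => /andP[_ yd]; move: yx; rewrite (le_trans yd dx).
  by rewrite (rtest0 aI te) ?if_same// => h; move: Iy; rewrite mem_set.
have dP x : is_derive x (1 : R) (prim a eta) (eta x).
  have [xc|cx] := ltP x c; last first.
    by apply: is_derive_prim => //; [exact: ce|exact: lt_le_trans cx].
  rewrite e0; last by rewrite leNgt xc.
  apply: (@near_eq_is_derive _ _ _ (fun=> 0)).
  by near=> y; rewrite Pc//; near: y; exact: lt_nbhsl.
have dPE : derive1 (prim a eta) = eta.
  by apply/funext => x; exact: is_derive_derive1.
exists (prim a eta); last exact: dPE.
split.
  apply: derivable_smooth; last by rewrite dPE.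
  by move=> x; case: (dP x).
exists (c, d); split=> //= x /negP; rewrite negb_and -!ltNge => /orP[/Pc//|/ltW/Pd//].
Unshelve. all: by end_near. Qed.

(** Subtracting a multiple of a fixed [rho] of integral 1 gives any test function zero mean, hence
    makes it a derivative, which [T] kills. Stated for functionals so that it also applies to $\eta
    \mapsto \int h \eta'$, not yet known to be integration against a function. *)
Lemma functional_of_derive0 (T : (R -> R) -> R) :
  (forall k eta1 eta2, rtest I eta1 -> rtest I eta2 ->
     T (fun x => eta1 x - k * eta2 x) = T eta1 - k * T eta2) ->
  (forall eta, rtest I eta -> T (derive1 eta) = 0) ->
  exists k, forall eta, rtest I eta -> T eta = k * \int[mu]_(x in I) eta x.
Proof.
move=> Tl T0; have [rho tr J1] := exists_rtest1; exists (T rho) => eta te.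
have I1 e : rtest I e -> mu.-integrable I (EFin \o e).
  move=> te'; have := rtest_integrable (loci_cst 1) te'.
  by apply: eq_integrable => // x _ /=; rewrite mul1r.
set m := \int[mu]_(x in I) eta x.
have tt : rtest I (fun x => eta x - m * rho x) by apply: rtestB => //; exact: rtestZ.
have J0 : \int[mu]_(x in I) (eta x - m * rho x) = 0.
  rewrite RintegralB//; [|exact: I1|by apply: I1; exact: rtestZ].
  by rewrite RintegralZl ?I1// J1 mulr1 subrr.
have [theta ttheta E] := rtest_primitive tt J0.
have := T0 _ ttheta; rewrite E Tl// => /eqP; rewrite subr_eq0 => /eqP ->.
by rewrite mulrC.
Qed.

Lemma du_bois_reymond f : loci f ->
  (forall eta, rtest I eta -> \int[mu]_(x in I) (f x * derive1 eta x) = 0) ->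
  exists k, {ae mu, forall x, I x -> f x = k}.
Proof.
move=> lf H.
have [||k Hk] := @functional_of_derive0 (fun eta => \int[mu]_(x in I) (f x * eta x)).
- move=> k e1 e2 t1 t2.
  rewrite -RintegralZl//; last exact: rtest_integrable.
  rewrite -RintegralB//; last 2 first.
  - exact: rtest_integrable.
  - by apply: RintegrableZ => //; exact: rtest_integrable.
  by apply: eq_Rintegral => x _; ring.
- exact: H.
exists k; have lk : loci (fun x => f x - k) by apply: lociB => //; exact: loci_cst.
have := @fundamental_lemma (fun x => f x - k) lk.
have h0 eta : rtest I eta -> \int[mu]_(x in I) ((f x - k) * eta x) = 0.
  move=> te; under eq_Rintegral do rewrite mulrBl.
  rewrite RintegralB//; [|exact: rtest_integrable|exact: (rtest_integrable (loci_cst k))].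
  rewrite Hk// RintegralZl ?subrr//.
  have := rtest_integrable (loci_cst 1) te.
  by apply: eq_integrable => // x _ /=; rewrite mul1r.
move=> /(_ h0); apply: filterS; first exact: (ae_filter_ringOfSetsType mu).
by move=> x /= h /h /eqP; rewrite subr_eq0 => /eqP.
Qed.

(** Subtracting the double primitive [G0] of [g] leaves a function [h] with zero weak second
    derivative. Such a function is affine almost everywhere, and adding the affine part to [G0]
    gives [F0]. *)
Lemma weak2_regularity f g : loci f -> loci g ->
  (forall eta, rtest I eta -> \int[mu]_(x in I) (f x * derive1n 2 eta x) =
                              \int[mu]_(x in I) (g x * eta x)) ->
  exists F0 F1, [/\ ac a F1 g, ac a F0 F1, continuous F0, continuous F1 &
    {ae mu, forall x, I x -> f x = F0 x}].
Proof.
move=> lf lg H.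
pose G1 x := 0 + prim a g x; pose G0 x := 0 + prim a G1 x.
have cG1 : continuous G1 by move=> x; apply: cvgD; [exact: cvg_cst|exact: prim_continuous].
have lG1 := loci_continuous cG1.
have cG0 : continuous G0 by move=> x; apply: cvgD; [exact: cvg_cst|exact: prim_continuous].
have lG0 := loci_continuous cG0.
have aG1 : ac a G1 g .
  exact: ac_prim.
have aG0 : ac a G0 G1 .
  exact: ac_prim.
pose h x := f x - G0 x.
have lh : loci h by exact: lociB.
have tint e : rtest I e -> mu.-integrable I (EFin \o e).
  move=> te'; have := rtest_integrable (loci_cst 1) te'.
  by apply: eq_integrable => // x _ /=; rewrite mul1r.
have h2 eta : rtest I eta -> \int[mu]_(x in I) (h x * derive1 (derive1 eta) x) = 0.
  move=> te; have td := rtest_derive1 te; have tdd := rtest_derive1 td.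
  under eq_Rintegral do rewrite mulrBl.
  rewrite RintegralB//; [|exact: rtest_integrable|exact: rtest_integrable].
  rewrite (H eta te) (ac_rtest_ibp lG1 aG0 td) (ac_rtest_ibp lg aG1 te); ring.
(* This functional vanishes on derivatives, so $\int h \eta' = k \int \eta$: the weak derivative of
   [h] is the constant [- k]. Hence the shape of [w] and the sign of [k] in [F0] and [F1]. *)
have [||k Hk] := @functional_of_derive0 (fun eta => \int[mu]_(x in I) (h x * derive1 eta x)).
- move=> k e1 e2 t1 t2.
  have [d1 d2] := (rtest_derive1 t1, rtest_derive1 t2).
  rewrite -RintegralZl//; last exact: rtest_integrable.
  rewrite -RintegralB//; last 2 first.
  - exact: rtest_integrable.
  - by apply: RintegrableZ => //; exact: rtest_integrable.
  apply: eq_Rintegral => x _.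
  rewrite (_ : derive1 _ x = derive1 e1 x - k * derive1 e2 x); first ring.
  apply: is_derive_derive1; apply: is_deriveB; first exact: smooth_is_derive t1.1.
  by apply: is_deriveZ; exact: smooth_is_derive t2.1.
- exact: h2.
pose w x := h x + k * x.
have cid : continuous (fun x : R => k * x).
  by move=> x; apply: cvgM; [exact: cvg_cst|exact: cvg_id].
have aid : ac a (fun x => k * x) (fun=> k).
  apply: ac_C1 => [x|x]; last exact: cvg_cst.
  have d1 : is_derive x 1 (k \*: (@id R)) (k *: 1) by exact: is_deriveZ.
  by apply: is_derive_eq; rewrite /GRing.scale/= mulr1.
have lw : loci w by apply: lociD => //; exact: loci_continuous.
have [eta te|m Hm] := du_bois_reymond lw.
  have td := rtest_derive1 te.
  under eq_Rintegral do rewrite mulrDl.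
  rewrite RintegralD//; [|exact: rtest_integrable|]; last first.
    by apply: rtest_integrable => //; exact: loci_continuous.
  rewrite Hk// (ac_rtest_ibp (loci_cst k) aid te) RintegralZl ?subrr//; exact: tint.
pose F1 x := G1 x - k; pose F0 x := G0 x + m - k * x.
have cF1 : continuous F1 by move=> x; apply: cvgB; [exact: cG1|exact: cvg_cst].
exists F0, F1; split=> //.
- by move=> x ax; rewrite /F1 (aG1 x ax); ring.
- move=> x ax; rewrite /F0 (aG0 x ax) (aid x ax) /F1 /prim RintegralB//; last exact: loci_cst.
  ring.
- move=> x; apply: cvgB; last exact: cid.
  by apply: cvgD; [exact: cG0|exact: cvg_cst].
- move: Hm; apply: filterS; first exact: (ae_filter_ringOfSetsType mu).
  by move=> x /= hm /hm; rewrite /w /h /F0 => <-; ring.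
Qed.

End Edge.
End TestFunctions.

(** * Square-integrable functions, and Green's formula on a half-line *)

Section SquareIntegrable.
Variable R : realType.
Implicit Types (f g h : R -> R) (D I : set R).
Notation mu := (@lebesgue_measure R).

Lemma aeS (P Q : R -> Prop) : (forall x, P x -> Q x) ->
  {ae mu, forall x, P x} -> {ae mu, forall x, Q x}.
Proof. by move=> PQ; apply: filterS; first exact: (ae_filter_ringOfSetsType mu). Qed.

Lemma ae2S (P Q S : R -> Prop) : (forall x, P x -> Q x -> S x) ->
  {ae mu, forall x, P x} -> {ae mu, forall x, Q x} -> {ae mu, forall x, S x}.
Proof.
move=> PQ h1; apply: filterS2 h1; last exact: PQ.
exact: (ae_filter_ringOfSetsType mu).
Qed.

Lemma RintegrableS D E f : measurable D -> measurable E -> E `<=` D ->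
  mu.-integrable D (EFin \o f) -> mu.-integrable E (EFin \o f).
Proof. by move=> mD mE ED; apply: integrableS. Qed.

Definition rL2 I f := measurable_fun I f /\ mu.-integrable I (EFin \o (fun x => f x ^+ 2)).

Lemma le_Rintegrable D f g : measurable D -> measurable_fun D f ->
  (forall x, D x -> `|f x| <= g x) -> mu.-integrable D (EFin \o g) ->
  mu.-integrable D (EFin \o f).
Proof.
move=> mD mf fg; apply: le_integrable => //; first exact/measurable_EFinP.
by move=> x Dx; rewrite lee_fin; apply: (le_trans (fg x Dx)); exact: ler_norm.
Qed.

Lemma rL2_integrableM I f g : measurable I -> rL2 I f -> rL2 I g ->
  mu.-integrable I (EFin \o (fun x => f x * g x)).
Proof.
move=> mI [mf f2] [mg g2]; apply: (le_Rintegrable mI (measurable_funM mf mg) _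
  (RintegrableD mI f2 g2)) => x _.
rewrite normrM -(real_normK (num_real (f x))) -(real_normK (num_real (g x))).
have := normr_ge0 (f x); have := normr_ge0 (g x); nra.
Qed.

Lemma rL2D I f g : measurable I -> rL2 I f -> rL2 I g -> rL2 I (fun x => f x + g x).
Proof.
move=> mI Lf Lg; have fg := rL2_integrableM mI Lf Lg; move: Lf Lg => [mf f2] [mg g2].
split; first exact: measurable_funD.
have := RintegrableD mI (RintegrableD mI f2 g2) (RintegrableZ 2 mI fg).
by apply: eq_integrable => // x _ /=; congr EFin; ring.
Qed.

Lemma rL2Z I k f : measurable I -> rL2 I f -> rL2 I (fun x => k * f x).
Proof.
move=> mI [mf f2]; split; first by apply: measurable_funM.
have := RintegrableZ (k ^+ 2) mI f2.
by apply: eq_integrable => // x _ /=; congr EFin; ring.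
Qed.

Lemma rL2B I f g : measurable I -> rL2 I f -> rL2 I g -> rL2 I (fun x => f x - g x).
Proof.
move=> mI Lf Lg; have := rL2D mI Lf (rL2Z (-1) mI Lg).
by congr rL2; apply/funext => x; rewrite mulN1r.
Qed.

Lemma rL2_0 I : measurable I -> rL2 I (fun=> 0).
Proof.
move=> mI; split; first exact: measurable_cst.
have := integrable0 mu I; apply: eq_integrable => // x _ /=.
by rewrite expr0n.
Qed.

Lemma rL2_ae I f g : measurable I -> measurable_fun I g -> ae_eq mu I f g ->
  rL2 I f -> rL2 I g.
Proof.
move=> mI mg fg [mf f2]; split=> //; apply/integrableP; split.
  by apply/measurable_EFinP; exact: measurable_funX.
have /integrableP[mf2] := f2; apply: le_lt_trans.
rewrite le_eqVlt; apply/orP; left; apply/eqP/ae_eq_integral => //.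
- by apply: measurableT_comp => //; apply/measurable_EFinP; exact: measurable_funX.
- by apply: measurableT_comp => //; apply/measurable_EFinP; exact: measurable_funX.
- by apply: aeS fg => x /= h /h ->.
Qed.

(** On a bounded segment square integrability gives integrability through $|f| \le 1 + f^2$. *)
Lemma rL2_loci I f : measurable I -> rL2 I f -> loci (f \_ I).
Proof.
move=> mI [mf f2] x y.
have i1 : mu.-integrable `[x, y] (EFin \o ((fun x => f x ^+ 2) \_ I)).
  apply: (@integrableS _ _ _ _ setT) => //.
  by rewrite -restrict_EFin; apply/integrable_restrict => //; rewrite setTI.
have i2 := RintegrableD (measurable_itv `[x, y]) (loci_cst 1 x y) i1.
apply: (le_Rintegrable (measurable_itv _) _ _ i2).
  by apply: measurable_funTS; apply/(measurable_restrictT _ _).1.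
move=> z _; rewrite !patchE; case: ifP => _ /=; last by rewrite normr0 addr0.
rewrite -(real_normK (num_real (f z))).
have := normr_ge0 (f z); set u := `|_| => u0.
have : 0 <= (u - 1) ^+ 2 by rewrite sqr_ge0.
nra.
Qed.

Lemma Rintegral_patch I f g :
  \int[mu]_(x in I) ((f \_ I) x * g x) = \int[mu]_(x in I) (f x * g x).
Proof. by apply: eq_Rintegral => x xI; rewrite patchE xI. Qed.

Lemma continuous_rL2 I x y f : measurable I -> I `<=` `[x, y] -> continuous f -> rL2 I f.
Proof.
move=> mI Ixy cf; split; first by apply: measurable_funTS; exact: continuous_measurable_fun.
apply: (RintegrableS (measurable_itv `[x, y]) mI Ixy).
by apply: loci_continuous => z; apply: continuousM; exact: cf.
Qed.

Lemma supported_rL2 I x y f : measurable I -> continuous f ->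
  (forall z, I z -> ~ (x <= z <= y) -> f z = 0) -> rL2 I f.
Proof.
move=> mI cf f0; split; first by apply: measurable_funTS; exact: continuous_measurable_fun.
have : mu.-integrable I (EFin \o ((fun x => f x ^+ 2) \_ `[x, y])).
  apply: (RintegrableS measurableT mI) => //.
  by apply: integrable_patch; apply: loci_continuous => z; apply: continuousM; exact: cf.
apply: eq_integrable => // z /set_mem Iz /=; rewrite patchE mem_itvcc.
by case: ifPn => // /negP h; rewrite f0// expr0n.
Qed.

Section Leg.
Variable a : R.
Let I : set R := `]a, +oo[%classic.
Let mI : measurable I := measurable_itv _.

Lemma leg_isedge : isedge a I.
Proof. by exists +oo%O => //; left. Qed.

Lemma leg_not_bounded_below f T0 (e : R) : mu.-integrable I (EFin \o f) -> 0 < e ->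
  (forall x, T0 <= x -> e <= `|f x|) -> False.
Proof.
move=> fi e0 H; set b := Num.max a T0.
have bI : `]b, +oo[%classic `<=` I.
  by move=> x; rewrite /I/= !in_itv/= !andbT /b gt_max => /andP[].
have := RintegrableS mI (measurable_itv _) bI fi.
move=> /(@integrable_norm _ _ _ mu) fb.
have : mu.-integrable `]b, +oo[ (EFin \o cst e).
  apply: (le_Rintegrable _ _ _ fb) => // x /=; rewrite in_itv/= andbT /b gt_max => /andP[_ /ltW Tx].
  by rewrite gtr0_norm// H.
move=> /integrableP[_] /=; rewrite (gtr0_norm e0) integral_cst// => h.
have muy : mu `]b, +oo[%classic = +oo%E by rewrite lebesgue_measure_itv/= ltry.
have : (e%:E * mu `]b, +oo[%classic < +oo)%E := h.
by rewrite muy gt0_muley ?lte_fin.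
Qed.

Lemma leg_integral_cvg f : mu.-integrable I (EFin \o f) ->
  \int[mu]_(x in `[a, T]) (f \_ I) x @[T --> +oo] --> \int[mu]_(x in I) f x.
Proof.
move=> fi; apply/cvg_pinftyP => u uy.
have ifI : mu.-integrable setT (EFin \o (f \_ I)).
  by rewrite -restrict_EFin; apply/integrable_restrict => //; rewrite setTI.
rewrite [X in _ --> X]Rintegral_mkcond.
rewrite (_ : (fun n => _) = (fun n => \int[mu]_x ((f \_ I) \_ `[a, u n]) x)); last first.
  by apply/funext => n; rewrite Rintegral_mkcond.
have mfI : measurable_fun setT (f \_ I) by case/integrableP : ifI => /measurable_EFinP.
apply: (@Rdominated _ _ _ mu _ _ _ (fun x => `|(f \_ I) x|)) => //.
- by move=> n; apply/(measurable_restrictT _ _).1 => //; exact: measurable_funTS.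
- move=> x _; apply: cvg_near_cst.
  move/cvgryPge : uy => /(_ x); apply: filterS => n xn.
  rewrite patchE mem_itvcc xn andbT; case: ifPn => //; rewrite -ltNge => xa.
  by rewrite patchE memNset// /I/= in_itv/= andbT ltNge (ltW xa).
- exact: integrable_norm ifI.
- by move=> n x _; rewrite patchE; case: ifP => // _; rewrite normr0.
Qed.

Lemma leg_limit0 f l : mu.-integrable I (EFin \o f) -> f x @[x --> +oo] --> l -> l = 0.
Proof.
move=> fi fl; apply/eqP/negP => /negP l0.
have e0 : 0 < `|l| / 2 by rewrite divr_gt0// normr_gt0.
have /cvgrPdist_le /(_ _ e0) [T0 [_ H]] := fl.
apply: (@leg_not_bounded_below f (T0 + 1) (`|l| / 2) fi e0) => x Tx.
have Tx' : T0 < x by lra.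
have := H _ Tx'; have := ler_normD (l - f x) (f x); rewrite subrK; lra.
Qed.

(** Monotone convergence along the segments from [a] to [a + n]. *)
Lemma bounded_integral_integrable f B : loci f ->
  (forall x, 0 <= f x) -> (forall T, a <= T -> \int[mu]_(x in `[a, T]) f x <= B) ->
  mu.-integrable I (EFin \o f).
Proof.
move=> lf f0 fB; apply: (RintegrableS (measurable_itv `[a, +oo[)) => //.
  by move=> x; rewrite /I/= !in_itv/= !andbT => /ltW.
have mf := loci_measurable lf.
apply/integrableP; split; first by apply/measurable_EFinP; exact: measurable_funTS.
apply: le_lt_trans (ltry B).
rewrite (_ : `[a, +oo[%classic = \bigcup_n `[a, a + n%:R]%classic :> set R); last first.
  apply/seteqP; split=> x; rewrite /= in_itv/= ?andbT.
    move=> ax; exists (Num.truncn (x - a)).+1 => //=; rewrite in_itv/= ax/=.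
    by rewrite -lerBlDl ltW// truncnS_gt.
  by move=> [n _] /=; rewrite in_itv/= => /andP[].
have h := @ge0_nondecreasing_set_cvg_integral _ (measurableTypeR R) _ (fun n => `[a, a + n%:R]%classic)
  (fun x => `|(f x)%:E|%E) (@lebesgue_measure R).
have /h c : {homo (fun n => `[a, a + n%:R]%classic : set R) : n m / (n <= m)%N >-> (n <= m)%O}.
  move=> n m nm; apply/subsetPset => x /=; rewrite !in_itv/= => /andP[-> /le_trans]; apply.
  by rewrite lerD2l ler_nat.
have {}c := c (fun n => measurable_itv _).
have /c {}c : forall n, measurable_fun `[a, a + n%:R] (fun x => `|(f x)%:E|%E).
  by move=> n; apply: measurableT_comp => //; apply/measurable_EFinP; exact: measurable_funTS.
have {}c := c (fun i x _ => abse_ge0 _).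
rewrite -(cvg_lim _ c)//; apply: lime_le; first by apply/cvg_ex; eexists; exact: c.
apply: nearW => n.
under eq_integral => x _ do rewrite gee0_abs ?lee_fin ?f0//.
rewrite EFin_Rintegral//; first by rewrite lee_fin fB// lerDl.
Qed.

(* If f and f'' are in L^2 of a half-line, so is f': otherwise f f' tends to
   infinity, by parts, and then so does f^2. *)
Lemma leg_derive_rL2 (F0 F1 g : R -> R) : continuous F0 -> continuous F1 -> ac a F0 F1 ->
  ac a F1 (g \_ I) -> rL2 I F0 -> rL2 I g -> rL2 I F1.
Proof.
move=> c0 c1 a0 a1 L0 Lg; split; first by apply: measurable_funTS; exact: continuous_measurable_fun.
have lg := rL2_loci mI Lg.
have l1 := loci_continuous c1.
have c11 : continuous (fun x => F1 x ^+ 2) by move=> x; apply: continuousM; exact: c1.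
have iF0g := rL2_integrableM mI Lg L0.
have /cvgrPdist_le /(_ _ ltr01) [T0 [_ HT0]] := leg_integral_cvg iF0g.
set K := \int[mu]_(x in I) (g x * F0 x) in HT0.
have parts T : a <= T -> \int[mu]_(x in `[a, T]) (F1 x ^+ 2) =
    F0 T * F1 T - F0 a * F1 a - \int[mu]_(x in `[a, T]) ((fun x => g x * F0 x) \_ I) x.
  move=> aT; have := ac_ibp l1 lg a0 a1 aT => <-.
  rewrite [X in _ + X - _](_ : _ = \int[mu]_(x in `[a, T]) ((fun x => g x * F0 x) \_ I) x).
    by rewrite addrK.
  by apply: eq_Rintegral => x _; rewrite !patchE; case: ifP => // _; rewrite mul0r.
have [[B HB]|nB] := pselect (exists B, forall T, a <= T -> \int[mu]_(x in `[a, T]) (F1 x ^+ 2) <= B).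
  apply: (bounded_integral_integrable _ _ HB); first exact: loci_continuous.
  by move=> x; exact: sqr_ge0.
exfalso.
have mono S T : a <= S -> S <= T -> \int[mu]_(x in `[a, S]) (F1 x ^+ 2) <= \int[mu]_(x in `[a, T]) (F1 x ^+ 2).
  move=> aS ST; rewrite -subr_ge0 (primB (loci_continuous c11))//.
  by apply: Rintegral_ge0 => x _; exact: sqr_ge0.
have [T1 aT1 HT1] : exists2 T1, a <= T1 & forall T, T1 <= T -> 1 <= F0 T * F1 T.
  (* This value turns the identity [parts] into the lower bound 1: the integral of [g x * F0 x] up
     to [T] is within 1 of its limit [K], whence the 2. *)
  pose B := 2 - K - F0 a * F1 a.
  have [S aS HS] : exists2 S, a <= S & B <= \int[mu]_(x in `[a, S]) (F1 x ^+ 2).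
    apply: contrapT => h; apply: nB; exists B => T aT; rewrite leNgt; apply/negP => hT.
    by apply: h; exists T => //; exact: ltW.
  exists (Num.max S (T0 + 1)); first by rewrite le_max aS.
  move=> T; rewrite ge_max => /andP[ST T0T].
  have aT := le_trans aS ST; have := mono S T aS ST; rewrite (parts T aT) => h.
  have T0T' : T0 < T by lra.
  have := HT0 _ T0T'; rewrite ler_norml => /andP[h1 h2].
  rewrite /B in HS; lra.
have l01 : loci (fun x => F1 x * F0 x).
  by apply: loci_continuous => x; apply: continuousM; [exact: c1|exact: c0].
(* The density $2 F_0 F_1$ of $F_0^2$ is at least 2 beyond [T1], so $F_0^2$ grows at least
   linearly. *)
have ge2 T : T1 <= T -> 2 * (T - T1) <= F0 T ^+ 2.
  move=> T1T; have aT := le_trans aT1 T1T.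
  have e1 := ac_ibp l1 l1 a0 a0 aT; have e2 := ac_ibp l1 l1 a0 a0 aT1.
  have : prim a (fun x => F1 x * F0 x) T - prim a (fun x => F1 x * F0 x) T1 >= T - T1.
    rewrite primB//.
    apply: (@le_trans _ _ (\int[mu]_(x in `[T1, T]) 1)).
      rewrite Rintegral_cst// mul1r.
      move: T1T; rewrite le_eqVlt => /predU1P[<-|T1T].
        by rewrite subrr fine_ge0.
      suff : T - T1 <= fine (mu `[T1, T]%classic) by [].
      by rewrite lebesgue_measure_itv/= lte_fin T1T.
    apply: le_Rintegral => //; [exact: loci_cst|].
    by move=> x /=; rewrite in_itv/= => /andP[T1x _]; rewrite mulrC HT1.
  rewrite /prim => h; have := sqr_ge0 (F0 T1); lra.
apply: (@leg_not_bounded_below _ (T1 + 1) 2 L0.2) => // T TT1.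
have := ge2 T; rewrite ger0_norm ?sqr_ge0//; have : T1 <= T by lra.
move=> -> /(_ isT); lra.
Qed.

(** The integrals over [[a, T]] converge, so the boundary term at [T] has a limit; as a combination
    of products of square-integrable functions it is also integrable, and the limit must be 0.
    Square integrability of [F1] and [G1] enters here. *)
Lemma leg_green (F0 F1 f G0 G1 g : R -> R) :
  continuous F0 -> continuous F1 -> ac a F0 F1 -> ac a F1 (f \_ I) -> rL2 I F0 -> rL2 I F1 -> rL2 I f ->
  continuous G0 -> continuous G1 -> ac a G0 G1 -> ac a G1 (g \_ I) -> rL2 I G0 -> rL2 I G1 -> rL2 I g ->
  \int[mu]_(x in I) (f x * G0 x) - \int[mu]_(x in I) (F0 x * g x) =
  - (F1 a * G0 a - F0 a * G1 a).
Proof.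
move=> cF0 cF1 aF0 aF1 LF0 LF1 Lf cG0 cG1 aG0 aG1 LG0 LG1 Lg.
have i1 := rL2_integrableM mI Lf LG0.
have i2 := rL2_integrableM mI LF0 Lg.
have W T : a <= T -> \int[mu]_(x in `[a, T]) ((fun x => f x * G0 x) \_ I) x -
    \int[mu]_(x in `[a, T]) ((fun x => F0 x * g x) \_ I) x =
    (F1 T * G0 T - F0 T * G1 T) - (F1 a * G0 a - F0 a * G1 a).
  move=> aT.
  have e1 := ac_ibp (rL2_loci mI Lf) (loci_continuous cG1) aF1 aG0 aT.
  have e2 := ac_ibp (rL2_loci mI Lg) (loci_continuous cF1) aG1 aF0 aT.
  have -> : \int[mu]_(x in `[a, T]) ((fun x => f x * G0 x) \_ I) x =
      \int[mu]_(x in `[a, T]) ((f \_ I) x * G0 x).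
    by apply: eq_Rintegral => x _; rewrite !patchE; case: ifP => // _; rewrite mul0r.
  have -> : \int[mu]_(x in `[a, T]) ((fun x => F0 x * g x) \_ I) x =
      \int[mu]_(x in `[a, T]) ((g \_ I) x * F0 x).
    by apply: eq_Rintegral => x _; rewrite !patchE; case: ifP => // _; rewrite (mulrC (F0 x), mul0r).
  have e3 : \int[mu]_(x in `[a, T]) (G1 x * F1 x) = \int[mu]_(x in `[a, T]) (F1 x * G1 x).
    by apply: eq_Rintegral => x _; rewrite mulrC.
  rewrite e3 in e1; lra.
set X := (X in X = _); set w := F1 a * G0 a - F0 a * G1 a.
have lim : (F1 T * G0 T - F0 T * G1 T) @[T --> +oo] --> X + w.
  have cv : \int[mu]_(x in `[a, T]) ((fun x => f x * G0 x) \_ I) x -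
      \int[mu]_(x in `[a, T]) ((fun x => F0 x * g x) \_ I) x + w @[T --> +oo] --> X + w.
    by apply: cvgD; [apply: cvgB; exact: leg_integral_cvg|exact: cvg_cst].
  apply: cvg_trans cv; apply: near_eq_cvg.
  near=> T; rewrite W ?subrK//.
have : X + w = 0.
  apply: leg_limit0 lim.
  by apply: RintegrableB => //; [apply: rL2_integrableM|apply: rL2_integrableM].
by move/eqP; rewrite addr_eq0 => /eqP.
Unshelve. all: by end_near. Qed.

End Leg.
End SquareIntegrable.

(** * Real Sobolev functions on an edge and their continuous representatives *)

Section RealSobolev.
Variable R : realType.
Implicit Types (f g h : R -> R) (I : set R).
Notation mu := (@lebesgue_measure R).

Lemma loop_derive_rL2 a b (F0 F1 g : R -> R) : continuous F1 -> rL2 `]a, b[ F1.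
Proof.
by move=> c1; apply: (@continuous_rL2 _ _ a b) => //; exact: subset_itv_oo_cc.
Qed.

Lemma loop_green a b (F0 F1 f G0 G1 g : R -> R) : a < b ->
  continuous F0 -> continuous F1 -> ac a F0 F1 -> ac a F1 (f \_ `]a, b[) -> rL2 `]a, b[ f ->
  continuous G0 -> continuous G1 -> ac a G0 G1 -> ac a G1 (g \_ `]a, b[) -> rL2 `]a, b[ g ->
  \int[mu]_(x in `]a, b[) (f x * G0 x) - \int[mu]_(x in `]a, b[) (F0 x * g x) =
  (F1 b * G0 b - F0 b * G1 b) - (F1 a * G0 a - F0 a * G1 a).
Proof.
move=> ab cF0 cF1 aF0 aF1 Lf cG0 cG1 aG0 aG1 Lg.
set I := `]a, b[%classic; have mI : measurable I := measurable_itv _.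
have e1 := ac_ibp (rL2_loci mI Lf) (loci_continuous cG1) aF1 aG0 (ltW ab).
have e2 := ac_ibp (rL2_loci mI Lg) (loci_continuous cF1) aG1 aF0 (ltW ab).
have E (u v : R -> R) : \int[mu]_(x in `[a, b]) ((u \_ I) x * v x) = \int[mu]_(x in I) (u x * v x).
  rewrite [LHS]Rintegral_mkcond [RHS]Rintegral_mkcond; apply: eq_Rintegral => x _.
  rewrite !patchE mem_itvcc; case: (ifP (x \in I)) => [|_]; last by rewrite mul0r; case: ifP.
  by rewrite inE /I/= in_itv/= => /andP[/ltW-> /ltW->].
rewrite !E in e1 e2.
have -> : \int[mu]_(x in I) (F0 x * g x) = \int[mu]_(x in I) (g x * F0 x).
  by apply: eq_Rintegral => x _; rewrite mulrC.
have e3 : \int[mu]_(x in `[a, b]) (G1 x * F1 x) = \int[mu]_(x in `[a, b]) (F1 x * G1 x).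
  by apply: eq_Rintegral => x _; rewrite mulrC.
rewrite e3 in e1; lra.
Qed.

Definition rwd n I f g := forall eta, rtest I eta ->
  \int[mu]_(x in I) (f x * derive1n n eta x) = (-1) ^+ n * \int[mu]_(x in I) (g x * eta x).

(** [F0] and [F1] represent f and f' up to the endpoints. The density of [F1] is [g] cut off to [I],
    so both functions make sense on the whole line, [F1] being constant beyond a finite right
    endpoint. *)
Definition rH2 a I f F0 F1 g :=
  [/\ continuous F0, continuous F1, ac a F0 F1, ac a F1 (g \_ I) & ae_eq mu I f F0] /\
  [/\ rL2 I F0, rL2 I F1 & rL2 I g].

(** On a bounded edge the second component follows from continuity alone, on a leg it is
    [leg_derive_rL2]; bundling it lets the regularity lemmas be stated once for both. *)
Definition redge a I := isedge a I /\ forall F0 F1 g, continuous F0 -> continuous F1 ->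
  ac a F0 F1 -> ac a F1 (g \_ I) -> rL2 I F0 -> rL2 I g -> rL2 I F1.

Lemma redge_loop a b : a < b -> redge a `]a, b[%classic.
Proof.
move=> ab; split; first by exists (BLeft b) => //; right; exists b.
by move=> F0 F1 g c0 c1 _ _ _ _; exact: loop_derive_rL2.
Qed.

Lemma redge_leg a : redge a `]a, +oo[%classic.
Proof.
split; first exact: leg_isedge.
by move=> F0 F1 g c0 c1 a0 a1 L0 Lg; exact: (@leg_derive_rL2 _ a F0 F1 g).
Qed.

Section OnEdge.
Variables (a : R) (I : set R) (eI : redge a I).
Let aI : isedge a I := eI.1.
Let mI : measurable I := edge_measurable aI.

Lemma rL2_test_integrable f eta : rL2 I f -> rtest I eta ->
  mu.-integrable I (EFin \o (fun x => f x * eta x)).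
Proof.
move=> Lf te; have := rtest_integrable aI (rL2_loci mI Lf) te.
by apply: eq_integrable => // x xI /=; rewrite patchE xI.
Qed.

Lemma rwd_unique n f g h : rL2 I g -> rL2 I h -> rwd n I f g -> rwd n I f h -> ae_eq mu I g h.
Proof.
move=> Lg Lh wg wh.
have := @fundamental_lemma _ a I aI (fun x => (g \_ I) x - (h \_ I) x)
  (lociB (rL2_loci mI Lg) (rL2_loci mI Lh)).
have h0 eta : rtest I eta -> \int[mu]_(x in I) (((g \_ I) x - (h \_ I) x) * eta x) = 0.
  move=> te; under eq_Rintegral do rewrite mulrBl.
  rewrite RintegralB//; [|exact: (rtest_integrable aI (rL2_loci mI Lg))|exact: (rtest_integrable aI (rL2_loci mI Lh))].
  rewrite !Rintegral_patch; have := wg eta te; rewrite (wh eta te) => /eqP.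
  by rewrite (inj_eq (mulfI _)) ?signr_eq0// => /eqP ->; rewrite subrr.
move=> /(_ h0); apply: aeS => x h1 Ix; have /eqP := h1 Ix.
by rewrite !patchE mem_set//= subr_eq0 => /eqP.
Qed.

Lemma ae_eq_Rintegral f g h : ae_eq mu I f g -> rL2 I f -> rL2 I g -> rtest I h ->
  \int[mu]_(x in I) (f x * h x) = \int[mu]_(x in I) (g x * h x).
Proof.
move=> fg Lf Lg th; congr fine; apply: ae_eq_integral => //.
- exact: measurable_int (rL2_test_integrable Lf th).
- exact: measurable_int (rL2_test_integrable Lg th).
- by apply: aeS fg => x e /e ->.
Qed.

Lemma rH2_rwd1 f F0 F1 g : rL2 I f -> rH2 a I f F0 F1 g -> rwd 1 I f F1.
Proof.
move=> Lf [[c0 c1 a0 a1 fF] [L0 L1 Lg]] eta te.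
have td : rtest I (derive1n 1 eta) by exact: rtest_derive1.
rewrite (ae_eq_Rintegral fF Lf L0 td) expr1 mulN1r.
exact: ac_rtest_ibp (loci_continuous c1) a0 te.
Qed.

Lemma rH2_rwd2 f F0 F1 g : rL2 I f -> rH2 a I f F0 F1 g -> rwd 2 I f g.
Proof.
move=> Lf rf eta te; have := rH2_rwd1 Lf rf; have [[c0 c1 a0 a1 fF] [L0 L1 Lg]] := rf.
have td := rtest_derive1 te.
move=> /(_ _ td); rewrite expr1 mulN1r => e1.
rewrite -[LHS]/(\int[mu]_(x in I) (f x * derive1n 1 (derive1 eta) x)) e1.
rewrite (ac_rtest_ibp aI (rL2_loci mI Lg) a1 te) Rintegral_patch.
by rewrite sqrrN expr1n mul1r opprK.
Qed.

Lemma rwd2_rH2 f g : rL2 I f -> rL2 I g -> rwd 2 I f g ->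
  exists F0 F1, rH2 a I f F0 F1 g.
Proof.
move=> Lf Lg w; have lf := rL2_loci mI Lf; have lg := rL2_loci mI Lg.
have [|F0 [F1 [a1 a0 c0 c1 fF]]] := weak2_regularity aI lf lg.
  by move=> eta te; rewrite !Rintegral_patch w// sqrrN expr1n mul1r.
have fF' : ae_eq mu I f F0.
  by apply: aeS fF => x h Ix; rewrite -(h Ix) patchE mem_set.
have L0 : rL2 I F0.
  apply: (rL2_ae mI _ fF' Lf); apply: measurable_funTS; exact: continuous_measurable_fun.
by exists F0, F1; split; split=> //; exact: (eI.2 F0 F1 g).
Qed.

Lemma rL2_eq f g : (forall x, I x -> f x = g x) -> measurable_fun I g -> rL2 I f -> rL2 I g.
Proof. by move=> fg mg; apply: rL2_ae => //; apply: aeW => x; exact: fg. Qed.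

Lemma prim_patch f x : loci f -> loci (f \_ I) -> a <= x -> (forall y, a < y -> y < x -> I y) ->
  prim a (f \_ I) x = prim a f x.
Proof.
move=> lf lfI; rewrite le_eqVlt => /predU1P[<-|ax] H; first by rewrite !primaa.
have i1 (g : R -> R) : loci g -> prim a g x = \int[mu]_(x in `]a, x[) g x.
  move=> ig; rewrite /prim.
  rewrite -Rintegral_itv_bndo_bndc; last first.
    by apply: (RintegrableS _ _ _ (ig a x)) => //; exact: subset_itv_co_cc.
  rewrite -Rintegral_itv_obnd_cbnd//.
  by apply: (RintegrableS _ _ _ (ig a x)) => //; exact: subset_itv_oo_cc.
rewrite !i1//; apply: eq_Rintegral => y; rewrite inE/= in_itv/= => /andP[ay yx].
by rewrite patchE mem_set//; exact: H.
Qed.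

(** [f] itself may fail to be the representative, since [rH2] asks for a second derivative cut off
    outside [I]: [F0] can leave [f] beyond the right endpoint. Agreement is claimed on the closed
    edge, which the condition on [x] describes. *)
Lemma C2_rH2 f f1 f2 : (forall x, is_derive x (1 : R) f (f1 x)) ->
  (forall x, is_derive x (1 : R) f1 (f2 x)) -> continuous f2 ->
  rL2 I f -> rL2 I f1 -> rL2 I f2 ->
  exists F0 F1, rH2 a I f F0 F1 f2 /\
   forall x, a <= x -> (forall y, a < y -> y < x -> I y) -> F0 x = f x /\ F1 x = f1 x.
Proof.
move=> d0 d1 c2 L0 L1 L2.
have cont (u v : R -> R) : (forall x, is_derive x (1 : R) u (v x)) -> continuous u.
  by move=> h x; apply/differentiable_continuous/derivable1_diffP; case: (h x).
have c0 := cont _ _ d0; have c1 := cont _ _ d1.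
pose F1 x := f1 a + prim a (f2 \_ I) x.
have l2 := rL2_loci mI L2.
have cF1 : continuous F1 by move=> x; apply: cvgD; [exact: cvg_cst|exact: prim_continuous].
pose F0 x := f a + prim a F1 x.
have lF1 := loci_continuous cF1.
have cF0 : continuous F0 by move=> x; apply: cvgD; [exact: cvg_cst|exact: prim_continuous].
have E1 x : a <= x -> (forall y, a < y -> y < x -> I y) -> F1 x = f1 x.
  move=> ax H; rewrite /F1 prim_patch//; last exact: loci_continuous.
  by rewrite (ac_C1 d1 c2 ax).
have E0 x : a <= x -> (forall y, a < y -> y < x -> I y) -> F0 x = f x.
  move=> ax H; rewrite (ac_C1 d0 c1 ax) /F0; congr (_ + _).
  apply: eq_Rintegral => y; rewrite inE/= in_itv/= => /andP[ay yx]; apply: E1 => // z az zy.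
  by apply: H => //; exact: lt_le_trans yx.
have HI x : I x -> a <= x /\ (forall y, a < y -> y < x -> I y).
  move=> Ix; split; first exact: ltW (edge_gt aI Ix).
  by move=> y ay yx; apply: (edge_conn aI Ix) => //; exact: ltW.
exists F0, F1; split; last by move=> x ax H; rewrite E0// E1.
split; split=> //.
- exact: ac_prim.
- exact: ac_prim.
- by apply: aeW => x Ix; have [h1 h2] := HI x Ix; rewrite E0.
- apply: (rL2_eq _ _ L0); first by move=> x Ix; have [h1 h2] := HI x Ix; rewrite E0.
  by apply: measurable_funTS; exact: continuous_measurable_fun.
- apply: (rL2_eq _ _ L1); first by move=> x Ix; have [h1 h2] := HI x Ix; rewrite E1.
  by apply: measurable_funTS; exact: continuous_measurable_fun.
Qed.

End OnEdge.

Lemma ae_open_nonempty (P : R -> Prop) U : open U -> U !=set0 ->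
  {ae mu, forall x, P x} -> exists2 x, U x & P x.
Proof.
move=> oU [x0 Ux0] [N [mN N0 subN]].
have /nbhs_ballP[r /= r0 rU] := open_nbhs_nbhs (conj oU Ux0).
apply: contrapT => h.
have : (mu (ball x0 r) <= mu N)%E.
  apply: le_measure; rewrite ?inE//; first exact: measurable_ball.
  apply: subset_trans subN => x xr /= Px; apply: h; exists x => //; exact: rU.
rewrite N0 lebesgue_measure_ball ?(ltW r0)// lee_fin.
by rewrite leNgt mulrn_wgt0.
Qed.

(** The points of agreement have full measure in [I] and so come arbitrarily close to [c];
    continuity along the closed edge does the rest. *)
Lemma within_closure_unique I (F G : R -> R) c : open I ->
  {within closure I, continuous F} -> {within closure I, continuous G} ->
  ae_eq mu I F G -> closure I c -> F c = G c.
Proof.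
move=> oI /subspace_continuousP cF /subspace_continuousP cG FG Ic; apply/eqP/negP => /negP ne.
have cFG : F x - G x @[x --> within (closure I) (nbhs c)] --> F c - G c.
  by apply: cvgB; [exact: cF|exact: cG].
have e0 : 0 < `|F c - G c| by rewrite normr_gt0 subr_eq0.
move/cvgrPdist_lt : cFG => /(_ _ e0); rewrite near_withinE => nF.
have /nbhs_ballP[r /= r0 rF] := nF.
have oU : open (I `&` ball c r) by apply: openI => //; exact: ball_open.
have [x [Ix xr] E] : exists2 x, (I `&` ball c r) x & (I x -> F x = G x).
  apply: ae_open_nonempty => //.
  by have [y [Iy yr]] := Ic _ (nbhsx_ballx c r r0); exists y.
have := rF x xr (@subset_closure _ I x Ix).
by rewrite (E Ix) subrr subr0 ltxx.
Qed.

Lemma closure_edge_left a I : isedge a I -> closure I a.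
Proof.
move=> aI B /nbhs_ballP[r /= r0 rB]; have [e ae H] := edge_near_left aI.
exists (Num.min (a + r / 2) ((a + e) / 2)); split.
  by apply: H; rewrite ?lt_min ?gt_min; apply/andP || (apply/orP; right); try split; lra.
apply: rB; rewrite /ball/= ltr_distlC lt_min gt_min; apply/andP; split.
  by apply/andP; split; lra.
by apply/orP; left; lra.
Qed.

Lemma closure_oo_right (a b : R) : a < b -> closure `]a, b[%classic b.
Proof.
move=> ab B /nbhs_ballP[r /= r0 rB].
exists (Num.max (b - r / 2) ((a + b) / 2)); split.
  by rewrite /= in_itv/= lt_max gt_max; apply/andP; split; [apply/orP; right|apply/andP; split]; lra.
apply: rB; rewrite /ball/= ltr_distlC lt_max gt_max; apply/andP; split.
  by apply/orP; left; lra.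
by apply/andP; split; lra.
Qed.

End RealSobolev.

Local Open Scope complex_scope.
Local Open Scope ring_scope.

(** * Complex-valued functions on an edge: traces and weak derivatives *)

Section ComplexEdge.
Variable R : realType.
Local Notation C := R[i].
Implicit Types (f g h F G eta : R -> C) (I : set R).
Notation mu := (@lebesgue_measure R).

Lemma cReM (x y : C) : complex.Re (x * y) =
  complex.Re x * complex.Re y - complex.Im x * complex.Im y.
Proof. by case: x => ? ?; case: y. Qed.

Lemma cImM (x y : C) : complex.Im (x * y) =
  complex.Re x * complex.Im y + complex.Im x * complex.Re y.
Proof. by case: x => ? ?; case: y. Qed.

Lemma cReD (x y : C) : complex.Re (x + y) = complex.Re x + complex.Re y.
Proof. by case: x => ? ?; case: y. Qed.

Lemma cImD (x y : C) : complex.Im (x + y) = complex.Im x + complex.Im y.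
Proof. by case: x => ? ?; case: y. Qed.

Lemma cReN (x : C) : complex.Re (- x) = - complex.Re x.
Proof. by case: x. Qed.

Lemma cImN (x : C) : complex.Im (- x) = - complex.Im x.
Proof. by case: x. Qed.

Lemma cRe_conj (x : C) : complex.Re (x^*) = complex.Re x.
Proof. by case: x. Qed.

Lemma cIm_conj (x : C) : complex.Im (x^*) = - complex.Im x.
Proof. by case: x. Qed.

Lemma complexP (x y : C) : complex.Re x = complex.Re y -> complex.Im x = complex.Im y -> x = y.
Proof. by case: x => ? ?; case: y => ? ? /= -> ->. Qed.

Lemma signC n : ((-1) ^+ n : C) = ((-1) ^+ n)%:C.
Proof. by rewrite rmorphXn rmorphN1. Qed.

Lemma L2P I f : measurable I -> L2 I f <-> rL2 I (rePart f) /\ rL2 I (imPart f).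
Proof.
move=> mI; split => [[mr mi i2]|[[mr r2] [mi i2]]]; last first.
  by split=> //; exact: RintegrableD.
have mr2 : measurable_fun I (fun x => rePart f x ^+ 2) by exact: measurable_funX.
have mi2 : measurable_fun I (fun x => imPart f x ^+ 2) by exact: measurable_funX.
split; split=> //; apply: (le_Rintegrable mI _ _ i2) => // x _ /=.
  by rewrite ger0_norm ?sqr_ge0// lerDl sqr_ge0.
by rewrite ger0_norm ?sqr_ge0// lerDr sqr_ge0.
Qed.

Lemma compact_hull (K : set R) : K !=set0 -> compact K ->
  exists c d, [/\ K c, K d & forall x, K x -> c <= x <= d].
Proof.
move=> K0 cK.
have cid : {within K, continuous (id : R -> R)} by apply: continuous_subspaceT => x; exact: cvg_id.
have [d Kd dmax] := @compact_EVT_max _ R id K K0 cK cid.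
have [c Kc cmin] := @compact_EVT_min _ R id K K0 cK cid.
exists c, d; split; [exact: set_mem Kc|exact: set_mem Kd|] => x /mem_set Kx.
by apply/andP; split; [exact: cmin|exact: dmax].
Qed.

(** The least and greatest points of a nonempty compact subset of [I] lie in [I], which links the
    compact supports of [test_fun] with the segments of [rtest]. *)
Lemma test_funP a I eta : isedge a I ->
  test_fun I eta <-> rtest I (rePart eta) /\ rtest I (imPart eta).
Proof.
move=> aI; split => [[sr si [K [cK KI K0]]]|[tr ti]].
  have [c [d [Ic Id H]]] : exists c d, [/\ I c, I d & forall x, K x -> c <= x <= d].
    have [KN|K0'] := pselect (K !=set0).
      have [c [d [Kc Kd h]]] := compact_hull KN cK.
      by exists c, d; split=> //; exact: KI.
    have [c Ic _] := edge_nonempty aI.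
    by exists c, c; split=> // x Kx; exfalso; apply: K0'; exists x.
  by split; split=> //; exists (c, d); split=> //= x h; rewrite /rePart /imPart K0// => /H.
have [c [d [Ic Id h1 h2]]] := rtest_hull tr ti.
split; [exact: tr.1|exact: ti.1|].
exists `[c, d]%classic; split; first exact: segment_compact.
  move=> x /=; rewrite in_itv/= => /andP[cx xd].
  by apply: (edge_conn aI Id) => //; apply: lt_le_trans cx; exact: (edge_gt aI Ic).
move=> x /=; rewrite in_itv/= => h; apply: complexP; first exact: (h1 x).
exact: (h2 x).
Qed.

Lemma derive1n_cst0 n : derive1n n (fun _ : R => 0 : R) = fun=> 0.
Proof.
elim: n => // n IH; rewrite derive1nS IH.
by apply/funext => x; exact: derive1_cst.
Qed.

Lemma rtest_derive1n n I (eta : R -> R) : rtest I eta -> rtest I (derive1n n eta).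
Proof.
elim: n eta => // n IH eta te; rewrite derive1nSr; apply: IH; exact: rtest_derive1.
Qed.

Definition ofReal (f : R -> R) (x : R) : C := (f x)%:C.

(** Real-valued test functions separate the real and imaginary parts; conversely the complex
    identity is recombined from four real ones. *)
Lemma is_weak_derivP a I n f g : redge a I -> L2 I f -> L2 I g ->
  is_weak_deriv I n f g <->
  rwd n I (rePart f) (rePart g) /\ rwd n I (imPart f) (imPart g).
Proof.
move=> eI; have aI := eI.1; have mI := edge_measurable aI.
move=> /(L2P f mI)[fr fi] /(L2P g mI)[gr gi]; split.
  move=> H.
  have {}H (e : R -> R) : rtest I e ->
    cintegral I (fun x => f x * cderiv n (ofReal e) x) =
    (-1) ^+ n * cintegral I (fun x => g x * ofReal e x).
    move=> te; apply: H; apply/(test_funP _ aI); split.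
      exact: te.
    split; first exact: smooth_cst.
    by have [_ [cd [h1 h2 _]]] := te; exists cd.
  have im0 e : imPart (ofReal e) = fun=> 0 by [].
  have re0 e : rePart (ofReal e) = e by [].
  have d0 e x : cderiv n (ofReal e) x = (derive1n n e x)%:C.
    by rewrite /cderiv im0 re0 derive1n_cst0.
  split=> e te; have := H e te; rewrite signC.
    move=> /(congr1 (@complex.Re R)); rewrite cReM/= mul0r subr0 => E.
    transitivity (\int[mu]_(x in I) rePart (fun x => f x * cderiv n (ofReal e) x) x).
      by apply: eq_Rintegral => x _; rewrite /rePart d0 cReM/= mulr0 subr0.
    rewrite E; congr (_ * _).
    by apply: eq_Rintegral => x _; rewrite /rePart cReM/= mulr0 subr0.
  move=> /(congr1 (@complex.Im R)); rewrite cImM/= mul0r addr0 => E.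
  transitivity (\int[mu]_(x in I) imPart (fun x => f x * cderiv n (ofReal e) x) x).
    by apply: eq_Rintegral => x _; rewrite /imPart d0 cImM/= mulr0 add0r.
  rewrite E; congr (_ * _).
  by apply: eq_Rintegral => x _; rewrite /imPart cImM/= mulr0 add0r.
move=> [wr wi] eta /(test_funP _ aI)[tr ti].
have dr := rtest_derive1n n tr; have di := rtest_derive1n n ti.
have IE (u v : R -> R) := rL2_test_integrable eI (f := u) (eta := v).
rewrite signC; apply: complexP.
  rewrite cReM/= mul0r subr0.
  transitivity (\int[mu]_(x in I) (rePart f x * derive1n n (rePart eta) x - imPart f x * derive1n n (imPart eta) x)).
    by apply: eq_Rintegral => x _; rewrite /rePart cReM.
  rewrite RintegralB ?IE// wr// wi// -mulrBr; congr (_ * _).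
  rewrite -RintegralB ?IE//.
  by apply: eq_Rintegral => x _; rewrite /rePart cReM.
rewrite cImM/= mul0r addr0.
transitivity (\int[mu]_(x in I) (rePart f x * derive1n n (imPart eta) x + imPart f x * derive1n n (rePart eta) x)).
  by apply: eq_Rintegral => x _; rewrite /imPart cImM.
rewrite RintegralD ?IE// wr// wi// -mulrDr; congr (_ * _).
rewrite -RintegralD ?IE//.
by apply: eq_Rintegral => x _; rewrite /imPart cImM.
Qed.

Definition cH2 a I f F0 F1 g :=
  rH2 a I (rePart f) (rePart F0) (rePart F1) (rePart g) /\
  rH2 a I (imPart f) (imPart F0) (imPart F1) (imPart g).

Lemma ae_eq_complex I f g : ae_eq mu I f g <->
  ae_eq mu I (rePart f) (rePart g) /\ ae_eq mu I (imPart f) (imPart g).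
Proof.
split=> [h|[h1 h2]].
  by split; apply: aeS h => x e Ix; rewrite /rePart /imPart e.
by apply: (ae2S _ h1 h2) => x e1 e2 Ix; apply: complexP; [exact: e1|exact: e2].
Qed.

(** Makes the choice operator in [trace] harmless: all continuous representatives have the same
    value at [c]. *)
Lemma trace_eq I f f0 c : open I -> closure I c ->
  continuous (rePart f0) -> continuous (imPart f0) -> ae_eq mu I f f0 ->
  trace I f c = f0 c.
Proof.
move=> oI Ic cr ci ff0; apply: xget_unique.
  by exists f0; split=> //; exact: continuous_subspaceT.
move=> z [f1 [cr1 ci1 ff1 <-]].
have [r0 i0] := (ae_eq_complex I f f0).1 ff0.
have [r1 i1] := (ae_eq_complex I f f1).1 ff1.
apply: complexP.
  apply: (@within_closure_unique _ I (rePart f1) (rePart f0) c) => //.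
    exact: continuous_subspaceT.
  by apply: (ae2S _ r0 r1) => x e0 e1 Ix; rewrite -e1// e0.
apply: (@within_closure_unique _ I (imPart f1) (imPart f0) c) => //.
  exact: continuous_subspaceT.
by apply: (ae2S _ i0 i1) => x e0 e1 Ix; rewrite -e1// e0.
Qed.

Lemma wderiv_eq a I n f g : redge a I -> L2 I f -> L2 I g -> is_weak_deriv I n f g ->
  ae_eq mu I (wderiv I n f) g.
Proof.
move=> eI Lf Lg wg; have aI := eI.1; have mI := edge_measurable aI.
have [Lw ww] : L2 I (wderiv I n f) /\ is_weak_deriv I n f (wderiv I n f).
  apply: (@xgetPex _ (fun=> 0) [set g | L2 I g /\ is_weak_deriv I n f g]).
  by exists g.
have [w1 w2] := (is_weak_derivP n eI Lf Lg).1 wg.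
have [w3 w4] := (is_weak_derivP n eI Lf Lw).1 ww.
have [g1 g2] := (L2P g mI).1 Lg; have [g3 g4] := (L2P _ mI).1 Lw.
apply/ae_eq_complex; split.
  exact: (rwd_unique eI g3 g1 w3 w1).
exact: (rwd_unique eI g4 g2 w4 w2).
Qed.

Section OnEdge.
Variables (a : R) (I : set R) (eI : redge a I).
Let aI : isedge a I := eI.1.
Let mI : measurable I := edge_measurable aI.

Lemma cH2_L2 f F0 F1 g : cH2 a I f F0 F1 g -> [/\ L2 I F0, L2 I F1 & L2 I g].
Proof.
move=> [[_ [r0 r1 rg]] [_ [i0 i1 ig]]].
by split; apply/(L2P _ mI).
Qed.

Lemma cH2_wd f F0 F1 g : L2 I f -> cH2 a I f F0 F1 g ->
  is_weak_deriv I 1 f F1 /\ is_weak_deriv I 2 f g.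
Proof.
move=> Lf cf; have [L0 L1 Lg] := cH2_L2 cf; have [fr fi] := (L2P f mI).1 Lf.
have [cr ci] := cf; split.
  apply/(is_weak_derivP 1 eI Lf L1); split.
    exact: (rH2_rwd1 eI fr cr).
  exact: (rH2_rwd1 eI fi ci).
apply/(is_weak_derivP 2 eI Lf Lg); split.
  exact: (rH2_rwd2 eI fr cr).
exact: (rH2_rwd2 eI fi ci).
Qed.

Lemma cH2_H2 f F0 F1 g : L2 I f -> cH2 a I f F0 F1 g -> H2 I f.
Proof.
move=> Lf cf; have [L0 L1 Lg] := cH2_L2 cf; have [w1 w2] := cH2_wd Lf cf.
split=> // -[|[|[|//]]] _.
- exists f; split=> // eta _; rewrite expr0 mul1r.
  congr cintegral; apply/funext => x; congr (_ * _).
  by rewrite /cderiv /=; apply: complexP.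
- by exists F1.
- by exists g.
Qed.

Lemma H2_cH2 f : H2 I f -> exists F0 F1, cH2 a I f F0 F1 (wderiv I 2 f).
Proof.
move=> [Lf H].
have [Lg wg] : L2 I (wderiv I 2 f) /\ is_weak_deriv I 2 f (wderiv I 2 f).
  by apply: (@xgetPex _ (fun=> 0) [set g | L2 I g /\ is_weak_deriv I 2 f g]); exact: H.
have [w1 w2] := (is_weak_derivP 2 eI Lf Lg).1 wg.
have [fr fi] := (L2P f mI).1 Lf; have [gr gi] := (L2P _ mI).1 Lg.
have [F0 [F1 h1]] := rwd2_rH2 eI fr gr w1.
have [G0 [G1 h2]] := rwd2_rH2 eI fi gi w2.
by exists (fun x => F0 x +i* G0 x), (fun x => F1 x +i* G1 x).
Qed.

Lemma cH2_trace f F0 F1 g c : closure I c -> L2 I f -> cH2 a I f F0 F1 g ->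
  [/\ trace I f c = F0 c, trace I (wderiv I 1 f) c = F1 c &
      ae_eq mu I (wderiv I 2 f) g].
Proof.
move=> Ic Lf cf; have [L0 L1 Lg] := cH2_L2 cf; have [w1 w2] := cH2_wd Lf cf.
have [[[cr0 cr1 _ _ er] _] [[ci0 ci1 _ _ ei] _]] := cf.
split.
- by apply: trace_eq => //; [exact: edge_open aI|apply/ae_eq_complex].
- by apply: trace_eq => //; [exact: edge_open aI|exact: wderiv_eq eI Lf L1 w1].
- exact: wderiv_eq eI Lf Lg w2.
Qed.

Lemma weak2_cH2 f g : L2 I f -> L2 I g -> is_weak_deriv I 2 f g ->
  exists F0 F1, cH2 a I f F0 F1 g.
Proof.
move=> Lf Lg wg; have [w1 w2] := (is_weak_derivP 2 eI Lf Lg).1 wg.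
have [fr fi] := (L2P f mI).1 Lf; have [gr gi] := (L2P _ mI).1 Lg.
have [F0 [F1 h1]] := rwd2_rH2 eI fr gr w1.
have [G0 [G1 h2]] := rwd2_rH2 eI fi gi w2.
by exists (fun x => F0 x +i* G0 x), (fun x => F1 x +i* G1 x).
Qed.

End OnEdge.
End ComplexEdge.

(** * Density of test functions in L2 of an edge *)

Section Density.
Variable R : realType.
Implicit Types (f g h : R -> R).
Notation mu := (@lebesgue_measure R).

Lemma edge_exhaustion a (I : set R) : isedge a I -> exists c d : nat -> R,
  [/\ forall n, I (c n), forall n, I (d n) &
   forall x, I x -> \forall n \near \oo, c n < x < d n].
Proof.
move=> aI.
have inv0 : (n.+3%:R^-1 : R) @[n --> \oo] --> 0.
  by have := @cvg_harmonic R; rewrite -(cvg_shiftn 2); under eq_fun do rewrite /= addn2.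
have [b -> [->|[b' ab ->]]] := aI.
  exists (fun n => a + n.+3%:R^-1), (fun n => a + n.+3%:R); split.
  - by move=> n; rewrite /= in_itv/= andbT ltrDl invr_gt0.
  - by move=> n; rewrite /= in_itv/= andbT ltrDl.
  - move=> x /=; rewrite in_itv/= andbT => ax.
    near=> n; apply/andP; split.
      rewrite -ltrBrDl; near: n; apply: (cvgr_lt 0 inv0); lra.
    rewrite -ltrBlDl (@lt_le_trans _ _ n%:R)//; last by rewrite ler_nat -addn3 leq_addr.
    by near: n; exact: nbhs_infty_gtr.
exists (fun n => a + (b' - a) * n.+3%:R^-1), (fun n => b' - (b' - a) * n.+3%:R^-1).
have ba : 0 < b' - a by rewrite subr_gt0.
have h n : 0 < (b' - a) * n.+3%:R^-1 /\ (b' - a) * n.+3%:R^-1 < b' - a.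
  by rewrite mulr_gt0 ?invr_gt0 ?ltr0n// gtr_pMr// invf_lt1 ?ltr0n// ltr1n.
split.
- by move=> n; move: (h n); set u := _ * _ => -[h1 h2]; rewrite /= in_itv/=; apply/andP; split; lra.
- by move=> n; move: (h n); set u := _ * _ => -[h1 h2]; rewrite /= in_itv/=; apply/andP; split; lra.
- move=> x /=; rewrite in_itv/= => /andP[ax xb].
  near=> n.
  have h1 : n.+3%:R^-1 < (x - a) / (b' - a).
    by near: n; apply: (cvgr_lt 0 inv0); rewrite divr_gt0//; lra.
  have h2 : n.+3%:R^-1 < (b' - x) / (b' - a).
    by near: n; apply: (cvgr_lt 0 inv0); rewrite divr_gt0//; lra.
  rewrite ltr_pdivlMr// in h1; rewrite ltr_pdivlMr// in h2.
  rewrite (mulrC (b' - a)); move: h1 h2; set u := _ * _ => h1 h2.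
  apply/andP; split; lra.
Unshelve. all: by end_near. Qed.

Section OnEdge.
Variables (a : R) (I : set R) (aI : isedge a I).
Let mI : measurable I := edge_measurable aI.

(** Membership in the L2 closure of the real test functions; [e] bounds the square of the
    distance. *)
Definition approx f := rL2 I f /\ forall e, 0 < e ->
  exists2 eta, rtest I eta & \int[mu]_(x in I) (f x - eta x) ^+ 2 < e.

Lemma rtest_rL2 eta : rtest I eta -> rL2 I eta.
Proof.
move=> te; have [_ [[c d] /= [_ _ h]]] := te.
by apply: (supported_rL2 mI (rtest_continuous te)) => z _; exact: h.
Qed.

Lemma le_sq_sum f g h k1 k2 : rL2 I f -> rL2 I g -> rL2 I h ->
  (forall x, f x ^+ 2 <= k1 * g x ^+ 2 + k2 * h x ^+ 2) ->
  \int[mu]_(x in I) f x ^+ 2 <=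
  k1 * \int[mu]_(x in I) g x ^+ 2 + k2 * \int[mu]_(x in I) h x ^+ 2.
Proof.
move=> [_ f2] [_ g2] [_ h2] H.
have i1 := RintegrableZ k1 mI g2; have i2 := RintegrableZ k2 mI h2.
rewrite -!RintegralZl// -RintegralD//.
by apply: le_Rintegral => //; exact: RintegrableD.
Qed.

Lemma approx_lim f : rL2 I f ->
  (forall e, 0 < e -> exists2 g, approx g & \int[mu]_(x in I) (f x - g x) ^+ 2 < e) ->
  approx f.
Proof.
move=> Lf H; split=> // e e0; have e4 : 0 < e / 4 by lra.
have [g [Lg Ag] fg] := H _ e4; have [eta te ge] := Ag _ e4.
exists eta => //; have Le := rtest_rL2 te.
apply: le_lt_trans (@le_sq_sum (fun x => f x - eta x) (fun x => f x - g x) (fun x => g x - eta x) 2 2 _ _ _ _) _.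
- exact: rL2B.
- exact: rL2B.
- exact: rL2B.
- move=> x; have := sqr_ge0 ((f x - g x) - (g x - eta x)); nra.
- lra.
Qed.

Lemma approxDZ k f g : approx f -> approx g -> approx (fun x => f x + k * g x).
Proof.
move=> [Lf Af] [Lg Ag]; split; first by apply: rL2D => //; exact: rL2Z.
move=> e e0; have e4 : 0 < e / 4 by lra.
(* After the factor $2k^2$ the error of [g] is at most e/2; the added 1 keeps the divisor positive
   when k = 0. *)
have k0 : 0 < 4 * (k ^+ 2 + 1) by have := sqr_ge0 k; lra.
have [eta te fe] := Af _ e4.
have [theta tt ge] := Ag _ (divr_gt0 e0 k0).
exists (fun x => eta x - (- k) * theta x); first by apply: rtestB => //; exact: rtestZ.
have [Le Lt] := (rtest_rL2 te, rtest_rL2 tt).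
have L1 : rL2 I (fun x => f x - eta x) by exact: rL2B.
have L2 : rL2 I (fun x => g x - theta x) by exact: rL2B.
have L3 : rL2 I (fun x => f x + k * g x - (eta x - - k * theta x)).
  apply: rL2B => //; first by apply: rL2D => //; exact: rL2Z.
  by apply: rL2B => //; exact: rL2Z.
apply: le_lt_trans (@le_sq_sum _ _ _ 2 (2 * k ^+ 2) L3 L1 L2 _) _.
  by move=> x; have := sqr_ge0 ((f x - eta x) - k * (g x - theta x)); nra.
rewrite ltr_pdivlMr// in ge; set Q := \int[mu]_(x in I) (g x - theta x) ^+ 2 in ge *.
have Q0 : 0 <= Q by apply: Rintegral_ge0 => x _; exact: sqr_ge0.
have : 2 * k ^+ 2 * Q <= e / 2 by nra.
move=> h; lra.
Qed.

Lemma approx0 : approx (fun=> 0).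
Proof.
split=> [|e e0]; first exact: rL2_0.
have [c Ic _] := edge_nonempty aI.
exists (fun=> 0).
  by split; [exact: smooth_cst|exists (c, c)].
under eq_Rintegral do rewrite subr0 expr0n/=.
by rewrite Rintegral_cst// mul0r.
Qed.

Lemma approx_dominated (u : nat -> R -> R) f g : (forall n, approx (u n)) -> rL2 I f ->
  rL2 I g -> (forall x, I x -> u n x @[n --> \oo] --> f x) ->
  (forall n x, I x -> `|f x - u n x| <= `|g x|) -> approx f.
Proof.
move=> Au Lf Lg uf fug; apply: approx_lim => // e e0.
have : \int[mu]_(x in I) (f x - u n x) ^+ 2 @[n --> \oo] --> \int[mu]_(x in I) 0.
  apply: (@Rdominated _ _ _ mu _ _ _ (fun x => g x ^+ 2)) => //.
  - move=> n; apply: measurable_funX; apply: measurable_funB; first exact: Lf.1.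
    exact: (Au n).1.1.
  - move=> x Ix; rewrite -[X in _ --> X](expr0n _ 2) -(subrr (f x)).
    rewrite expr2; under eq_fun do rewrite expr2.
    by apply: cvgM; apply: cvgB; (exact: cvg_cst || exact: uf).
  - exact: Lg.2.
  - move=> n x Ix; rewrite normrX -[leRHS](@real_normK _ _ )?num_real//.
    by rewrite lerXn2r ?nnegrE// fug.
rewrite Rintegral_cst// mul0r => /cvgr_lt /(_ e e0) [n _ h].
by exists (u n) => //; exact: h n (leqnn _).
Qed.

Lemma indic_rL2 (A : set R) c d : measurable A -> A `<=` `[c, d] -> rL2 I (\1_A).
Proof.
move=> mA Acd; split; first exact: measurable_indic.
apply: (RintegrableS measurableT mI) => //.
have : mu.-integrable setT (EFin \o ((fun _ : R => 1 : R) \_ `[c, d])).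
  apply: integrable_patch; exact: loci_cst.
apply: le_Rintegrable => //.
  by apply: measurable_funX; exact: measurable_indic.
move=> x _; rewrite indicE patchE ger0_norm ?sqr_ge0//.
have [xA|xA] := boolP (x \in A); last by rewrite expr0n; case: ifP.
by rewrite mem_set ?expr1n//; apply: Acd; rewrite inE in xA.
Qed.

Lemma approx_ooindic c d : I c -> I d -> approx (\1_(`]c, d[%classic : set R)).
Proof.
move=> Ic Id.
have Lcd : rL2 I (\1_(`]c, d[%classic : set R)).
  by apply: (@indic_rL2 _ c d) => //; exact: subset_itv_oo_cc.
apply: (@approx_dominated (plateau c d) _ (\1_(`]c, d[%classic : set R))) => //.
- move=> n; split; first by apply: rtest_rL2; exact: rtest_plateau.
  move=> e e0; exists (plateau c d n); first exact: rtest_plateau.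
  under eq_Rintegral do rewrite subrr expr0n/=.
  by rewrite Rintegral_cst// mul0r.
- move=> x _; rewrite indicE.
  have -> : (x \in `]c, d[%classic) = (c < x < d)%R.
    by apply/idP/idP; rewrite inE/= in_itv/=.
  exact: plateau_cvg.
- move=> n x _; rewrite indicE; have [xcd|xcd] /= := boolP (x \in `]c, d[%classic).
    rewrite normr1 ler_norml.
    have := plateau_ge0 c d n x; have := plateau_le1 c d n x; move=> ? ?; apply/andP; split; lra.
  rewrite plateau_out ?subrr//; move: xcd; rewrite notin_setE/= in_itv/=.
  by move=> h h'; apply: h.
Qed.

(** Dynkin induction from the half-lines, which are stable under intersection. Cutting with []c, d[]
    keeps all indicators square-integrable, so that complements and countable disjoint unions stay
    in the closed linear class [approx]. *)
Lemma approx_indic c d (S : set R) : I c -> I d -> measurable S ->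
  approx (\1_(S `&` `]c, d[%classic)).
Proof.
move=> Ic Id mS.
pose G : set (set R) := [set A | exists x, A = `]x, +oo[%classic].
have Acd := approx_ooindic Ic Id.
have L S' : measurable S' -> rL2 I (\1_(S' `&` `]c, d[%classic)).
  move=> mS'; apply: (@indic_rL2 _ c d); first exact: measurableI.
  by apply: subset_trans (@subset_itv_oo_cc _ _ c d) => x [].
apply: (@dynkin_induction _ _ G (fun S => approx (\1_(S `&` `]c, d[%classic)))) => //.
- exact: RGenOInfty.measurableE.
- move=> _ _ [x ->] [y ->]; exists (Num.max x y).
  by apply/seteqP; split=> z; rewrite /= !in_itv/= !andbT gt_max => /andP.
- by rewrite setTI.
- move=> _ [x ->].
  have [cx|xc] := leP c x; last first.
    rewrite (_ : _ `&` _ = `]c, d[%classic)//.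
    apply/seteqP; split=> z /=; rewrite !in_itv/= ?andbT; first by case.
    by move=> /andP[cz zd]; rewrite cz zd; split=> //; exact: lt_trans cz.
  have [dx|xd] := leP d x.
    rewrite (_ : _ `&` _ = set0); first by rewrite indic0; exact: approx0.
    apply/seteqP; split=> z //=; rewrite !in_itv/= ?andbT => -[xz /andP[_ zd]].
    by move: (lt_trans (lt_le_trans zd dx) xz); rewrite ltxx.
  rewrite (_ : _ `&` _ = `]x, d[%classic).
    apply: approx_ooindic => //; apply: (edge_conn aI Id); last exact: ltW.
    by apply: lt_le_trans cx; exact: (edge_gt aI Ic).
  apply/seteqP; split=> z /=; rewrite !in_itv/= ?andbT.
    by move=> [-> /andP[_ ->]].
  by move=> /andP[xz zd]; rewrite xz zd (le_lt_trans cx xz).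
- move=> A mA AA; have := approxDZ (-1) Acd AA; congr approx; apply/funext => x.
  rewrite !indicE !in_setI; rewrite in_setC.
  by case: (x \in A); case: (x \in _) => /=; ring.
- move=> F mF tF AF.
  have key n : approx (fun x => \sum_(k < n) \1_(F k `&` `]c, d[%classic) x).
    elim: n => [|n IH].
      by under eq_fun do rewrite big_ord0; exact: approx0.
    under eq_fun do rewrite big_ord_recr/= -[X in _ + X]mul1r.
    exact: approxDZ.
  have sumE x k0 n : F k0 x -> (c < x < d)%R ->
      \sum_(k < n) \1_(F k `&` `]c, d[%classic) x = (k0 < n)%N%:R :> R.
    move=> Fx xcd; elim: n => [|n IH]; first by rewrite big_ord0.
    rewrite big_ord_recr/= IH indicE.
    have -> : (x \in F n `&` `]c, d[%classic) = (n == k0).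
      apply/idP/idP => [|/eqP ->]; last by rewrite inE; split=> //=; rewrite in_itv.
      rewrite inE => -[Fnx _]; apply/eqP; apply: (tF _ _ Logic.I Logic.I); by exists x.
    by rewrite ltnS; case: ltngtP => _; rewrite ?addr0 ?add0r.
  have sum0 x n : ~ ((\bigcup_k F k) `&` `]c, d[%classic) x ->
      \sum_(k < n) \1_(F k `&` `]c, d[%classic) x = 0 :> R.
    move=> h; apply: big1 => k _; rewrite indicE memNset// => -[Fx xcd].
    by apply: h; split=> //; exists k.
  have mU : measurable (\bigcup_k F k) by exact: bigcup_measurable.
  apply: (approx_dominated key (L _ mU) Acd.1).
  + move=> x _; rewrite indicE; have [xU|xU] := boolP (x \in (\bigcup_k F k) `&` `]c, d[%classic).
      rewrite inE in xU; have [[k0 _ Fx] xcd] := xU.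
      rewrite /= in_itv/= in xcd.
      apply: cvg_near_cst; exists k0.+1 => // n /= k0n.
      by rewrite (sumE _ _ _ Fx xcd) k0n.
    rewrite notin_setE in xU; apply: cvg_near_cst; apply: nearW => n.
    by rewrite sum0.
  + move=> n x _; have [xU|xU] := pselect (((\bigcup_k F k) `&` `]c, d[%classic) x).
      have [[k0 _ Fx] xcd] := xU; rewrite !indicE (mem_set xU) (mem_set xcd).
      rewrite /= in_itv/= in xcd.
      by rewrite (sumE _ _ _ Fx xcd); case: (k0 < n)%N; rewrite ?subrr ?subr0 ?normr0 ?normr1.
    by rewrite sum0// indicE memNset// subrr normr0.
- have h : measurable S = <<s G >> S := congr1 (fun m : set (set R) => m S) (RGenOInfty.measurableE R).
  by rewrite -h.
Qed.

Import HBSimple HBNNSimple.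

(** Simple functions below [f] and converging to it, cut off to intervals that exhaust the edge, so
    that each is a finite combination of indicators covered by [approx_indic]. *)
Lemma approx_ge0 f : rL2 I f -> (forall x, 0 <= f x) -> approx f.
Proof.
move=> Lf f0; have [mf f2] := Lf.
have mfE : measurable_fun I (EFin \o f) by exact/measurable_EFinP.
have f0E x : I x -> (0 <= (EFin \o f) x)%E by rewrite lee_fin.
have [c [d [Ic Id H]]] := edge_exhaustion aI.
pose s n := nnsfun_approx mI mfE n.
apply: (@approx_dominated (fun n x => s n x * \1_(`]c n, d n[%classic) x) _ f) => //.
- move=> n.
  pose l : seq R := finmap.enum_fset (fset_set (range (s n))).
  rewrite (_ : (fun x => _) = fun x =>
    \sum_(y <- l) (y * \1_(s n @^-1` [set y] `&` `]c n, d n[%classic) x)); last first.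
    apply/funext => x; rewrite fimfunE fsbig_finite//= mulr_suml; apply: eq_bigr => i _.
    by rewrite indicI mulrA.
  elim: l => [|y l IH]; first by under eq_fun do rewrite big_nil; exact: approx0.
  under eq_fun do rewrite big_cons addrC.
  by apply: approxDZ => //; exact: approx_indic.
- move=> x Ix.
  have c1 : s n x @[n --> \oo] --> f x.
    by have := cvg_nnsfun_approx mI mfE f0E Ix; exact: fine_cvg.
  rewrite -[f x]mulr1; apply: cvgM => //.
  apply: cvg_near_cst; have := H x Ix; apply: filterS => n xcd.
  by rewrite indicE mem_set//= in_itv.
- move=> n x Ix.
  have s0 : 0 <= s n x by [].
  have sf : s n x <= f x.
    by rewrite /s nnsfun_approxE -lee_fin; exact: (le_approx _ f0E).
  rewrite indicE; case: (_ \in _); rewrite ?mulr1 ?mulr0.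
    by rewrite !ger0_norm ?subr_ge0// lerBlDr lerDl.
  by rewrite subr0.
Qed.

Lemma test_dense f : rL2 I f -> approx f.
Proof.
move=> Lf; have [mf f2] := Lf.
have Lp : rL2 I (fun x => Num.max (f x) 0).
  split; first exact: measurable_maxr.
  apply: (le_Rintegrable mI _ _ f2).
    by apply: measurable_funX; exact: measurable_maxr.
  move=> x _; rewrite ger0_norm ?sqr_ge0// /Num.max; case: ifP => _ //.
  by rewrite expr0n sqr_ge0.
have Ln : rL2 I (fun x => Num.max (f x) 0 - f x) by exact: rL2B.
have h1 : approx (fun x => Num.max (f x) 0).
  by apply: approx_ge0 => // x; rewrite le_max lexx orbT.
have h2 : approx (fun x => Num.max (f x) 0 - f x).
  by apply: approx_ge0 => // x; rewrite subr_ge0 le_max lexx.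
have := approxDZ (-1) h1 h2; congr approx; apply/funext => x; ring.
Qed.

End OnEdge.
End Density.

(** * Inner products, linearity and Green's formula for complex functions on an edge *)

Section EdgeFunctions.
Variable R : realType.
Local Notation C := R[i].
Implicit Types (f g h F G eta : R -> C) (I : set R).
Notation mu := (@lebesgue_measure R).

Lemma measurable_ae_integral I (u v : R -> R) : measurable I -> measurable_fun I u ->
  measurable_fun I v -> ae_eq mu I u v -> \int[mu]_(x in I) u x = \int[mu]_(x in I) v x.
Proof.
move=> mI mu_ mv uv; congr fine; apply: ae_eq_integral => //.
- exact/measurable_EFinP.
- exact/measurable_EFinP.
- by apply: aeS uv => x e /e ->.
Qed.

Definition inner I f g : C := cintegral I (fun x => f x * (g x)^*).

Lemma inner_ae I f f' g g' : measurable I -> L2 I f -> L2 I f' -> L2 I g -> L2 I g' ->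
  ae_eq mu I f f' -> ae_eq mu I g g' -> inner I f g = inner I f' g'.
Proof.
move=> mI [fr fi _] [fr' fi' _] [gr gi _] [gr' gi' _] ff gg.
have mM (u u' v v' : R -> R) : measurable_fun I u -> measurable_fun I u' ->
    measurable_fun I v -> measurable_fun I v' -> measurable_fun I (fun x => u x * v x + u' x * v' x).
  by move=> *; apply: measurable_funD; apply: measurable_funM.
have mN (u : R -> R) : measurable_fun I u -> measurable_fun I (fun x => - u x).
  by move=> ?; apply: measurableT_comp.
have E1 h k : rePart (fun x => h x * (k x)^*) =
    fun x => rePart h x * rePart k x + imPart h x * imPart k x.
  by apply/funext => x; rewrite /rePart cReM cRe_conj cIm_conj /imPart mulrN opprK.
have E2 h k : imPart (fun x => h x * (k x)^*) =
    fun x => rePart h x * (- imPart k x) + imPart h x * rePart k x.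
  by apply/funext => x; rewrite /imPart cImM cRe_conj cIm_conj.
apply: complexP => /=.
  apply: measurable_ae_integral => //; rewrite ?E1; [exact: mM|exact: mM|].
  by apply: (ae2S _ ff gg) => x e1 e2 Ix; rewrite /rePart /imPart e1// e2.
apply: measurable_ae_integral => //; rewrite ?E2; [by apply: mM => //; exact: mN|by apply: mM => //; exact: mN|].
by apply: (ae2S _ ff gg) => x e1 e2 Ix; rewrite /rePart /imPart e1// e2.
Qed.

Lemma innerE I f g : measurable I -> L2 I f -> L2 I g -> inner I f g =
  (\int[mu]_(x in I) (rePart f x * rePart g x) + \int[mu]_(x in I) (imPart f x * imPart g x)) +i*
  (\int[mu]_(x in I) (imPart f x * rePart g x) - \int[mu]_(x in I) (rePart f x * imPart g x)).
Proof.
move=> mI /(L2P f mI)[fr fi] /(L2P g mI)[gr gi].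
have i1 := rL2_integrableM mI fr gr; have i2 := rL2_integrableM mI fi gi.
have i3 := rL2_integrableM mI fr gi; have i4 := rL2_integrableM mI fi gr.
apply: complexP => /=.
  rewrite -RintegralD//; apply: eq_Rintegral => x _.
  by rewrite /rePart cReM cRe_conj cIm_conj /imPart mulrN opprK.
rewrite -RintegralB//; apply: eq_Rintegral => x _.
by rewrite /imPart cImM cRe_conj cIm_conj mulrN addrC.
Qed.

Lemma L2N I f : measurable I -> L2 I f -> L2 I (fun x => - f x).
Proof.
move=> mI /(L2P f mI)[fr fi]; apply/(L2P _ mI); split.
  have := rL2Z (-1) mI fr; congr rL2; apply/funext => x.
  by rewrite mulN1r /rePart cReN.
have := rL2Z (-1) mI fi; congr rL2; apply/funext => x.
by rewrite mulN1r /imPart cImN.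
Qed.

Lemma L2_axpy I (c : C) f g : measurable I -> L2 I f -> L2 I g -> L2 I (fun x => c * f x + g x).
Proof.
move=> mI /(L2P f mI)[fr fi] /(L2P g mI)[gr gi]; apply/(L2P _ mI); split.
  have := rL2D mI (rL2B mI (rL2Z (complex.Re c) mI fr) (rL2Z (complex.Im c) mI fi)) gr.
  by congr rL2; apply/funext => x; rewrite /rePart cReD cReM.
have := rL2D mI (rL2D mI (rL2Z (complex.Re c) mI fi) (rL2Z (complex.Im c) mI fr)) gi.
by congr rL2; apply/funext => x; rewrite /imPart cImD cImM.
Qed.

Lemma L2_0 I : measurable I -> L2 I (fun=> 0).
Proof. by move=> mI; apply/(L2P _ mI); split; exact: rL2_0. Qed.

Section RealLinear.
Variables (a : R) (I : set R) (mI : measurable I).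

Lemma patchD (u v : R -> R) : (fun x => u x + v x) \_ I = fun x => (u \_ I) x + (v \_ I) x.
Proof. by apply/funext => x; rewrite !patchE; case: ifP => // _; rewrite addr0. Qed.

Lemma patchZ k (u : R -> R) : (fun x => k * u x) \_ I = fun x => k * (u \_ I) x.
Proof. by apply/funext => x; rewrite !patchE; case: ifP => // _; rewrite mulr0. Qed.

Lemma acD (F f G g : R -> R) : loci f -> loci g -> ac a F f -> ac a G g ->
  ac a (fun x => F x + G x) (fun x => f x + g x).
Proof.
move=> lf lg aF aG x ax; rewrite (aF x ax) (aG x ax) /prim RintegralD//.
by rewrite addrACA.
Qed.

Lemma acZ k (F f : R -> R) : loci f -> ac a F f -> ac a (fun x => k * F x) (fun x => k * f x).
Proof. by move=> lf aF x ax; rewrite (aF x ax) mulrDr /prim RintegralZl. Qed.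

Lemma rH2D (f F0 F1 g f' F0' F1' g' : R -> R) : rH2 a I f F0 F1 g -> rH2 a I f' F0' F1' g' ->
  rH2 a I (fun x => f x + f' x) (fun x => F0 x + F0' x) (fun x => F1 x + F1' x) (fun x => g x + g' x).
Proof.
move=> [[c0 c1 a0 a1 e] [l0 l1 l2]] [[c0' c1' a0' a1' e'] [l0' l1' l2']].
split; split; try exact: rL2D.
- by move=> x; apply: cvgD; [exact: c0|exact: c0'].
- by move=> x; apply: cvgD; [exact: c1|exact: c1'].
- by apply: acD => //; exact: loci_continuous.
- by rewrite patchD; apply: acD => //; exact: rL2_loci.
- by apply: (ae2S _ e e') => x h h' Ix; rewrite h// h'.
Qed.

Lemma rH2Z k (f F0 F1 g : R -> R) : rH2 a I f F0 F1 g ->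
  rH2 a I (fun x => k * f x) (fun x => k * F0 x) (fun x => k * F1 x) (fun x => k * g x).
Proof.
move=> [[c0 c1 a0 a1 e] [l0 l1 l2]].
split; split; try exact: rL2Z.
- by move=> x; apply: cvgM; [exact: cvg_cst|exact: c0].
- by move=> x; apply: cvgM; [exact: cvg_cst|exact: c1].
- by apply: acZ => //; exact: loci_continuous.
- by rewrite patchZ; apply: acZ => //; exact: rL2_loci.
- by apply: aeS e => x h Ix; rewrite h.
Qed.

End RealLinear.

Section OnEdge.
Variables (a : R) (I : set R) (eI : redge a I).
Let aI : isedge a I := eI.1.
Let mI : measurable I := edge_measurable aI.

Lemma cH2_axpy (c : C) f F0 F1 g f' F0' F1' g' : cH2 a I f F0 F1 g -> cH2 a I f' F0' F1' g' ->
  cH2 a I (fun x => c * f x + f' x) (fun x => c * F0 x + F0' x)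
    (fun x => c * F1 x + F1' x) (fun x => c * g x + g' x).
Proof.
move=> [r i] [r' i']; split.
  have := rH2D mI (rH2D mI (rH2Z mI (complex.Re c) r) (rH2Z mI (- complex.Im c) i)) r'.
  by congr rH2; apply/funext => x; rewrite /rePart cReD cReM mulNr.
have := rH2D mI (rH2D mI (rH2Z mI (complex.Re c) i) (rH2Z mI (complex.Im c) r)) i'.
by congr rH2; apply/funext => x; rewrite /imPart cImD cImM.
Qed.

Lemma cH2_ae f f' F0 F1 g : ae_eq mu I f f' -> cH2 a I f F0 F1 g -> cH2 a I f' F0 F1 g.
Proof.
move=> /ae_eq_complex[er ei] [[[r1 r2 r3 r4 r5] r6] [[i1 i2 i3 i4 i5] i6]].
split; split=> //; split=> //.
  by apply: (ae2S _ er r5) => x h h' Ix; rewrite -h// h'.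
by apply: (ae2S _ ei i5) => x h h' Ix; rewrite -h// h'.
Qed.

Lemma H2_ae f f' c : closure I c -> H2 I f -> L2 I f' -> ae_eq mu I f f' ->
  [/\ H2 I f', trace I f' c = trace I f c,
      trace I (wderiv I 1 f') c = trace I (wderiv I 1 f) c &
      ae_eq mu I (wderiv I 2 f') (wderiv I 2 f)].
Proof.
move=> Ic Hf Lf' ff'; have [F0 [F1 cf]] := H2_cH2 eI Hf.
have cf' := cH2_ae ff' cf.
have [-> -> _] := cH2_trace eI Ic Hf.1 cf.
have [-> -> e] := cH2_trace eI Ic Lf' cf'.
by split=> //; exact: (cH2_H2 eI Lf' cf').
Qed.

Lemma H2_axpy (k : C) f g c : closure I c -> H2 I f -> H2 I g ->
  let h := fun x => k * f x + g x in
  [/\ H2 I h, trace I h c = k * trace I f c + trace I g c,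
      trace I (wderiv I 1 h) c = k * trace I (wderiv I 1 f) c + trace I (wderiv I 1 g) c &
      ae_eq mu I (wderiv I 2 h) (fun x => k * wderiv I 2 f x + wderiv I 2 g x)].
Proof.
move=> Ic Hf Hg h; have [F0 [F1 cf]] := H2_cH2 eI Hf; have [G0 [G1 cg]] := H2_cH2 eI Hg.
have ch := cH2_axpy k cf cg.
have Lh : L2 I h by apply: L2_axpy => //; [exact: Hf.1|exact: Hg.1].
have [-> -> _] := cH2_trace eI Ic Hf.1 cf.
have [-> -> _] := cH2_trace eI Ic Hg.1 cg.
have [-> -> e] := cH2_trace eI Ic Lh ch.
by split=> //; exact: (cH2_H2 eI Lh ch).
Qed.

Lemma H2_L2_wderiv2 f : H2 I f -> L2 I (wderiv I 2 f).
Proof. by move=> Hf; have [F0 [F1 cf]] := H2_cH2 eI Hf; have [] := cH2_L2 eI cf. Qed.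

Lemma smooth_H2 (u v : R -> R) : smooth u -> smooth v ->
  rL2 I u -> rL2 I (derive1 u) -> rL2 I (derive1 (derive1 u)) ->
  rL2 I v -> rL2 I (derive1 v) -> rL2 I (derive1 (derive1 v)) ->
  let f := fun x => u x +i* v x in
  H2 I f /\ (forall c, closure I c -> a <= c -> (forall y, a < y -> y < c -> I y) ->
   [/\ trace I f c = u c +i* v c,
      trace I (wderiv I 1 f) c = derive1 u c +i* derive1 v c &
      ae_eq mu I (wderiv I 2 f) (fun x => derive1 (derive1 u) x +i* derive1 (derive1 v) x)]).
Proof.
move=> su sv u0 u1 u2 v0 v1 v2 f.
have su1 := smooth_derive1 su; have sv1 := smooth_derive1 sv.
have [U0 [U1 [ru Eu]]] := C2_rH2 eI (fun x => smooth_is_derive x su)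
  (fun x => smooth_is_derive x su1) (smooth_continuous (smooth_derive1 su1)) u0 u1 u2.
have [V0 [V1 [rv Ev]]] := C2_rH2 eI (fun x => smooth_is_derive x sv)
  (fun x => smooth_is_derive x sv1) (smooth_continuous (smooth_derive1 sv1)) v0 v1 v2.
have Lf : L2 I f by apply/(L2P f mI).
have cf : cH2 a I f (fun x => U0 x +i* V0 x) (fun x => U1 x +i* V1 x)
  (fun x => derive1 (derive1 u) x +i* derive1 (derive1 v) x) by split; [exact: ru|exact: rv].
split; first exact: (cH2_H2 eI Lf cf).
move=> c Ic ac Hc; have [-> -> e] := cH2_trace eI Ic Lf cf.
have [-> ->] := Eu c ac Hc.
by have [-> ->] := Ev c ac Hc.
Qed.

(* B encodes the boundary contribution of the edge in the real Green formula. *)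
Lemma complex_green (B : (R -> R) -> R) :
  (forall u v : R -> R, B (fun x => u x + v x) = B u + B v) ->
  (forall u v : R -> R, B (fun x => u x - v x) = B u - B v) ->
  (forall f F0 F1 u g G0 G1 v : R -> R, rH2 a I f F0 F1 u -> rH2 a I g G0 G1 v ->
    \int[mu]_(x in I) (u x * G0 x) - \int[mu]_(x in I) (F0 x * v x) =
    B (fun x => F1 x * G0 x - F0 x * G1 x)) ->
  forall f F0 F1 u g G0 G1 v : R -> C, L2 I f -> L2 I g -> cH2 a I f F0 F1 u -> cH2 a I g G0 G1 v ->
  let W := fun x => F1 x * (G0 x)^* - F0 x * (G1 x)^* in
  inner I u g - inner I f v = B (rePart W) +i* B (imPart W).
Proof.
move=> BD BB H f F0 F1 u g G0 G1 v Lf Lg cf cg W.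
have [L0 L1 Lu] := cH2_L2 eI cf; have [M0 M1 Lv] := cH2_L2 eI cg.
have [fr fi] := cf; have [gr gi] := cg.
have eF : ae_eq mu I f F0.
  by apply/ae_eq_complex; split; [case: fr => -[]|case: fi => -[]].
have eG : ae_eq mu I g G0.
  by apply/ae_eq_complex; split; [case: gr => -[]|case: gi => -[]].
rewrite (inner_ae mI Lu Lu Lg M0 (aeW _ (fun x _ => erefl)) eG).
rewrite (inner_ae mI Lf L0 Lv Lv eF (aeW _ (fun x _ => erefl))).
rewrite !innerE//.
have h1 := H _ _ _ _ _ _ _ _ fr gr; have h2 := H _ _ _ _ _ _ _ _ fi gi.
have h3 := H _ _ _ _ _ _ _ _ fi gr; have h4 := H _ _ _ _ _ _ _ _ fr gi.
apply: complexP; rewrite (cReD, cImD) (cReN, cImN) /=.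
  rewrite (_ : rePart W = fun x => (rePart F1 x * rePart G0 x - rePart F0 x * rePart G1 x) +
      (imPart F1 x * imPart G0 x - imPart F0 x * imPart G1 x)); last first.
    apply/funext => x; rewrite /W /rePart /imPart !(cReD, cReN, cReM, cRe_conj, cIm_conj); ring.
  rewrite BD -h1 -h2; ring.
rewrite (_ : imPart W = fun x => (imPart F1 x * rePart G0 x - imPart F0 x * rePart G1 x) -
    (rePart F1 x * imPart G0 x - rePart F0 x * imPart G1 x)); last first.
  apply/funext => x; rewrite /W /rePart /imPart !(cImD, cImN, cImM, cRe_conj, cIm_conj); ring.
rewrite BB -h3 -h4; ring.
Qed.

(** The real and imaginary parts of the pairing with a real test function give the weak equations
    for the two parts of [v], the minus sign being moved onto [w]. *)
Lemma weak_of_test v w : L2 I v -> L2 I w ->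
  (forall e : R -> R, rtest I e ->
    inner I (fun x => - cderiv 2 (ofReal e) x) v = inner I (ofReal e) w) ->
  H2 I v /\ ae_eq mu I w (fun x => - wderiv I 2 v x).
Proof.
move=> Lv Lw H.
have [vr vi] := (L2P v mI).1 Lv; have [wr wi] := (L2P w mI).1 Lw.
have Lw' := L2N mI Lw.
have P (u : R -> R) (e : R -> R) : rL2 I u -> rtest I e ->
    \int[mu]_(x in I) (- u x * e x) = - \int[mu]_(x in I) (u x * e x).
  move=> Lu te; rewrite -mulN1r -RintegralZl//; last exact: (rL2_test_integrable eI Lu te).
  by apply: eq_Rintegral => x _; ring.
have dE (e : R -> R) x : cderiv 2 (ofReal e) x = (derive1n 2 e x)%:C.
  rewrite /cderiv; congr (_ +i* _).
  by rewrite (_ : imPart (ofReal e) = fun=> 0) // derive1n_cst0.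
have wk : is_weak_deriv I 2 v (fun x => - w x).
  apply/(is_weak_derivP 2 eI Lv Lw'); split => e te; have te2 := rtest_derive1n 2 te;
    have := H e te; rewrite sqrrN expr1n mul1r.
    move=> /(congr1 (@complex.Re R)) E.
    have -> : \int[mu]_(x in I) (rePart (fun x => - w x) x * e x) = - \int[mu]_(x in I) (rePart w x * e x).
      by rewrite -P//; apply: eq_Rintegral => x _; rewrite /rePart cReN.
    have -> : \int[mu]_(x in I) (rePart w x * e x) = complex.Re (inner I (ofReal e) w).
      apply: eq_Rintegral => x _; rewrite /rePart cReM cRe_conj cIm_conj/=; ring.
    rewrite -E /= -[LHS]opprK -P//; congr (- _); apply: eq_Rintegral => x _.
    rewrite -[(e^`())^`()%classic]/(derive1n 2 e); rewrite /rePart dE cReM cRe_conj cIm_conj cReN cImN/=; ring.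
  move=> /(congr1 (@complex.Im R)) E.
  have -> : \int[mu]_(x in I) (imPart (fun x => - w x) x * e x) = - \int[mu]_(x in I) (imPart w x * e x).
    by rewrite -P//; apply: eq_Rintegral => x _; rewrite /imPart cImN.
  have -> : - (\int[mu]_(x in I) (imPart w x * e x)) = complex.Im (inner I (ofReal e) w).
    rewrite -P//; apply: eq_Rintegral => x _; rewrite /imPart cImM cRe_conj cIm_conj/=; ring.
  rewrite -E /=; apply: eq_Rintegral => x _.
  rewrite /imPart dE cImM cRe_conj cIm_conj cReN cImN/=; ring.
have [F0 [F1 cv]] := weak2_cH2 eI Lv Lw' wk.
split; first exact: (cH2_H2 eI Lv cv).
have [_ _ e] := cH2_trace eI (closure_edge_left aI) Lv cv.
by apply: aeS e => x h Ix; rewrite h// opprK.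
Qed.

End OnEdge.
End EdgeFunctions.

(** * Functions with prescribed boundary data *)

Section BoundaryData.
Variables (R : realType) (L : R) (hL : 0 < L).
Local Notation C := R[i].
Notation mu := (@lebesgue_measure R).

Lemma germ_affine (f : R -> R) (u v c : R) : (\forall x \near c, f x = u + v * (x - c)) ->
  f c = u /\ derive1 f c = v.
Proof.
move=> h; split; first by rewrite (nbhs_singleton h) subrr mulr0 addr0.
apply: is_derive_derive1; apply: (@near_eq_is_derive _ _ _ (fun x => v * x + (u - v * c))).
  by apply: filterS h => x ->; ring.
exact: is_derive_affine.
Qed.

Lemma loop_redge : redge (- L) (@loopE R L).
Proof. by apply: redge_loop; rewrite gtrN. Qed.

Lemma leg_redge : redge L (@legE R L).
Proof. exact: redge_leg. Qed.

Lemma closure_loop_left : closure (@loopE R L) (- L).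
Proof. exact: closure_edge_left loop_redge.1. Qed.

Lemma closure_loop_right : closure (@loopE R L) L.
Proof. by apply: closure_oo_right; rewrite gtrN. Qed.

Lemma closure_leg : closure (@legE R L) L.
Proof. exact: closure_edge_left leg_redge.1. Qed.

Lemma measurable_loop : measurable (@loopE R L).
Proof. exact: edge_measurable loop_redge.1. Qed.

Lemma measurable_leg : measurable (@legE R L).
Proof. exact: edge_measurable leg_redge.1. Qed.

Lemma smooth_affine_step u v : smooth (fun x : R => step (u * x + v)).
Proof. exact/smooth_affine/smooth_step. Qed.

Lemma smooth_poly1 (u v : R) : smooth (fun x : R => u * x + v).
Proof. by apply: (@smooth_affine R (fun x => x)); exact: smooth_id. Qed.

Lemma loop_smooth_data (p p' q q' : R) : exists2 f : R -> R, smooth f &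
  [/\ f (- L) = p, derive1 f (- L) = p', f L = q & derive1 f L = q'].
Proof.
(* The step is 0 for $x \le -L/2$ and 1 for $x \ge L/2$, so blending two affine functions leaves
   each unchanged near its own endpoint. *)
have L0 := hL; pose s x : R := step (L^-1 * x + 1 / 2).
have LV : L^-1 * L = 1 by rewrite mulVf// gt_eqF.
pose f x := (p' * x + (p + p' * L)) * (1 - s x) + (q' * x + (q - q' * L)) * s x.
have near_left : \forall x \near - L, f x = p + p' * (x - - L).
  near=> x; rewrite /f /s step_le0; first ring.
  have xL : x < - L / 2 by near: x; apply: lt_nbhsl; lra.
  have : L^-1 * x < L^-1 * (- L / 2) by rewrite ltr_pM2l// invr_gt0.
  lra.
have near_right : \forall x \near L, f x = q + q' * (x - L).
  near=> x; rewrite /f /s step_ge1; first ring.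
  have xL : L / 2 < x by near: x; apply: lt_nbhsr; lra.
  have : L^-1 * (L / 2) < L^-1 * x by rewrite ltr_pM2l// invr_gt0.
  lra.
have [l1 l2] := germ_affine near_left; have [r1 r2] := germ_affine near_right.
exists f; last by split.
have ss : smooth s := @smooth_affine_step L^-1 (1 / 2).
have s1 : smooth (fun x => 1 - s x) := smoothB (@smooth_cst R 1) ss.
exact: smoothD (smoothM (@smooth_poly1 _ _) s1) (smoothM (@smooth_poly1 _ _) ss).
Unshelve. all: by end_near. Qed.

Lemma leg_smooth_data (p p' : R) : exists2 f : R -> R, smooth f &
  [/\ f L = p, derive1 f L = p' & forall x, L + 2 < x -> f x = 0].
Proof.
(* The cut-off factor [1 - s x] is 1 up to $L + 1/2$ and 0 from $L + 3/2$ on; the bound $L + 2$ of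
   the statement leaves a margin. *)
pose s x : R := step (1 * x + (- L - 1 / 2)).
pose f x := (p' * x + (p - p' * L)) * (1 - s x).
have near_left : \forall x \near L, f x = p + p' * (x - L).
  near=> x; rewrite /f /s step_le0; first ring.
  have xL : x < L + 1 / 2 by near: x; apply: lt_nbhsl; lra.
  lra.
have [l1 l2] := germ_affine near_left.
exists f; last first.
  by split=> // x xL; rewrite /f /s step_ge1; [ring|lra].
have ss : smooth s := @smooth_affine_step 1 (- L - 1 / 2).
have s1 : smooth (fun x => 1 - s x) := smoothB (@smooth_cst R 1) ss.
exact: smoothM (@smooth_poly1 _ _) s1.
Unshelve. all: by end_near. Qed.

Lemma derive1_vanish (f : R -> R) (T : R) : (forall x, T < x -> f x = 0) ->
  forall x, T < x -> derive1 f x = 0.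
Proof.
move=> f0 x Tx; apply: is_derive_derive1.
apply: (@near_eq_is_derive _ _ _ (fun=> 0)).
by near=> y; rewrite f0//; near: y; exact: lt_nbhsr.
Unshelve. all: by end_near. Qed.

Lemma loop_smooth_rL2 (f : R -> R) : smooth f -> rL2 (@loopE R L) f.
Proof.
move=> sf; apply: (@continuous_rL2 _ _ (- L) L) => //; first exact: measurable_loop.
  exact: subset_itv_oo_cc.
exact: smooth_continuous.
Qed.

Lemma leg_smooth_rL2 (f : R -> R) T : smooth f -> (forall x, T < x -> f x = 0) ->
  rL2 (@legE R L) f.
Proof.
move=> sf f0; apply: (@supported_rL2 _ _ L T) => //; first exact: measurable_leg.
  exact: smooth_continuous.
move=> z; rewrite /legE/= in_itv/= andbT => Lz h; apply: f0.
by rewrite ltNge; apply/negP => zT; apply: h; rewrite (ltW Lz).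
Qed.

Lemma loop_data (p p' q q' : C) : exists2 f : R -> C, H2 (@loopE R L) f &
  [/\ trace (loopE L) f (- L) = p, trace (loopE L) (wderiv (loopE L) 1 f) (- L) = p',
      trace (loopE L) f L = q & trace (loopE L) (wderiv (loopE L) 1 f) L = q'].
Proof.
case: p p' q q' => [pr pi] [pr' pi'] [qr qi] [qr' qi'].
have [u su [u1 u2 u3 u4]] := loop_smooth_data pr pr' qr qr'.
have [v sv [v1 v2 v3 v4]] := loop_smooth_data pi pi' qi qi'.
have [su' sv'] := (smooth_derive1 su, smooth_derive1 sv).
have [su'' sv''] := (smooth_derive1 su', smooth_derive1 sv').
have [Hf T] := smooth_H2 loop_redge su sv (loop_smooth_rL2 su) (loop_smooth_rL2 su')
  (loop_smooth_rL2 su'') (loop_smooth_rL2 sv) (loop_smooth_rL2 sv') (loop_smooth_rL2 sv'').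
exists (fun x => u x +i* v x); first exact: Hf.
have [||t1 t2 _] := T _ closure_loop_left; first by [].
  by move=> y h1 h2; move: (lt_trans h1 h2); rewrite ltxx.
have [||t3 t4 _] := T _ closure_loop_right; first by rewrite ge0_cp// ltW.
  by move=> y h1 h2; rewrite /loopE/= in_itv/= h1 h2.
by rewrite t1 t2 t3 t4 u1 u2 u3 u4 v1 v2 v3 v4.
Qed.

Lemma leg_data (p p' : C) : exists2 f : R -> C, H2 (@legE R L) f &
  trace (legE L) f L = p /\ trace (legE L) (wderiv (legE L) 1 f) L = p'.
Proof.
case: p p' => [pr pi] [pr' pi'].
have [u su [u1 u2 u3]] := leg_smooth_data pr pr'.
have [v sv [v1 v2 v3]] := leg_smooth_data pi pi'.
have [su' sv'] := (smooth_derive1 su, smooth_derive1 sv).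
have [su'' sv''] := (smooth_derive1 su', smooth_derive1 sv').
have [u3' v3'] := (derive1_vanish u3, derive1_vanish v3).
have [u3'' v3''] := (derive1_vanish u3', derive1_vanish v3').
have [Hf T] := smooth_H2 leg_redge su sv (leg_smooth_rL2 su u3) (leg_smooth_rL2 su' u3')
  (leg_smooth_rL2 su'' u3'') (leg_smooth_rL2 sv v3) (leg_smooth_rL2 sv' v3') (leg_smooth_rL2 sv'' v3'').
exists (fun x => u x +i* v x); first exact: Hf.
have [||t1 t2 _] := T _ closure_leg; first by [].
  by move=> y h1 h2; move: (lt_trans h1 h2); rewrite ltxx.
by rewrite t1 t2 u1 u2 v1 v2.
Qed.

(** The traces vanish because a test function and its derivative are 0 outside [I], where the
    endpoint [c] lies. *)
Lemma test_H2 a (I : set R) (T : R -> C) : redge a I -> test_fun I T ->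
  H2 I T /\ forall c, closure I c -> ~ I c -> a <= c -> (forall y, a < y -> y < c -> I y) ->
  [/\ trace I T c = 0, trace I (wderiv I 1 T) c = 0 & ae_eq mu I (wderiv I 2 T) (cderiv 2 T)].
Proof.
move=> eI /(test_funP T eI.1)[tr ti].
have [dr di] := (rtest_derive1 tr, rtest_derive1 ti).
have [ddr ddi] := (rtest_derive1 dr, rtest_derive1 di).
have rl := @rtest_rL2 _ _ _ eI.1.
have [Hf H] := smooth_H2 eI tr.1 ti.1 (rl _ tr) (rl _ dr) (rl _ ddr) (rl _ ti) (rl _ di) (rl _ ddi).
have TE : T = fun x => rePart T x +i* imPart T x.
  by apply/funext => x; apply: complexP.
rewrite -TE in Hf H; split=> // c Ic nIc ac Hc.
have [-> -> e] := H c Ic ac Hc.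
have r0 e' (te : rtest I e') := rtest0 eI.1 te nIc.
by rewrite !r0.
Qed.

End BoundaryData.

(** * Green's formula on the graph *)

Section Graph.
Variables (R : realType) (L : R) (N : nat) (hL : 0 < L).
Local Notation C := R[i].
Local Notation gfun := (gfun R N).
Implicit Types (U V W T : gfun).
Notation mu := (@lebesgue_measure R).
Local Notation loop := (@loopE R L).
Local Notation leg := (@legE R L).

Let eloop := loop_redge hL.
Let eleg := leg_redge L.
Let mloop := measurable_loop hL.
Let mleg := measurable_leg L.
Let cl : closure loop (- L) := closure_loop_left hL.
Let cr : closure loop L := closure_loop_right hL.
Let cg := @closure_leg R L.

Lemma psi_LE U j : psi_L L U j 0 = trace leg (psi U j) L.
Proof. exact: mxE. Qed.

Lemma psi'_LE U j : psi'_L L U j 0 = trace leg (wderiv leg 1 (psi U j)) L.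
Proof. exact: mxE. Qed.

Lemma graph_data (p p' q q' : C) (s t : 'I_N -> C) : exists U, gH2 L U /\
  [/\ phi_at L U (- L) = p, phi'_at L U (- L) = p', phi_at L U L = q & phi'_at L U L = q'] /\
  (forall j, psi_L L U j 0 = s j /\ psi'_L L U j 0 = t j).
Proof.
have [f Hf [f1 f2 f3 f4]] := loop_data hL p p' q q'.
have /choice [g Hg] : forall j : 'I_N, exists g : R -> C, H2 leg g /\
    (trace leg g L = s j /\ trace leg (wderiv leg 1 g) L = t j).
  by move=> j; have [g g1 g2] := leg_data L (s j) (t j); exists g.
exists (GFun f g); split; last split => //.
  by split=> //= j; have [] := Hg j.
by move=> j; rewrite psi_LE psi'_LE; have [_] := Hg j.
Qed.

Lemma innerNl (I : set R) f g : measurable I -> L2 I f -> L2 I g ->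
  inner I (fun x => - f x) g = - inner I f g.
Proof.
move=> mI Lf Lg; have Lf' := L2N mI Lf; rewrite !innerE//.
have [fr fi] := (L2P f mI).1 Lf; have [gr gi] := (L2P g mI).1 Lg.
have P (u v : R -> R) : rL2 I u -> rL2 I v ->
    \int[mu]_(x in I) (- u x * v x) = - (\int[mu]_(x in I) (u x * v x)).
  move=> Lu Lv; rewrite -mulN1r -RintegralZl//; last exact: rL2_integrableM.
  by apply: eq_Rintegral => x _; ring.
have E1 : rePart (fun x => - f x) = fun x => - rePart f x.
  by apply/funext => x; rewrite /rePart cReN.
have E2 : imPart (fun x => - f x) = fun x => - imPart f x.
  by apply/funext => x; rewrite /imPart cImN.
by rewrite E1 E2 !P//; apply: complexP; rewrite ?cReN ?cImN/=; ring.
Qed.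

Lemma innerNr (I : set R) f g : measurable I -> L2 I f -> L2 I g ->
  inner I f (fun x => - g x) = - inner I f g.
Proof.
move=> mI Lf Lg; rewrite -innerNl//; congr cintegral; apply/funext => x.
by rewrite rmorphN mulrN mulNr.
Qed.

Definition bform U V : C :=
  (phi'_at L U (- L) * (phi_at L V (- L))^* - phi_at L U (- L) * (phi'_at L V (- L))^*) -
  (phi'_at L U L * (phi_at L V L)^* - phi_at L U L * (phi'_at L V L)^*) +
  \sum_(j < N) (psi'_L L U j 0 * (psi_L L V j 0)^* - psi_L L U j 0 * (psi'_L L V j 0)^*).

Lemma loop_complex_green f g : H2 loop f -> H2 loop g ->
  let W c := trace loop (wderiv loop 1 f) c * (trace loop g c)^* -
             trace loop f c * (trace loop (wderiv loop 1 g) c)^* in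
  inner loop (fun x => - wderiv loop 2 f x) g - inner loop f (fun x => - wderiv loop 2 g x) =
  W (- L) - W L.
Proof.
move=> Hf Hg W.
have [F0 [F1 cf]] := H2_cH2 eloop Hf; have [G0 [G1 cg']] := H2_cH2 eloop Hg.
have [Lf Lg] := (Hf.1, Hg.1).
have [L2f L2g] := (H2_L2_wderiv2 eloop Hf, H2_L2_wderiv2 eloop Hg).
rewrite innerNl// innerNr//.
have [w1 w2 _] := cH2_trace eloop cl Lf cf; have [w3 w4 _] := cH2_trace eloop cl Lg cg'.
have [w5 w6 _] := cH2_trace eloop cr Lf cf; have [w7 w8 _] := cH2_trace eloop cr Lg cg'.
rewrite /W w1 w2 w3 w4 w5 w6 w7 w8.
(* The boundary functional of the loop is the difference of the values at its two ends; the operator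
   is minus the second derivative, which reverses the sign to [W (- L) - W L]. *)
have := @complex_green _ _ _ eloop (fun h => h L - h (- L)) _ _ _ _ _ _ _ _ _ _ _ Lf Lg cf cg'.
move=> h; rewrite opprK addrC -opprB {}h.
- by apply: complexP; rewrite !(cReD, cReN, cImD, cImN)/= /rePart /imPart !(cReD, cReN, cImD, cImN); ring.
- by move=> u v; ring.
- by move=> u v; ring.
- move=> f' F0' F1' u g' G0' G1' v [[c0 c1 a0 a1 _] [_ _ Lu]] [[d0 d1 b0 b1 _] [_ _ Lv]].
  by apply: loop_green => //; rewrite gtrN.
Qed.

Lemma leg_complex_green f g : H2 leg f -> H2 leg g ->
  inner leg (fun x => - wderiv leg 2 f x) g - inner leg f (fun x => - wderiv leg 2 g x) =
  trace leg (wderiv leg 1 f) L * (trace leg g L)^* -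
  trace leg f L * (trace leg (wderiv leg 1 g) L)^*.
Proof.
move=> Hf Hg.
have [F0 [F1 cf]] := H2_cH2 eleg Hf; have [G0 [G1 cg']] := H2_cH2 eleg Hg.
have [Lf Lg] := (Hf.1, Hg.1).
have [L2f L2g] := (H2_L2_wderiv2 eleg Hf, H2_L2_wderiv2 eleg Hg).
rewrite innerNl// innerNr//.
have [-> -> _] := cH2_trace eleg cg Lf cf; have [-> -> _] := cH2_trace eleg cg Lg cg'.
(* Only the finite endpoint enters the functional, [leg_green] having shown that infinity
   contributes nothing. *)
have := @complex_green _ _ _ eleg (fun h => - h L) _ _ _ _ _ _ _ _ _ _ _ Lf Lg cf cg'.
move=> h; rewrite opprK addrC -opprB {}h.
- by apply: complexP; rewrite !(cReD, cReN, cImD, cImN)/= /rePart /imPart !(cReD, cReN, cImD, cImN); ring.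
- by move=> u v; ring.
- by move=> u v; ring.
- move=> f' F0' F1' u g' G0' G1' v [[c0 c1 a0 a1 _] [l0 l1 Lu]] [[d0 d1 b0 b1 _] [m0 m1 Lv]].
  exact: leg_green.
Qed.

Lemma graph_green U V : gH2 L U -> gH2 L V ->
  ginner L (weak_laplacian L U) V - ginner L U (weak_laplacian L V) = bform U V.
Proof.
move=> [HU1 HU2] [HV1 HV2]; rewrite /ginner opprD addrACA -sumrB /bform.
have E j : inner leg (fun x => - wderiv leg 2 (psi U j) x) (psi V j) -
    inner leg (psi U j) (fun x => - wderiv leg 2 (psi V j) x) =
    psi'_L L U j 0 * (psi_L L V j 0)^* - psi_L L U j 0 * (psi'_L L V j 0)^*.
  have := leg_complex_green (HU2 j) (HV2 j).
  have e1 := psi_LE U j; have e2 := psi_LE V j; have e3 := psi'_LE U j; have e4 := psi'_LE V j.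
  rewrite -e1 -e2 -e3.
  rewrite -e4.
  exact.
congr (_ + _); first exact: loop_complex_green.
by apply: eq_bigr => j _; rewrite -E.
Qed.

End Graph.

Local Open Scope sesquilinear_scope.

(** * Boundary tuples and the boundary form *)

Section Extensions.
Variables (R : realType) (L : R) (N : nat) (hL : 0 < L).
Local Notation C := R[i].
Local Notation gfun := (gfun R N).
Implicit Types (U V W T : gfun).
Notation mu := (@lebesgue_measure R).
Local Notation loop := (@loopE R L).
Local Notation leg := (@legE R L).

Let eloop := loop_redge hL.
Let eleg := leg_redge L.
Let mloop := measurable_loop hL.
Let mleg := measurable_leg L.
Let cl : closure loop (- L) := closure_loop_left hL.
Let cr : closure loop L := closure_loop_right hL.
Let cg := @closure_leg R L.

Lemma ae_eq_r (f : R -> C) I : ae_eq mu I f f.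
Proof. exact: aeW. Qed.

Lemma ae_eq_s (f g : R -> C) I : ae_eq mu I f g -> ae_eq mu I g f.
Proof. by apply: aeS => x h Ix; rewrite h. Qed.

Lemma ae_eq_t (f g h : R -> C) I : ae_eq mu I f g -> ae_eq mu I g h -> ae_eq mu I f h.
Proof. by apply: ae2S => x h1 h2 Ix; rewrite h1// h2. Qed.

Lemma eqG_refl U : eqG L U U.
Proof. by split=> [|j]; exact: ae_eq_r. Qed.

Lemma eqG_sym U V : eqG L U V -> eqG L V U.
Proof. by move=> [h1 h2]; split=> [|j]; apply: ae_eq_s. Qed.

Lemma eqG_trans U V W : eqG L U V -> eqG L V W -> eqG L U W.
Proof. by move=> [h1 h2] [h3 h4]; split=> [|j]; [exact: ae_eq_t h3|exact: ae_eq_t (h4 j)]. Qed.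

Lemma gH2_gL2 U : gH2 L U -> gL2 L U.
Proof. by move=> [h1 h2]; split=> [|j]; [exact: h1.1|exact: (h2 j).1]. Qed.

Lemma gL2_laplacian U : gH2 L U -> gL2 L (weak_laplacian L U).
Proof.
move=> [h1 h2]; split=> [|j].
  by apply: (L2N mloop); exact: (H2_L2_wderiv2 eloop h1).
by apply: (L2N mleg); exact: (H2_L2_wderiv2 eleg (h2 j)).
Qed.

Lemma ginner_eqG U U' V V' : gL2 L U -> gL2 L U' -> gL2 L V -> gL2 L V' ->
  eqG L U U' -> eqG L V V' -> ginner L U V = ginner L U' V'.
Proof.
move=> [u1 u2] [u1' u2'] [v1 v2] [v1' v2'] [e1 e2] [e3 e4].
rewrite /ginner; congr (_ + _).
  exact: (@inner_ae _ loop _ _ _ _ mloop u1 u1' v1 v1' e1 e3).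
apply: eq_bigr => j _.
exact: (@inner_ae _ leg _ _ _ _ mleg (u2 j) (u2' j) (v2 j) (v2' j) (e2 j) (e4 j)).
Qed.

Definition bvals U := (phi_at L U (- L), phi'_at L U (- L), phi_at L U L, phi'_at L U L,
  psi_L L U, psi'_L L U).

Lemma gH2_eqG U U' : gH2 L U -> gL2 L U' -> eqG L U U' ->
  [/\ gH2 L U', bvals U' = bvals U & eqG L (weak_laplacian L U') (weak_laplacian L U)].
Proof.
move=> [h1 h2] [l1 l2] [e1 e2].
have [a1 a2 a3 a4] := H2_ae eloop cl h1 l1 e1.
have [_ b2 b3 _] := H2_ae eloop cr h1 l1 e1.
have H j := H2_ae eleg cg (h2 j) (l2 j) (e2 j).
split.
- by split; [exact: a1|move=> j; have [h _ _ _] := H j; exact: h].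
- have e5 : psi_L L U' = psi_L L U.
    apply/colP => j; have [_ e _ _] := H j.
    exact: (etrans (psi_LE L U' j) (etrans e (esym (psi_LE L U j)))).
  have e6 : psi'_L L U' = psi'_L L U.
    apply/colP => j; have [_ _ e _] := H j.
    exact: (etrans (psi'_LE L U' j) (etrans e (esym (psi'_LE L U j)))).
  by rewrite /bvals e5 e6 /phi_at /phi'_at a2 a3 b2 b3.
- split=> [|j]; first by apply: aeS a4 => x h Ix /=; rewrite h.
  by have [_ _ _ e] := H j; apply: aeS e => x h Ix /=; rewrite h.
Qed.

Lemma gH2_axpy c U V : gH2 L U -> gH2 L V -> [/\ gH2 L (gaxpy c U V),
  bvals (gaxpy c U V) = (c * phi_at L U (- L) + phi_at L V (- L),
    c * phi'_at L U (- L) + phi'_at L V (- L), c * phi_at L U L + phi_at L V L,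
    c * phi'_at L U L + phi'_at L V L, c *: psi_L L U + psi_L L V,
    c *: psi'_L L U + psi'_L L V) &
  eqG L (weak_laplacian L (gaxpy c U V)) (gaxpy c (weak_laplacian L U) (weak_laplacian L V))].
Proof.
move=> [h1 h2] [k1 k2].
have [a1 a2 a3 a4] := H2_axpy eloop c cl h1 k1.
have [_ b2 b3 _] := H2_axpy eloop c cr h1 k1.
have H j := H2_axpy eleg c cg (h2 j) (k2 j).
split.
- by split; [exact: a1|move=> j; have [h _ _ _] := H j; exact: h].
- have e5 : psi_L L (gaxpy c U V) = c *: psi_L L U + psi_L L V.
    apply/colP => j; have [_ e _ _] := H j; rewrite [RHS]mxE [X in X + _]mxE.
    exact: (etrans (psi_LE L (gaxpy c U V) j) (etrans e
      (f_equal2 (fun x y => c * x + y) (esym (psi_LE L U j)) (esym (psi_LE L V j))))).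
  have e6 : psi'_L L (gaxpy c U V) = c *: psi'_L L U + psi'_L L V.
    apply/colP => j; have [_ _ e _] := H j; rewrite [RHS]mxE [X in X + _]mxE.
    exact: (etrans (psi'_LE L (gaxpy c U V) j) (etrans e
      (f_equal2 (fun x y => c * x + y) (esym (psi'_LE L U j)) (esym (psi'_LE L V j))))).
  by rewrite /bvals e5 e6 /phi_at /phi'_at a2 a3 b2 b3.
- split=> [|j]; first by apply: aeS a4 => x h Ix /=; rewrite h// opprD mulrN.
  by have [_ _ _ e] := H j; apply: aeS e => x h Ix /=; rewrite h// opprD mulrN.
Qed.

Lemma test_gH2 T : test_fun loop (phi T) -> (forall j, test_fun leg (psi T j)) ->
  [/\ gH2 L T, bvals T = (0, 0, 0, 0, 0, 0) &
   eqG L (weak_laplacian L T) (GFun (fun x => - cderiv 2 (phi T) x) (fun j x => - cderiv 2 (psi T j) x))].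
Proof.
move=> t1 t2.
have [h1 H1] := test_H2 eloop t1.
have H2' j := test_H2 eleg (t2 j).
have L0 := hL.
have [||a1 a2 a3] := H1 _ cl _ (lexx _).
  by rewrite /loopE/= in_itv/= ltxx.
  by move=> y y1 y2; move: (lt_trans y1 y2); rewrite ltxx.
have [|||b1 b2 _] := H1 _ cr.
  by rewrite /loopE/= in_itv/= ltxx andbF.
  by rewrite ge0_cp// ltW.
  by move=> y y1 y2; rewrite /loopE/= in_itv/= y1 y2.
have K j : [/\ trace leg (psi T j) L = 0, trace leg (wderiv leg 1 (psi T j)) L = 0
    & ae_eq mu leg (wderiv leg 2 (psi T j)) (cderiv 2 (psi T j))].
  have [_ h] := H2' j; apply: h => //.
    by rewrite /legE/= in_itv/= ltxx.
  by move=> y y1 y2; move: (lt_trans y1 y2); rewrite ltxx.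
split.
- by split; [exact: h1|move=> j; have [h _] := H2' j; exact: h].
- have e5 : psi_L L T = 0.
    by apply/colP => j; have [e _ _] := K j; rewrite [LHS]psi_LE e mxE.
  have e6 : psi'_L L T = 0.
    by apply/colP => j; have [_ e _] := K j; rewrite [LHS]psi'_LE e mxE.
  by rewrite /bvals e5 e6 /phi_at /phi'_at a1 a2 b1 b2.
- split=> [|j]; first by apply: aeS a3 => x h Ix /=; rewrite h.
  by have [_ _ e] := K j; apply: aeS e => x h Ix /=; rewrite h.
Qed.

Local Notation r2 := ((Num.sqrt 2)%:C : C).

(** The conditions of [Dpar] on a bare tuple, entry by entry, so that isotropy and maximality are
    argued in finite dimension, without functions. *)
Definition bcond (a : R) (b : 'cV[C]_N) (M : 'M[C]_N) (z : C * C * C * C * 'cV[C]_N * 'cV[C]_N) :=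
  let: (p, p', q, q', s, t) := z in
  [/\ p = q, p' - q' = (2 * a)%:C * p + r2 * \sum_j (b j 0)^* * s j 0 &
      forall j, t j 0 = r2 * p * b j 0 + \sum_k M j k * s k 0].

Lemma DparE a b M U : Dpar L a b M U <-> gH2 L U /\ bcond a b M (bvals U).
Proof.
have E : (b ^t* *m psi_L L U) 0 0 = \sum_j (b j 0)^* * psi_L L U j 0.
  by rewrite mxE; apply: eq_bigr => j _; rewrite !mxE.
split=> [[h1 h2 h3 h4]|[h1 [h2 h3 h4]]].
  split=> //; split=> //; first by rewrite -E.
  by move=> j; rewrite h4 !mxE.
split=> //; first by rewrite E.
apply/colP => j; rewrite h4 [RHS]mxE; congr (_ + _); first by rewrite [RHS]mxE.
by rewrite [RHS]mxE.
Qed.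

Definition sform (z w : C * C * C * C * 'cV[C]_N * 'cV[C]_N) : C :=
  let: (p, p', q, q', s, t) := z in let: (y, y', x, x', u, v) := w in
  (p' * y^* - p * y'^*) - (q' * x^* - q * x'^*) +
  \sum_(j < N) (t j 0 * (u j 0)^* - s j 0 * (v j 0)^*).

Lemma bformE U V : bform L U V = sform (bvals U) (bvals V).
Proof. by []. Qed.

Lemma conj_real (x : R) : (x%:C : C)^* = x%:C.
Proof. by apply: complexP; rewrite ?cRe_conj ?cIm_conj/= ?oppr0. Qed.

Lemma hermP (M : 'M[C]_N) : reflect (forall j k, M j k = (M k j)^*) (M \is hermsymmx).
Proof.
apply: (iffP (is_hermitianmxP _ _ M)) => [h j k|h].
  by rewrite {1}h expr0 scale1r !mxE.
by apply/matrixP => j k; rewrite expr0 scale1r !mxE.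
Qed.

Section FixedParameter.
Variables (a : R) (b : 'cV[C]_N) (M : 'M[C]_N) (hM : M \is hermsymmx).

(** The terms in [2 * a] cancel since it is real, the terms in [b] from the loop cancel those from
    the legs, and the double sums in [M] agree after exchanging indices by Hermitian symmetry. *)
Lemma bcond_sform0 z w : bcond a b M z -> bcond a b M w -> sform z w = 0.
Proof.
have hM' := hermP M hM.
case: z => [[[[[p p'] q] q'] s] t] /=; case: w => [[[[[y y'] x] x'] u] v] /=.
move=> [<- e1 ht] [<- e2 hv].
have E2 : (y' - x')^* = (2 * a)%:C * y^* + r2 * \sum_j b j 0 * (u j 0)^*.
  rewrite e2 rmorphD !rmorphM/= !conj_real rmorph_sum; congr (_ + _ * _).
  by apply: eq_bigr => j _; rewrite rmorphM/= conjCK.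
have -> : p' * y^* - p * y'^* - (q' * y^* - p * x'^*) = (p' - q') * y^* - p * (y' - x')^*.
  rewrite rmorphB; ring.
rewrite e1 E2.
have -> : \sum_j (t j 0 * (u j 0)^* - s j 0 * (v j 0)^*) =
    r2 * p * (\sum_j b j 0 * (u j 0)^*) - r2 * y^* * (\sum_j (b j 0)^* * s j 0).
  have hs : \sum_j \sum_k M j k * s k 0 * (u j 0)^* = \sum_j \sum_k s j 0 * ((M j k)^* * (u k 0)^*).
    rewrite exchange_big/=; apply: eq_bigr => j _; apply: eq_bigr => k _.
    by rewrite (hM' k j); ring.
  rewrite sumrB.
  have -> : \sum_j t j 0 * (u j 0)^* = r2 * p * (\sum_j b j 0 * (u j 0)^*) +
      \sum_j \sum_k M j k * s k 0 * (u j 0)^*.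
    rewrite mulr_sumr -big_split/=; apply: eq_bigr => j _.
    by rewrite ht mulrDl mulr_suml; congr (_ + _); ring.
  have -> : \sum_j s j 0 * (v j 0)^* = r2 * y^* * (\sum_j (b j 0)^* * s j 0) +
      \sum_j \sum_k s j 0 * ((M j k)^* * (u k 0)^*).
    rewrite mulr_sumr -big_split/=; apply: eq_bigr => j _.
    rewrite hv rmorphD !rmorphM/= conj_real rmorph_sum mulrDr mulr_sumr; congr (_ + _); first ring.
    by apply: eq_bigr => k _; rewrite rmorphM.
  rewrite hs; ring.
ring.
Qed.

Lemma sum_delta (k : 'I_N) (f : 'I_N -> C) : \sum_j f j * (j == k)%:R = f k.
Proof.
rewrite (bigD1 k)//= eqxx mulr1 big1 ?addr0// => j jk.
by rewrite (negbTE jk) mulr0.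
Qed.

(** Three kinds of solutions of [bcond] suffice: each isolates, up to conjugation, one of the
    conditions on [w]. This is what keeps the adjoint from being larger than the operator. *)
Lemma sform0_bcond w : (forall z, bcond a b M z -> sform z w = 0) -> bcond a b M w.
Proof.
have hM' := hermP M hM.
case: w => [[[[[y y'] x] x'] u] v] H.
have conj0 (c d : C) : c^* - d^* = 0 -> c = d.
  by rewrite -rmorphB => /(congr1 Num.conj); rewrite conjCK rmorph0 => /eqP; rewrite subr_eq0 => /eqP.
(* Equal derivatives at both ends of the loop and zeros elsewhere: the jump is 0 and the form
   reduces to $\bar y - \bar x$. *)
have yx : y = x.
  apply: conj0; rewrite -[RHS](H (0, 1, 0, 1, 0, 0)) /=; last first.
    split=> //; first rewrite subrr mulr0 add0r big1 ?mulr0// => j _; first by rewrite mxE mulr0.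
    by move=> j; rewrite !mxE mulr0 mul0r add0r big1// => k _; rewrite mxE mulr0.
  by rewrite big1 => [|j _]; [ring|rewrite !mxE; ring].
split=> //.
(* Value 1 on the loop and 0 on the legs. Only the jump of the derivative is prescribed, so it is
   placed entirely at $-L$ and the derivative at $L$ is taken to be 0. *)
- have h : sform (1, (2 * a)%:C, 1, 0, 0, r2 *: b) (y, y', x, x', u, v) = 0.
    apply: H; split=> //; first rewrite subr0 mulr1 big1 ?mulr0 ?addr0// => j _; first by rewrite mxE mulr0.
    by move=> j; rewrite !mxE mulr1 big1 ?addr0// => k _; rewrite mxE mulr0.
  apply: conj0; apply/eqP; rewrite -oppr_eq0; apply/eqP; rewrite -[RHS]h /= -yx.
  have -> : \sum_j ((r2 *: b) j 0 * (u j 0)^* - (0 : 'cV[C]_N) j 0 * (v j 0)^*) = r2 * \sum_j b j 0 * (u j 0)^*.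
    by rewrite mulr_sumr; apply: eq_bigr => j _; rewrite !mxE; ring.
  rewrite rmorphB rmorphD !rmorphM/= !conj_real.
  have -> : (\sum_j (b j 0)^* * u j 0)^* = \sum_j b j 0 * (u j 0)^* :> C.
    by rewrite rmorph_sum; apply: eq_bigr => j _; rewrite rmorphM/= conjCK.
  ring.
- move=> k.
  (* Value 0 on the loop and the k-th unit vector on the legs; [bcond] then forces the k-th column
     of [M] as leg derivatives and [r2 * (b k 0)^*] as jump. *)
  have h : sform (0, r2 * (b k 0)^*, 0, 0, \col_j (j == k)%:R, \col_j M j k) (y, y', x, x', u, v) = 0.
    apply: H; split=> //.
      rewrite subr0 mulr0 add0r; congr (_ * _).
      by rewrite -[LHS](sum_delta k (fun j => (b j 0)^*)); apply: eq_bigr => j _; rewrite !mxE.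
    move=> j; rewrite mxE mulr0 mul0r add0r -[LHS](sum_delta k (M j)).
    by apply: eq_bigr => i _; rewrite mxE.
  apply: conj0; apply/eqP; rewrite -oppr_eq0; apply/eqP; rewrite -[RHS]h /= -yx.
  rewrite rmorphD !rmorphM/= conj_real.
  have -> : (\sum_k0 M k k0 * u k0 0)^* = \sum_j M j k * (u j 0)^*.
    by rewrite rmorph_sum; apply: eq_bigr => j _; rewrite rmorphM/= (hM' j k).
  have -> : \sum_j ((\col_j M j k) j 0 * (u j 0)^* - (\col_j (j == k)%:R : 'cV[C]_N) j 0 * (v j 0)^*) =
      \sum_j M j k * (u j 0)^* - (v k 0)^*.
    rewrite sumrB -(sum_delta k (fun j => (v j 0)^*)); congr (_ - _).
      by apply: eq_bigr => j _; rewrite mxE.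
    by apply: eq_bigr => j _; rewrite mxE mulrC.
  ring.
Qed.

Lemma bdata_ex z : exists U, gH2 L U /\ bvals U = z.
Proof.
case: z => [[[[[p p'] q] q'] s] t].
have [U [hU [[u1 u2 u3 u4] ust]]] := graph_data hL p p' q q' (fun j => s j 0) (fun j => t j 0).
exists U; split=> //; rewrite /bvals u1 u2 u3 u4.
have -> : psi_L L U = s by apply/colP => j; have [] := ust j.
by have -> : psi'_L L U = t by apply/colP => j; have [] := ust j.
Qed.

End FixedParameter.
End Extensions.

(** * Self-adjoint extensions and their boundary conditions *)

Section SelfAdjoint.
Variables (R : realType) (L : R) (N : nat) (hL : 0 < L).
Local Notation C := R[i].
Local Notation gfun := (gfun R N).
Implicit Types (U V W T Z : gfun) (A : opgraph R N).
Notation mu := (@lebesgue_measure R).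
Local Notation loop := (@loopE R L).
Local Notation leg := (@legE R L).
Local Notation r2 := ((Num.sqrt 2)%:C : C).

Let eloop := loop_redge hL.
Let eleg := leg_redge L.
Let mloop := measurable_loop hL.
Let mleg := measurable_leg L.

Lemma r2_neq0 : r2 != 0.
Proof. by apply/eqP => -[] /eqP; rewrite sqrtr_eq0 leNgt ltr0n. Qed.

Lemma gL2_zero : gL2 L (gzero R N).
Proof. by split=> [|j]; apply: L2_0. Qed.

Lemma gL2_axpy c U V : gL2 L U -> gL2 L V -> gL2 L (gaxpy c U V).
Proof. by move=> [u1 u2] [v1 v2]; split=> [|j]; apply: L2_axpy. Qed.

Lemma test_fun0 a (I : set R) : isedge a I -> test_fun I (fun=> 0).
Proof.
move=> aI; apply/(test_funP _ aI).
have r0 : rtest I (fun=> 0).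
  split; first exact: smooth_cst.
  by have [c Ic _] := edge_nonempty aI; exists (c, c).
by split; exact: r0.
Qed.

Definition lap_test T : gfun :=
  GFun (fun x => - cderiv 2 (phi T) x) (fun j x => - cderiv 2 (psi T j) x).

Lemma H0_test T : test_fun loop (phi T) -> (forall j, test_fun leg (psi T j)) ->
  H0 L (T, lap_test T).
Proof.
move=> t1 t2; have [hT _ e] := test_gH2 hL t1 t2.
split=> /=; first exact: gH2_gL2.
  split=> [|j] /=; apply: L2N => //.
    have [tr ti] := (test_funP _ eloop.1).1 t1; apply/(L2P _ mloop); split.
      exact: rtest_rL2 eloop.1 _ (rtest_derive1n 2 tr).
    exact: rtest_rL2 eloop.1 _ (rtest_derive1n 2 ti).
  have [tr ti] := (test_funP _ eleg.1).1 (t2 j); apply/(L2P _ mleg); split.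
    exact: rtest_rL2 eleg.1 _ (rtest_derive1n 2 tr).
  exact: rtest_rL2 eleg.1 _ (rtest_derive1n 2 ti).
by exists T; split=> //; exact: eqG_refl.
Qed.

Lemma inner0l (I : set R) (f g : R -> C) : measurable I -> (forall x, f x = 0) -> inner I f g = 0.
Proof.
move=> mI f0; have E (u : R -> R) : (forall x, u x = 0) -> \int[mu]_(x in I) u x = 0.
  by move=> u0; under eq_Rintegral do rewrite u0; rewrite Rintegral_cst// mul0r.
by apply: complexP => /=; apply: E => x; rewrite /rePart /imPart f0 mul0r.
Qed.

Lemma cderiv0 (f : R -> C) x : (forall x, f x = 0) -> cderiv 2 f x = 0.
Proof.
move=> f0; rewrite (_ : f = fun=> 0); last exact/funext.
have d0 := derive1n_cst0 R 2.
rewrite /cderiv (_ : rePart (fun=> 0) = fun=> 0)// (_ : imPart (fun=> 0) = fun=> 0)//.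
by rewrite d0.
Qed.

Lemma test_ofReal a (I : set R) e : isedge a I -> rtest I e -> test_fun I (ofReal e).
Proof.
move=> aI te; apply/(test_funP _ aI); split; first exact: te.
by split; [exact: smooth_cst|have [_ [cd [h1 h2 _]]] := te; exists cd].
Qed.

(** Test functions supported on a single edge decouple the graph, and [weak_of_test] applies to each
    edge. *)
Lemma H0_adjoint V W : gL2 L V -> gL2 L W ->
  (forall U Z, H0 L (U, Z) -> ginner L Z V = ginner L U W) ->
  gH2 L V /\ eqG L W (weak_laplacian L V).
Proof.
move=> [v1 v2] [w1 w2] H.
have h1 : H2 loop (phi V) /\ ae_eq mu loop (phi W) (fun x => - wderiv loop 2 (phi V) x).
  apply: (weak_of_test eloop v1 w1) => e te.
  pose T : gfun := GFun (ofReal e) (fun _ _ => 0).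
  have := H _ _ (@H0_test T (test_ofReal eloop.1 te) (fun j => test_fun0 eleg.1)).
  rewrite /ginner /= -!/(inner _ _ _).
  rewrite big1; last first.
    by move=> j _; apply: (@inner0l leg _ _ mleg) => x; rewrite cderiv0// oppr0.
  by rewrite big1 ?addr0// => j _; exact: (@inner0l leg _ _ mleg).
have h2 j : H2 leg (psi V j) /\ ae_eq mu leg (psi W j) (fun x => - wderiv leg 2 (psi V j) x).
  apply: (weak_of_test eleg (v2 j) (w2 j)) => e te.
  pose T : gfun := GFun (fun=> 0) (fun k => if k == j then ofReal e else fun=> 0).
  have tT k : test_fun leg (psi T k).
    rewrite /T/=; case: ifP => _; [exact: test_ofReal eleg.1 te|exact: test_fun0 eleg.1].
  have := H _ _ (@H0_test T (test_fun0 eloop.1) tT).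
  rewrite /ginner /= -!/(inner _ _ _).
  rewrite (@inner0l loop _ _ mloop); last by move=> x; rewrite cderiv0// oppr0.
  rewrite [X in _ = X + _](@inner0l loop _ _ mloop)// !add0r.
  rewrite (bigD1 j)//= eqxx big1 ?addr0; last first.
    move=> k kj; rewrite (negbTE kj).
    by apply: (@inner0l leg _ _ mleg) => x; rewrite cderiv0// oppr0.
  rewrite (bigD1 j)//= eqxx big1 ?addr0// => k kj; rewrite (negbTE kj).
  exact: (@inner0l leg _ _ mleg).
split; split; [exact: h1.1|by move=> j; exact: (h2 j).1|exact: h1.2|by move=> j; exact: (h2 j).2].
Qed.

Section FixedParam.
Variables (a : R) (b : 'cV[C]_N) (M : 'M[C]_N) (hM : M \is hermsymmx).
Let H : opgraph R N := Hpar L (a, b, M).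

Lemma HparP U V : H (U, V) <->
  [/\ gH2 L U, bcond a b M (bvals L U), gL2 L V & eqG L V (weak_laplacian L U)].
Proof.
split=> [[/= /DparE[h1 h2] h3 h4]|[h1 h2 h3 h4]]; first by split.
by split=> //=; apply/DparE.
Qed.

Lemma Hpar_lap U : gH2 L U -> bcond a b M (bvals L U) -> H (U, weak_laplacian L U).
Proof.
by move=> h1 h2; apply/HparP; split; [exact: h1|exact: h2|exact: gL2_laplacian|exact: eqG_refl].
Qed.

Lemma bcond0 : bcond a b M (0, 0, 0, 0, 0, 0).
Proof.
split=> //; first by rewrite subrr mulr0 add0r big1 ?mulr0// => j _; rewrite mxE mulr0.
by move=> j; rewrite !mxE mulr0 mul0r add0r big1// => k _; rewrite mxE mulr0.
Qed.

Lemma H0_sub_Hpar : @H0 R L N `<=` H.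
Proof.
move=> [U V] [/= lU lV [T [t1 t2 eU eV]]].
have [hT bT eT] := test_gH2 hL t1 t2.
have [hU bU lapU] := gH2_eqG hL hT lU (eqG_sym eU).
apply/HparP; split; [exact: hU|by rewrite bU bT; exact: bcond0|exact: lV|].
apply: eqG_trans eV _; apply: eqG_trans (eqG_sym eT) _; exact: eqG_sym lapU.
Qed.

(** An element of the adjoint lies in H2 because the operator extends [H0]. Every tuple satisfying
    [bcond] is attained in the domain, so its own tuple is annihilated by all of them under [sform],
    and [sform0_bcond] concludes. *)
Lemma Hpar_self_adjoint_eq : H = adjoint L H.
Proof.
apply/seteqP; split=> -[V W].
  move=> /HparP[hV bV lW eW]; split=> /=; [exact: gH2_gL2|exact: lW|].
  move=> U Z /HparP[hU bU lZ eZ].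
  have lV := gH2_gL2 hV; have lU := gH2_gL2 hU.
  rewrite (ginner_eqG hL lZ (gL2_laplacian hL hU) lV lV eZ (eqG_refl _ _)).
  rewrite (ginner_eqG hL lU lU lW (gL2_laplacian hL hV) (eqG_refl _ _) eW).
  apply/eqP; rewrite -subr_eq0; apply/eqP.
  by rewrite graph_green// bformE; exact: (bcond_sform0 hM bU bV).
move=> [/= lV lW HH].
have [hV eW] : gH2 L V /\ eqG L W (weak_laplacian L V).
  by apply: H0_adjoint => // U Z /H0_sub_Hpar; exact: HH.
apply/HparP; split; [exact: hV| |exact: lW|exact: eW].
apply: (sform0_bcond hM) => z bz.
have [U [hU bU]] := bdata_ex hL z.
have := HH _ _ (Hpar_lap hU _); rewrite bU => /(_ bz) E.
rewrite -bU -bformE -graph_green// E.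
rewrite (ginner_eqG hL (gH2_gL2 hU) (gH2_gL2 hU) lW (gL2_laplacian hL hV) (eqG_refl _ _) eW).
by rewrite subrr.
Qed.

Lemma eqG_axpy c U U' V V' : eqG L U U' -> eqG L V V' -> eqG L (gaxpy c U V) (gaxpy c U' V').
Proof.
move=> [e1 e2] [e3 e4]; split=> [|j].
  by apply: (ae2S _ e1 e3) => x h1 h2 Ix /=; rewrite h1// h2.
by apply: (ae2S _ (e2 j) (e4 j)) => x h1 h2 Ix /=; rewrite h1// h2.
Qed.

Lemma bcond_axpy c p p' q q' s t y y' x x' u v :
  bcond a b M (p, p', q, q', s, t) -> bcond a b M (y, y', x, x', u, v) ->
  bcond a b M (c * p + y, c * p' + y', c * q + x, c * q' + x', c *: s + u, c *: t + v).
Proof.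
move=> [u1 u2 u3] [v1 v2 v3]; split; first by rewrite u1 v1.
- rewrite opprD addrACA -mulrBr u2 v2.
  have -> : \sum_j (b j 0)^* * (c *: s + u) j 0 =
      c * (\sum_j (b j 0)^* * s j 0) + \sum_j (b j 0)^* * u j 0.
    by rewrite mulr_sumr -big_split/=; apply: eq_bigr => j _; rewrite !mxE; ring.
  ring.
- move=> j; rewrite mxE [X in X + _]mxE u3 v3.
  have -> : \sum_k M j k * (c *: s + u) k 0 =
      c * (\sum_k M j k * s k 0) + \sum_k M j k * u k 0.
    by rewrite mulr_sumr -big_split/=; apply: eq_bigr => k _; rewrite !mxE; ring.
  ring.
Qed.

Lemma Hpar_is_operator : is_operator L H.
Proof.
split.
- by move=> U V /HparP[hU _ lV _]; split=> //; exact: gH2_gL2.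
- move=> U V U' V' /HparP[hU bU lV eV] lU' lV' eU eV'.
  have [hU' bU' e] := gH2_eqG hL hU lU' eU.
  apply/HparP; split; [exact: hU'|by rewrite bU'; exact: bU|exact: lV'|].
  by apply: eqG_trans (eqG_sym eV') _; apply: eqG_trans eV _; exact: eqG_sym.
- have t1 : test_fun loop (phi (gzero R N)) by exact: test_fun0 eloop.1.
  have t2 j : test_fun leg (psi (gzero R N) j) by exact: test_fun0 eleg.1.
  have [h0 b0 e0] := test_gH2 hL t1 t2.
  apply/HparP; split; [exact: h0|by rewrite b0; exact: bcond0|exact: gL2_zero|].
  apply: eqG_trans (eqG_sym e0); split=> [|j]; apply: aeW => x _ /=.
    by rewrite cderiv0 ?oppr0.
  by rewrite cderiv0 ?oppr0.
- move=> c U V U' V' /HparP[hU bU lV eV] /HparP[hU' bU' lV' eV'].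
  have [h bh e] := gH2_axpy hL c hU hU'.
  apply/HparP; split; [exact: h|rewrite bh; exact: (bcond_axpy c bU bU')|exact: gL2_axpy|].
  by apply: eqG_trans (eqG_axpy c eV eV') _; exact: eqG_sym.
- move=> U V V' /HparP[_ _ _ e] /HparP[_ _ _ e'].
  exact: eqG_trans e (eqG_sym e').
Qed.

End FixedParam.

Lemma complex_test_dense a (I : set R) (f : R -> C) (e : R) : isedge a I -> L2 I f -> 0 < e ->
  exists2 T, test_fun I T & complex.Re (inner I (fun x => f x - T x) (fun x => f x - T x)) < e.
Proof.
move=> aI Lf e0; have mI := edge_measurable aI; have [fr fi] := (L2P f mI).1 Lf.
have e2 : 0 < e / 2 by rewrite divr_gt0.
have [_ /(_ _ e2)[u tu hu]] := test_dense aI fr.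
have [_ /(_ _ e2)[v tv hv]] := test_dense aI fi.
exists (fun x => u x +i* v x); first by apply/(test_funP _ aI).
have [Lu Lv] := (rtest_rL2 aI tu, rtest_rL2 aI tv).
set g := fun x => f x - (u x +i* v x).
have Er : rePart g = fun x => rePart f x - u x by apply/funext => x; rewrite /rePart cReD cReN.
have Ei : imPart g = fun x => imPart f x - v x by apply/funext => x; rewrite /imPart cImD cImN.
have Lg : L2 I g by apply/(L2P _ mI); rewrite Er Ei; split; exact: rL2B.
rewrite innerE// Er Ei /=; move: hu hv; set X := (X in X < _); set Y := (X in _ -> X < _ -> _) => hu hv.
rewrite [X in X + _](_ : _ = X)// [X in _ + X](_ : _ = Y)//; lra.
Qed.

Lemma densely_defined_of_H0 A : @H0 R L N `<=` A -> densely_defined L A.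
Proof.
move=> H0A U e [u1 u2] e0.
(* Each of the [N.+1] edges is allowed an equal share of the squared error. *)
have d0 : 0 < e ^+ 2 / N.+1%:R by rewrite divr_gt0// exprn_gt0.
have [f tf hf] := complex_test_dense eloop.1 u1 d0.
have /choice [g hg] : forall j : 'I_N, exists T : R -> C, test_fun leg T /\
    complex.Re (inner leg (fun x => psi U j x - T x) (fun x => psi U j x - T x)) < e ^+ 2 / N.+1%:R.
  by move=> j; have [T h1 h2] := complex_test_dense eleg.1 (u2 j) d0; exists T.
pose T : gfun := GFun f g.
exists T; first by exists (lap_test T); apply: H0A; apply: H0_test => //= j; exact: (hg j).1.
have e2 : 0 < e ^+ 2 by rewrite exprn_gt0.
rewrite /gL2norm -[ltRHS](ger0_norm (ltW e0)) -sqrtr_sqr ltr_sqrt//.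
rewrite /ginner cReD (big_morph _ (@cReD R) (erefl : complex.Re (0 : C) = 0)) /=.
set d := e ^+ 2 / N.+1%:R in d0 hf hg.
have -> : e ^+ 2 = d + d * N%:R by rewrite -{1}[d]mulr1 -mulrDr nat1r divfK ?pnatr_eq0.
apply: ltr_leD; first exact: hf.
rewrite mulr_natr -[X in _ *+ X]card_ord -sumr_const.
by apply: ler_sum => j _; apply: ltW; exact: (hg j).2.
Qed.

Lemma Hpar_self_adjoint p : p \in @param_set R N -> self_adjoint L (Hpar L p).
Proof.
case: p => [[a b] M]; rewrite inE /param_set/= => hM; split.
- exact: Hpar_is_operator.
- exact/densely_defined_of_H0/H0_sub_Hpar.
- exact: Hpar_self_adjoint_eq.
Qed.

Lemma gdom_Hpar a b M U : gdom (Hpar L (a, b, M)) U <-> gH2 L U /\ bcond a b M (bvals L U).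
Proof.
split=> [[V /HparP[h1 h2 _ _]]|[h1 h2]]; first by split.
by exists (weak_laplacian L U); exact: Hpar_lap.
Qed.

Lemma colE0 (u : 'cV[C]_1) (v : 'cV[C]_(1 + N)) : (col_mx u v : 'cV_N.+2) 0 0 = u 0 0.
Proof.
rewrite (_ : (0 : 'I_N.+2) = @lshift 1 (1 + N) 0); last exact/val_inj.
exact: col_mxEu.
Qed.

Lemma colE1 (u v : 'cV[C]_1) (w : 'cV[C]_N) : (col_mx u (col_mx v w) : 'cV_N.+2) 1 0 = v 0 0.
Proof.
rewrite (_ : (1 : 'I_N.+2) = @rshift 1 (1 + N) (@lshift 1 N 0)); last exact/val_inj.
exact: etrans (col_mxEd _ _ _ _) (col_mxEu _ _ _ _).
Qed.

Lemma Gamma0E U (x : 'cV[C]_N.+2) : Gamma0 L U = x <->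
  [/\ phi_at L U (- L) = x 0 0, phi_at L U L = x 1 0 &
      forall j, psi_L L U j 0 = x (lift 0 (lift 0 j)) 0].
Proof.
have G0 : Gamma0 L U 0 0 = phi_at L U (- L).
  exact: etrans (colE0 _ _) (mxE _ _ _ _).
have G1 : Gamma0 L U 1 0 = phi_at L U L.
  exact: etrans (colE1 _ _ _) (mxE _ _ _ _).
have G2 j : Gamma0 L U (lift 0 (lift 0 j)) 0 = psi_L L U j 0.
  rewrite (_ : lift 0 (lift 0 j) = @rshift 1 (1 + N) (@rshift 1 N j)); last exact/val_inj.
  exact: etrans (col_mxEd _ _ _ _) (col_mxEd _ _ _ _).
split=> [<-|[h0 h1 h2]]; first by split.
apply/colP => i; case: (unliftP 0 i) => [k ->|->]; last by rewrite G0.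
case: (unliftP 0 k) => [j ->|->]; first by rewrite G2.
rewrite (_ : lift 0 0 = 1); last exact/val_inj.
by rewrite G1.
Qed.

(** The values on the loop and on the legs are free: the conditions fix only the jump, again placed
    entirely at $-L$, and the leg derivatives. *)
Lemma bcond_exists a b M (p : C) (s : 'cV[C]_N) : exists U,
  [/\ gH2 L U, bcond a b M (bvals L U), phi_at L U (- L) = p, phi_at L U L = p & psi_L L U = s].
Proof.
pose t : 'cV[C]_N := \col_j (r2 * p * b j 0 + \sum_k M j k * s k 0).
have [U [hU bU]] := bdata_ex hL
  (p, (2 * a)%:C * p + r2 * \sum_j (b j 0)^* * s j 0, p, 0, s, t).
exists U; split=> //; first by rewrite bU; split=> //; [rewrite subr0|move=> j; rewrite mxE].
- by case: bU.
- by case: bU.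
- by case: bU.
Qed.

Lemma Gamma0_Hpar a b M :
  @Gamma0 R L N @` gdom (Hpar L (a, b, M)) = [set x : 'cV[C]_N.+2 | x 0 0 = x 1 0].
Proof.
apply/seteqP; split=> [_ [U /gdom_Hpar[hU [e _ _]] <-]|x /= x01].
  by have [] := (Gamma0E U _).1 erefl => /= <- <- _.
have [U [hU bU u1 u2 u3]] := bcond_exists a b M (x 0 0) (\col_j x (lift 0 (lift 0 j)) 0).
exists U; first by apply/gdom_Hpar.
apply/Gamma0E; split=> //; first by rewrite u2.
by move=> j; rewrite u3 mxE.
Qed.

Lemma Hpar_looping p : p \in @param_set R N -> looping_extension L (Hpar L p).
Proof.
move=> hp; split; first exact: Hpar_self_adjoint.
  by case: p hp => [[a b] M] _; exact: H0_sub_Hpar.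
by case: p hp => [[a b] M] _; exact: Gamma0_Hpar.
Qed.

(** The parameters are read off the domain: an element with loop value 1 and leg values 0 gives [a]
    and [b], those with loop value 0 and a unit vector on the legs give the columns of [M]. *)
Lemma Hpar_inj (p q : param R N) : Hpar L p = Hpar L q -> p = q.
Proof.
case: p q => [[a b] M] [[a' b'] M'] E.
have E' U : gH2 L U -> bcond a b M (bvals L U) -> bcond a' b' M' (bvals L U).
  by move=> h1 h2; have /gdom_Hpar[] : gdom (Hpar L (a', b', M')) U by rewrite -E; apply/gdom_Hpar.
have [U [hU bU u1 u2 u3]] := bcond_exists a b M 1 0.
have [_ e1 e2] := bU; have [_ e3 e4] := E' _ hU bU.
have s0 (c c' : 'cV[C]_N) : \sum_j (c j 0)^* * (0 : 'cV[C]_N) j 0 = 0.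
  by apply: big1 => j _; rewrite mxE mulr0.
have ea : a = a'.
  move: e3; rewrite e1 u1 u3 !s0// !mulr0 !addr0 !mulr1 => -[] /eqP.
  by rewrite (inj_eq (mulfI _)) ?pnatr_eq0// => /eqP.
have eb : b = b'.
  apply/colP => j; have := e4 j; rewrite e2 u1 u3 !mulr1.
  rewrite !big1 ?addr0; [|by move=> k _; rewrite mxE mulr0|by move=> k _; rewrite mxE mulr0].
  by move/(mulfI r2_neq0).
have eM : M = M'.
  apply/matrixP => j k.
  have [V [hV bV v1 v2 v3]] := bcond_exists a b M 0 (\col_i (i == k)%:R).
  have [_ _ f2] := bV; have [_ _ f4] := E' _ hV bV.
  have := f4 j; rewrite f2 v1 v3 !mulr0 !mul0r !add0r.
  have S (A : 'M[C]_N) : \sum_i A j i * (\col_i (i == k)%:R : 'cV[C]_N) i 0 = A j k.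
    by rewrite -[RHS](sum_delta k (A j)); apply: eq_bigr => i _; rewrite mxE.
  by rewrite !S.
by rewrite ea eb eM.
Qed.

Lemma isotropic_bcond (B : set (C * C * C * C * 'cV[C]_N * 'cV[C]_N)) :
  (forall z w, B z -> B w -> sform z w = 0) ->
  (forall p p' q q' s t, B (p, p', q, q', s, t) -> p = q) ->
  (forall p s, exists p' q' t, B (p, p', p, q', s, t)) ->
  exists a b M, M \is hermsymmx /\ forall z, B z -> bcond a b M z.
Proof.
move=> iso loopB exB.
have [y' [x' [v B0]]] := exB 1 0.
have /choice [f hf] : forall j : 'I_N, exists w : C * C * 'cV[C]_N,
    B (0, w.1.1, 0, w.1.2, \col_i (i == j)%:R, w.2).
  by move=> j; have [f [g [w hw]]] := exB 0 (\col_i (i == j)%:R); exists (f, g, w).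
have c0 j : (0 : 'cV[C]_N) j 0 = 0 by rewrite mxE.
have cd k (j : 'I_N) : (\col_i (i == k)%:R : 'cV[C]_N) j 0 = (j == k)%:R by rewrite mxE.
(* [v] holds the leg derivatives of the chosen lift of (1, 0); dividing by [r2] matches the factor
   in [Dpar]. Likewise the k-th column of [M] holds the leg derivatives of the lift of the k-th unit
   vector. *)
pose b : 'cV[C]_N := r2^-1 *: v.
pose M : 'M[C]_N := \matrix_(j, k) (f k).2 j 0.
have r2b j : r2 * b j 0 = v j 0 by rewrite mxE mulrA divff ?mul1r ?r2_neq0.
have eq0 p p' q q' s t : B (p, p', q, q', s, t) ->
    p' - q' = (y' - x')^* * p + \sum_j (v j 0)^* * s j 0.
  move=> Bz; have := iso _ _ Bz B0; rewrite /sform -(loopB _ _ _ _ _ _ Bz) rmorph1.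
  have -> : \sum_(j < N) (t j 0 * ((0 : 'cV[C]_N) j 0)^* - s j 0 * (v j 0)^*) =
      - \sum_j (v j 0)^* * s j 0.
    by rewrite -sumrN; apply: eq_bigr => j _; rewrite c0 rmorph0; ring.
  move=> h; apply/eqP; rewrite -subr_eq0; apply/eqP; rewrite -[RHS]h rmorphB; ring.
have eqj p p' q q' s t j : B (p, p', q, q', s, t) ->
    t j 0 = p * ((f j).1.1 - (f j).1.2)^* + \sum_k ((f j).2 k 0)^* * s k 0.
  move=> Bz; have := iso _ _ Bz (hf j); rewrite /sform -(loopB _ _ _ _ _ _ Bz) rmorph0.
  have -> : \sum_(k < N) (t k 0 * ((\col_i (i == j)%:R : 'cV[C]_N) k 0)^* -
      s k 0 * ((f j).2 k 0)^*) = t j 0 - \sum_k ((f j).2 k 0)^* * s k 0.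
    rewrite sumrB; congr (_ - _).
      by rewrite -[RHS](sum_delta j (fun k => t k 0)); apply: eq_bigr => k _; rewrite cd rmorph_nat.
    by apply: eq_bigr => k _; rewrite mulrC.
  move=> h; apply/eqP; rewrite -subr_eq0; apply/eqP; rewrite -[RHS]h rmorphB; ring.
(* Pairing the two kinds of lifts shows that the jump condition and the leg condition involve the
   same vector up to conjugation, which is why a single [b] occurs twice. *)
have hb j : (f j).1.1 - (f j).1.2 = (v j 0)^*.
  rewrite (eq0 _ _ _ _ _ _ (hf j)) mulr0 add0r -[RHS](sum_delta j (fun k => (v k 0)^*)).
  by apply: eq_bigr => k _; rewrite cd.
(* Two unit-vector lifts are paired: both have loop value 0, so only the leg terms remain. *)
have hM : M \is hermsymmx.
  apply/hermP => j k; rewrite !mxE (eqj _ _ _ _ _ _ _ (hf k)) mul0r add0r.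
  rewrite -[RHS](sum_delta k (fun i => ((f j).2 i 0)^*)).
  by apply: eq_bigr => i _; rewrite cd.
(* The lift of (1, 0) paired with itself: its jump is real, and [a] is half of it. *)
have alr : y' - x' = (y' - x')^*.
  rewrite {1}(eq0 _ _ _ _ _ _ B0) mulr1 big1 ?addr0// => j _.
  by rewrite c0 mulr0.
pose a : R := complex.Re (y' - x') / 2.
have al2 : y' - x' = (2 * a)%:C.
  rewrite /a mulrC divfK ?pnatr_eq0//; apply: complexP => //=.
  have := congr1 (@complex.Im R) alr; rewrite cIm_conj => h; lra.
exists a, b, M; split=> // -[[[[[p p'] q] q'] s] t] Bz; split; first exact: loopB Bz.
  rewrite (eq0 _ _ _ _ _ _ Bz) -alr al2 mulr_sumr; congr (_ + _); apply: eq_bigr => j _.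
  by rewrite -r2b rmorphM/= conj_real mulrA.
move=> j; rewrite (eqj _ _ _ _ _ _ j Bz) hb conjCK -r2b; congr (_ + _); first ring.
apply: eq_bigr => k _; congr (_ * _).
by rewrite (hermP _ hM j k) mxE.
Qed.

(* Once A is contained in some Hpar L p, equality is automatic: both operators
   are self-adjoint and taking adjoints reverses inclusions. *)
Lemma looping_is_Hpar A : looping_extension L A ->
  exists2 p, p \in @param_set R N & A = Hpar L p.
Proof.
move=> [[opA dA AA] H0A GA].
have maxA V W : A (V, W) -> gH2 L V /\ eqG L W (weak_laplacian L V).
  rewrite {1}AA => -[/= lV lW h]; apply: H0_adjoint => // U Z /H0A; exact: h.
have symA U U' : gdom A U -> gdom A U' -> sform (bvals L U) (bvals L U') = 0.
  move=> [Z AZ] [Z' AZ'].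
  have [hU eZ] := maxA _ _ AZ; have [hU' eZ'] := maxA _ _ AZ'.
  have [ran _ _ _ _] := opA; have [_ lZ] := ran _ _ AZ; have [_ lZ'] := ran _ _ AZ'.
  have : ginner L Z U' = ginner L U Z' by move: AZ'; rewrite {1}AA => -[/= _ _]; exact.
  have lU := gH2_gL2 hU; have lU' := gH2_gL2 hU'.
  rewrite (ginner_eqG hL lZ (gL2_laplacian hL hU) lU' lU' eZ (eqG_refl _ _)).
  rewrite (ginner_eqG hL lU lU lZ' (gL2_laplacian hL hU') (eqG_refl _ _) eZ').
  by move=> E; rewrite -bformE -graph_green// E subrr.
have [|||a [b [M [hM subM]]]] := isotropic_bcond (B := @bvals R L N @` gdom A).
- by move=> _ _ [U dU <-] [V dV <-]; exact: symA.
(* That boundary values lie in the plane [x 0 0 = x 1 0] gives the looping condition; that they fill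
   it, used next, supplies the lifts from which the parameters are read. *)
- move=> p p' q q' s t [U dU [<- _ <- _ _ _]].
  have : (@Gamma0 R L N @` gdom A) (Gamma0 L U) by exists U.
  by rewrite GA /=; have [<- <- _] := (Gamma0E U _).1 erefl.
- move=> p s.
  pose x : 'cV[C]_N.+2 := col_mx (const_mx p : 'cV_1) (col_mx (const_mx p : 'cV_1) s).
  have : (@Gamma0 R L N @` gdom A) x.
    rewrite GA /=.
    exact: etrans (colE0 _ _) (etrans (mxE _ _ _ _) (esym (etrans (colE1 _ _ _) (mxE _ _ _ _)))).
  move=> [U dU]; rewrite /Gamma0 /x => E.
  have [/colP/(_ 0) h1 E1] := @eq_col_mx C 1 (1 + N) 1 _ _ _ _ E.
  have [/colP/(_ 0) h2 h3] := eq_col_mx E1.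
  exists (phi'_at L U (- L)), (phi'_at L U L), (psi'_L L U), U => //.
  by rewrite /bvals h3; move: h1 h2; rewrite !mxE => -> ->.
exists (a, b, M); first by rewrite inE.
have sub : A `<=` Hpar L (a, b, M).
  move=> [U Z] AZ; have [hU eZ] := maxA _ _ AZ.
  have [ran _ _ _ _] := opA; have [_ lZ] := ran _ _ AZ.
  apply/HparP; split; [exact: hU| |exact: lZ|exact: eZ].
  by apply: subM; exists U => //; exists Z.
apply/seteqP; split=> // -[U Z].
rewrite (Hpar_self_adjoint_eq a b hM) AA => -[/= lU lZ h]; split=> //= U' Z' AZ'.
exact/h/sub.
Qed.

End SelfAdjoint.

(** * Real coordinates on the parameter set *)

Section RealParameters.
Variables (R : realType) (N : nat).
Local Notation C := R[i].
Implicit Type v : 'rV[R]_((N + 1) ^ 2).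

Local Notation inner_ix := (lshift 1).
Local Notation last_ix := (rshift N (0 : 'I_1)).

Definition square_of v : 'M[R]_(N + 1) := vec_mx v.

Lemma square_of_axpy s u v i j :
  square_of (s *: u + v) i j = s * square_of u i j + square_of v i j.
Proof. by rewrite /square_of linearP !mxE. Qed.

(** Up to conjugate symmetry each real entry of the block is used exactly once, so the result is
    Hermitian by construction and determines the block. *)
Definition herm_entry (A : 'M[R]_(N + 1)) (j k : 'I_N) : C :=
  if (j < k)%N then A (inner_ix j) (inner_ix k) +i* A (inner_ix k) (inner_ix j)
  else if (k < j)%N then A (inner_ix k) (inner_ix j) -i* A (inner_ix j) (inner_ix k)
  else (A (inner_ix j) (inner_ix j))%:C.

(* A square matrix of real numbers is cut into a diagonal corner, the last
   column and row, and a square block whose upper and lower triangles are the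
   real and imaginary parts of a Hermitian matrix. *)
Definition real_param v : param R N :=
  let A := square_of v in
  (A last_ix last_ix, \col_j (A (inner_ix j) last_ix +i* A last_ix (inner_ix j)),
   \matrix_(j, k) herm_entry A j k).

Lemma real_param_linear : real_linear real_param.
Proof.
move=> s u v; rewrite /real_param; congr (_, _, _); first exact: square_of_axpy.
  apply/colP => j; rewrite [LHS]mxE [RHS]mxE [X in _ = X + _]mxE [X in _ = _ * X + _]mxE [X in _ = _ + X]mxE.
  by apply: complexP; rewrite ?cReD ?cImD ?cReM ?cImM /= !square_of_axpy; ring.
apply/matrixP => j k; rewrite [LHS]mxE [RHS]mxE [X in _ = X + _]mxE [X in _ = _ * X + _]mxE [X in _ = _ + X]mxE.
by rewrite /herm_entry; case: ltnP => _; [|case: ltnP => _]; apply: complexP; rewrite ?cReD ?cImD ?cReM ?cImM /= ?square_of_axpy; ring.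
Qed.

Lemma real_param_herm v : param_set (real_param v).
Proof.
apply/hermP => j k; rewrite !mxE /herm_entry.
case: (ltngtP j k) => jk; apply: complexP; rewrite ?cRe_conj ?cIm_conj/= ?opprK ?oppr0//.
by rewrite (val_inj jk).
Qed.

Lemma herm_entry_inj (A B : 'M[R]_(N + 1)) : (forall j k, herm_entry A j k = herm_entry B j k) ->
  forall j k, A (inner_ix j) (inner_ix k) = B (inner_ix j) (inner_ix k).
Proof.
move=> E j k; case: (ltngtP j k) => jk.
- by have := E j k; rewrite /herm_entry jk => -[].
- by have := E k j; rewrite /herm_entry jk => -[].
- by have := E j k; rewrite /herm_entry jk ltnn => -[]; rewrite (val_inj jk).
Qed.

Lemma real_param_inj : injective real_param.
Proof.
move=> u v [ea /matrixP eb /matrixP eM]; apply: (can_inj (@vec_mxK R (N + 1) (N + 1))).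
have e j : square_of u (inner_ix j) last_ix +i* square_of u last_ix (inner_ix j) =
    square_of v (inner_ix j) last_ix +i* square_of v last_ix (inner_ix j).
  by have := eb j 0; rewrite !mxE.
have h := @herm_entry_inj (square_of u) (square_of v).
apply/matrixP => i k; rewrite -(splitK i) -(splitK k).
case: (fintype.split i) => [i'|i']; case: (fintype.split k) => [k'|k'] /=; rewrite ?(ord1 i') ?(ord1 k').
- by apply: h => a b; have := eM a b; rewrite !mxE.
- by case: (e i').
- by case: (e k').
- exact: ea.
Qed.

Lemma real_param_surj p : param_set p -> exists v, real_param v = p.
Proof.
case: p => [[a b] M]; rewrite /param_set/= => hM.
(* Undoes the cutting: below the diagonal the block holds the imaginary part of the mirrored upper
   entry of [M], elsewhere the real part. *)
pose A : 'M[R]_(N + 1) := block_mx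
  (\matrix_(j, k) if (k < j)%N then complex.Im (M k j) else complex.Re (M j k))
  (\col_j complex.Re (b j 0)) (\row_j complex.Im (b j 0)) a%:M.
exists (mxvec A); rewrite /real_param /square_of mxvecK; congr (_, _, _).
- by rewrite block_mxEdr mxE eqxx.
- by apply/colP => j; rewrite mxE block_mxEur block_mxEdl !mxE; case: (b j 0).
apply/matrixP => j k; rewrite mxE /herm_entry !block_mxEul !mxE.
have := hermP _ hM j k.
case: (ltngtP j k) => jk; rewrite ?ltnn.
- by case: (M j k).
- by move=> ->; apply: complexP; rewrite ?cRe_conj ?cIm_conj.
(* A diagonal entry equals its own conjugate, so its imaginary part is 0. *)
- rewrite (val_inj jk) => /(congr1 (@complex.Im R)); rewrite cIm_conj => h.
  by apply: complexP => //=; lra.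
Qed.

End RealParameters.

Theorem theorem5p3 (R : realType) (L : R) (N : nat)
    (hL : 0 < L) (hN : (1 <= N)%N) :
  set_bij (@param_set R N) [set A : opgraph R N | looping_extension L A]
    (@Hpar R L N) /\
  exists theta : 'rV[R]_((N + 1) ^ 2)%N -> param R N,
    real_linear theta /\ set_bij [set: 'rV[R]_((N + 1) ^ 2)%N] (@param_set R N) theta.
Proof.
split; [split|exists (@real_param R N); split; [exact: real_param_linear|split]].
- by move=> p hp; apply: Hpar_looping => //; rewrite inE.
- by move=> p q _ _; exact: Hpar_inj.
- by move=> A hA; have [p hp ->] := looping_is_Hpar hL hA; exists p => //; rewrite inE in hp.
- by move=> v _; exact: real_param_herm.
- by move=> u v _ _; exact: real_param_inj.
- by move=> p hp; have [v <-] := real_param_surj hp; exists v.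
Qed.
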